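(* Let $u,v:[0,T]\to\mathbb{R}$ be Borel measurable functions with $u\in L^1(dt)$ and $v\in L^2(dt)$. Let $g:\Omega\times[0,T]\times\mathbb{R}^m\times\mathbb{R}^{m\times d}\to\mathbb{R}^m$ be measurable, with $\int_0^T|g(s,0,0)|\,ds\in L^2$, and suppose there is a constant $K>0$ such that $$|g(t,y,z)-g(t,y',z')|\le K(|y-y'|+|z-z'|)$$ for all $y,y'\in\mathbb{R}^m$ and $z,z'\in\mathbb{R}^{m\times d}$. Let $\xi\in L^2(\mathbb{R}^m)$ be $\mathcal{F}_T$-measurable. For $i=1,2$ and $n\in\mathbb{N}$, let $\alpha_i^n$ be deterministic, finite measures supported on $[-T,0]$ such that $$K^2\,\alpha_1^n([-T,0])^2\,\|u\|_{L^1(dt)}^2\le\frac1{25},\qquad K^2\,\alpha_2^n([-T,0])^2\,\|v\|_{L^2(dt)}^2\le\frac1{25}$$ for all $n$, and such that $\alpha_i^n([-T,0])\to1$ as $n\to\infty$ for $i=1,2$. Let $\delta_0$ denote the Dirac measure at $0$. Suppose that $\alpha_1^n\le\delta_0$ for all $n$ (or $\delta_0\le\alpha_1^n$ for all $n$), and that $\alpha_2^n\le\delta_0$ for all $n$ (or $\delta_0\le\alpha_2^n$ for all $n$). Then $$\|Y^n-Y\|_{\mathcal{S}^2(\mathbb{R}^m)}\to0\quad\text{and}\quad\|Z^n-Z\|_{\mathcal{H}^2(\mathbb{R}^{m\times d})}\to0,$$ where $(Y^n,Z^n)\in\mathcal{S}^2(\mathbb{R}^m)\times\mathcal{H}^2(\mathbb{R}^{m\times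 d})$ is the solution of the delay BSDE (recalled in the context) with delay measures $(\alpha_1^n,\alpha_2^n)$ and $(Y,Z)\in\mathcal{S}^2(\mathbb{R}^m)\times\mathcal{H}^2(\mathbb{R}^{m\times d})$ is the solution of the BSDE without delay $$Y_t=\xi+\int_t^Tg(s,u(s)Y_s,v(s)Z_s)\,ds-\int_t^TZ_s\,dW_s,\quad t\in[0,T].$$
   Context: Let $T\in(0,\infty]$ (infinite horizon is allowed), $m,d\in\mathbb{N}$, and let $(\Omega,\mathcal{F},(\mathcal{F}_t)_{t\in[0,T]},P)$ be a filtered probability space whose filtration is generated by a $d$-dimensional Brownian motion $W$, is complete and right-continuous, with $\mathcal{F}=\mathcal{F}_T$. $\Omega\times[0,T]$ carries the predictable $\sigma$-algebra and Euclidean spaces their Borel $\sigma$-algebras; measurability of $g$ is understood with respect to these. Equalities and inequalities between random variables (resp. processes) hold $P$-a.s. (resp. $P\otimes dt$-a.e.). $\mathcal{S}^2(\mathbb{R}^m)$ is the space of predictable continuous $\mathbb{R}^m$-valued processes $X$ with $\|X\|_{\mathcal{S}^2}^2:=E[(\sup_{t\in[0,T]}|X_t|)^2]<\infty$. $\mathcal{H}^2(\mathbb{R}^{m\times d})$ is the space of predictable $\mathbb{R}^{m\times d}$-valued processes $Z$ with $\|Z\|_{\mathcal{H}^2}^2:=E[\int_0^T|Z_u|^2\,du]<\infty$. Processes (and the deterministic functions $u,v$) are extended by $0$ to $[-T,0)$. The spaces $L^1(dt),L^2(dt)$ are with respect to Lebesgue measure on $[0,T]$. All measures are nonnegative measures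 on $[-\infty,\infty]$ (with its Borel $\sigma$-algebra); $\alpha\le\beta$ means $\alpha(A)\le\beta(A)$ for every measurable set $A$. For measures $\beta_1,\beta_2$ on $[-T,0]$, the delay BSDE with delay measures $(\beta_1,\beta_2)$ is $$Y_t=\xi+\int_t^T g\left(s,\int_{-T}^0u(s+r)Y_{s+r}\,\beta_1(dr),\int_{-T}^0v(s+r)Z_{s+r}\,\beta_2(dr)\right)ds-\int_t^TZ_s\,dW_s,\quad t\in[0,T].$$ Under the smallness conditions $K^2\beta_1([-T,0])^2\|u\|_{L^1(dt)}^2\le\frac1{25}$ and $K^2\beta_2([-T,0])^2\|v\|_{L^2(dt)}^2\le\frac1{25}$ it has a unique solution in $\mathcal{S}^2(\mathbb{R}^m)\times\mathcal{H}^2(\mathbb{R}^{m\times d})$. *)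

(* Defs.v *)
From HB Require Import structures.
From mathcomp Require Import all_boot all_order all_algebra.
From mathcomp Require Import all_classical all_reals all_analysis.
From mathcomp Require Import measurable_realfun.

Set Implicit Arguments.
Unset Strict Implicit.
Unset Printing Implicit Defensive.
Import Order.TTheory GRing.Theory Num.Theory.
Import numFieldNormedType.Exports.

Local Open Scope classical_set_scope.
Local Open Scope ring_scope.
Local Open Scope ereal_scope.

(* The library norm on matrices is the maximum norm; this is the Euclidean
   (Frobenius) norm. *)
Definition enorm (R : realType) (p q : nat) (A : 'M[R]_(p, q)) : R :=
  Num.sqrt (\sum_i \sum_j (A i j) ^+ 2)%R.

Definition borel_mx (R : realType) (p q : nat) : set (set 'M[R]_(p, q)) :=
  <<s [set B : set 'M[R]_(p, q) | open B] >>.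

(* [S] plays the role of a sigma-algebra of subsets of [D]. *)
Definition measurable_wrt (R : realType) (U : Type) (D : set U)
    (S : set (set U)) (p q : nat) (f : U -> 'M[R]_(p, q)) : Prop :=
  forall B, borel_mx B -> S (D `&` f @^-1` B).

(* Time ranges over [0, T] with T in ]0, +oo]: when T = +oo the point +oo is a
   genuine time, so processes are indexed by \bar R. Lebesgue integrals in time
   are over the set [rtimes T] of real times. *)
Definition times (R : realType) (T : \bar R) : set (\bar R) :=
  [set t | 0 <= t <= T].

Definition rtimes (R : realType) (T : \bar R) : set R :=
  [set s | 0 <= s%:E <= T].

Definition delays (R : realType) (T : \bar R) : set (\bar R) :=
  [set r | - T <= r <= 0].

Definition ext0 (R : realType) (V : nmodType) (T : \bar R) (f : \bar R -> V)
    (t : \bar R) : V :=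
  if 0 <= t <= T then f t else 0%R.

Notation process Omega R p q := (Omega -> \bar R -> 'M[R]_(p, q)).

Section basis.
Context (R : realType) (dO : measure_display) (Omega : measurableType dO)
  (P : probability Omega R) (d : nat) (T : \bar R)
  (W : Omega -> R -> 'cV[R]_d).

(* The filtration generated by W and the P-null sets; at t = +oo it is
   generated by all the W_s. *)
Definition bfilt (t : \bar R) : set (set Omega) :=
  <<s [set A | (exists s B, [/\ (0 <= s)%R, s%:E <= t, borel_mx B
                              & A = (fun w => W w s) @^-1` B])
               \/ P.-negligible A] >>.

(* The last clause says that, for s < t, the increment W_t - W_s is independent
   of F_s with law N(0, (t - s) Id): it gives the joint probability of an event
   of F_s and of a product of Borel sets. The parameters of [normal_prob] are
   the mean and the standard deviation. *)
Definition brownian_motion : Prop :=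
  [/\ {ae P, forall w, W w 0%R = 0%R},
      {ae P, forall w, {within rtimes T, continuous (W w)}}
    & forall s t : R, (0 <= s)%R -> (s < t)%R -> t%:E <= T ->
      forall (A : set Omega) (B : 'I_d -> set R), bfilt s%:E A ->
      (forall i, measurable (B i)) ->
      P (A `&` [set w | forall i, B i ((W w t - W w s)%R i ord0)]) =
      P A * \prod_(i < d) normal_prob 0%R (Num.sqrt (t - s)%R) (B i)].

Definition brownian_basis : Prop :=
  [/\ brownian_motion,
      measure_is_complete P,
      (forall t A, 0 <= t -> t < T ->
         (forall s, t < s -> s <= T -> bfilt s A) -> bfilt t A)
    & bfilt T = [set A | measurable A]].

Definition pdom : set (Omega * \bar R) := [set x | times T x.2].

Definition predictable_sets : set (set (Omega * \bar R)) :=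
  <<s pdom, [set S | (exists A, bfilt 0 A /\ S = A `*` [set 0])
                  \/ (exists A s t, [/\ 0 <= s, s < t, t <= T, bfilt s A
                                    & S = A `*` [set r | s < r <= t]])] >>.

Definition predictable (p q : nat) (X : process Omega R p q) : Prop :=
  measurable_wrt pdom predictable_sets (fun x => X x.1 x.2).

Definition S2norm (p q : nat) (X : process Omega R p q) : \bar R :=
  'N[P]_2%:E [(fun w => ereal_sup [set (enorm (X w t))%:E | t in times T])].

Definition H2norm (p q : nat) (X : process Omega R p q) : \bar R :=
  (\int[P]_w \int[lebesgue_measure]_(s in rtimes T)
     ((enorm (X w s%:E)) ^+ 2)%:E) `^ 2^-1.

Definition in_S2 (p q : nat) (X : process Omega R p q) : Prop :=
  [/\ predictable X,
      {ae P, forall w, {within times T, continuous (X w)}}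
    & S2norm X < +oo].

Definition in_H2 (p q : nat) (X : process Omega R p q) : Prop :=
  predictable X /\ H2norm X < +oo.

(* Simple predictable integrands
   sum_k c_k 1_{]l_k, r_k]} with c_k bounded and F_{l_k}-measurable. *)
Record simple_integrand (m : nat) := SimpleIntegrand {
  si_size : nat ;
  si_l : 'I_si_size -> R ;
  si_r : 'I_si_size -> R ;
  si_coef : 'I_si_size -> Omega -> 'M[R]_(m, d) ;
  si_l0 : forall k, (0 <= si_l k)%R ;
  si_lr : forall k, (si_l k <= si_r k)%R ;
  si_rT : forall k, (si_r k)%:E <= T ;
  si_meas : forall k, measurable_wrt setT (bfilt (si_l k)%:E) (si_coef k) ;
  si_bounded : forall k, exists C : R, forall w, (enorm (si_coef k w) <= C)%R
}.

Definition si_process (m : nat) (H : simple_integrand m) :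
    process Omega R m d := fun w t =>
  (\sum_(k < si_size H) (if ((si_l k)%:E < t <= (si_r k)%:E)%E
           then si_coef k w else 0))%R.

(* [fine] is harmless: the minimum of a nonnegative time and a real number is a
   real number. *)
Definition si_integral (m : nat) (H : simple_integrand m) :
    process Omega R m 1 := fun w t =>
  (\sum_(k < si_size H) (si_coef k w *m
     (W w (fine (Order.min t (si_r k)%:E)) -
      W w (fine (Order.min t (si_l k)%:E)))))%R.

(* M is (a continuous version of) the stochastic integral of Z with respect to
   W, as an S^2-limit of integrals of simple integrands converging to Z in
   H^2. It is determined up to indistinguishability. *)
Definition ito_integral (m : nat) (Z : process Omega R m d)
    (M : process Omega R m 1) : Prop :=
  in_S2 M /\
  exists H : nat -> simple_integrand m,
    (H2norm (fun w t => si_process (H k) w t - Z w t)%R @[k --> \oo] --> 0) /\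
    (S2norm (fun w t => si_integral (H k) w t - M w t)%R @[k --> \oo] --> 0).

(* (Y, Z) in S^2 x H^2 solves
   Y_t = xi + int_t^T f(s, Y, Z) ds - int_t^T Z_s dW_s on [0, T], where the
   generator f may depend on the whole paths of Y and Z. *)
Definition bsde_solution (m : nat) (xi : Omega -> 'cV[R]_m)
    (f : process Omega R m 1 -> process Omega R m d -> Omega -> R -> 'cV[R]_m)
    (Y : process Omega R m 1) (Z : process Omega R m d) : Prop :=
  [/\ in_S2 Y, in_H2 Z &
    exists2 M : process Omega R m 1, ito_integral Z M &
    {ae P, forall w, forall t, times T t ->
      Y w t = (xi w
        + \col_i (\int[lebesgue_measure]_(s in [set s : R | (t <= s%:E <= T)%E])
                    (f Y Z w s i ord0))
        - (M w T - M w t))%R}].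

Definition generator (m : nat) :=
  Omega -> \bar R -> 'cV[R]_m -> 'M[R]_(m, d) -> 'cV[R]_m.

Definition measurable_generator (m : nat) (g : generator m) : Prop :=
  measurable_wrt (pdom `*` [set: 'cV[R]_m] `*` [set: 'M[R]_(m, d)])
    <<s pdom `*` [set: 'cV[R]_m] `*` [set: 'M[R]_(m, d)],
      [set S | exists A B C, [/\ predictable_sets A, borel_mx B, borel_mx C
                              & S = A `*` B `*` C]] >>
    (fun x => g x.1.1.1 x.1.1.2 x.1.2 x.2).

(* int_{-T}^0 c(s + r) X_{s + r} beta(dr), entrywise *)
Definition delay_integral (p q : nat) (c : \bar R -> R)
    (beta : {finite_measure set (\bar R) -> \bar R})
    (X : process Omega R p q) (w : Omega) (s : R) : 'M[R]_(p, q) :=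
  (\matrix_(i, j) \int[beta]_(r in delays T)
     (ext0 T c (s%:E + r)%E * ext0 T (X w) (s%:E + r)%E i j))%R.

Definition delay_bsde_solution (m : nat) (g : generator m) (u v : \bar R -> R)
    (xi : Omega -> 'cV[R]_m)
    (beta1 beta2 : {finite_measure set (\bar R) -> \bar R}) :=
  bsde_solution xi (fun Y Z w s =>
    g w s%:E (delay_integral u beta1 Y w s) (delay_integral v beta2 Z w s)).

Definition nodelay_bsde_solution (m : nat) (g : generator m)
    (u v : \bar R -> R) (xi : Omega -> 'cV[R]_m) :=
  bsde_solution xi (fun Y Z w s =>
    g w s%:E (u s%:E *: Y w s%:E)%R (v s%:E *: Z w s%:E)%R).

End basis.

(* The norm of L^p(dt) for functions on [0, T]. *)
Definition Lpnorm (R : realType) (T : \bar R) (p : \bar R) (c : \bar R -> R) :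
    \bar R :=
  'N[@lebesgue_measure R]_p [(fun s => (ext0 T c s%:E)%:E)].

Definition measure_le (R : realType)
    (alpha beta : {measure set (\bar R) -> \bar R}) : Prop :=
  forall A : set (\bar R), measurable A -> alpha A <= beta A.

(* Main.v *)
Require Import Defs.
From HB Require Import structures.
From mathcomp Require Import all_boot all_order all_algebra.
From mathcomp Require Import all_classical all_reals all_analysis.
From mathcomp Require Import measurable_realfun.
From mathcomp Require Import ring lra.

Set Implicit Arguments.
Unset Strict Implicit.
Unset Printing Implicit Defensive.
Import Order.TTheory GRing.Theory Num.Theory.
Import numFieldNormedType.Exports.

Local Open Scope classical_set_scope.
Local Open Scope ring_scope.
Local Open Scope ereal_scope.

(** Let D = E(sup_t |Y^n_t - Y_t|^2) + E(int_0^T |Z^n_s - Z_s|^2 ds). The proof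
    bounds D by a constant times the squared defects of the total masses of the
    delay measures from 1.

    Stability ([bsde_stability]). Let f^n and f be the two drivers along the two
    solutions, G = int_0^T |f^n_s - f_s| ds, and let N be the difference of the two
    stochastic integrals. Both equations end at xi, so the square-integrable
    continuous martingale L_t = (Y^n - Y)_0 + N_t - N_0 ends at
    L_T = int_0^T (f^n_s - f_s) ds, and (Y^n - Y)_t - L_t is, up to sign, the
    integral of f^n - f over [0, t[. Thus |L_T| <= G and |(Y^n - Y)_t - L_t| <= G
    for all t. The isometry gives E(int |Z^n - Z|^2) <= E(L_T^2), as (Y^n - Y)_0
    is orthogonal to N_T - N_0, and the maximal inequality of Doob gives
    E(sup L^2) <= 4 E(L_T^2). Altogether D <= 10 E(G^2).

    Delays ([delay_integral_dist], [generator_delay_dist]). Averaging the shifts of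
    u X against a measure a on [-T, 0] is a convolution, so by translation
    invariance its L^1(dt) norm is at most a([-T, 0]) times that of u X, which is at
    most |u|_1 sup |X|; for v X the bound is |v|_2 |X|_2. With the Lipschitz property
    this bounds G. The delay measures acting on Y^n - Y and Z^n - Z contribute at
    most (sup |Y^n - Y| + |Z^n - Z|_2) / 5, which is what the smallness conditions
    say. The differences a - delta_0 acting on Y and Z contribute their total
    variation times a norm of (Y, Z). Since a and delta_0 are ordered, a - delta_0
    has a constant sign and its total variation is |a([-T, 0]) - 1|.

    Hence E(G^2) <= (9/100) D + k_n |(Y, Z)|^2 with k_n -> 0. As 10 * 9/100 < 1 the
    first term is absorbed, and D <= 100 k_n |(Y, Z)|^2 -> 0.

    The properties of the stochastic integral used above (martingale property,
    isometry, Doob) are derived from the independence and the law of the Brownian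
    increments, first for simple integrands and then in the limit. *)

(** * Moments of the centred Gaussian law *)

Section density.
Context d (T : measurableType d) (R : realType)
  (nu : {finite_measure set T -> \bar R})
  (mu : {sigma_finite_measure set T -> \bar R}) (p : T -> R).
Hypothesis mp : measurable_fun setT p.
Hypothesis nuE : forall A, measurable A -> nu A = \int[mu]_(x in A) (p x)%:E.

(** The Radon-Nikodym derivative is the density almost everywhere, so the change of
    variables formula for the former holds for the latter. *)
Lemma ge0_integral_density (h : T -> \bar R) : measurable_fun setT h ->
  (forall x, 0 <= h x) ->
  \int[nu]_x h x = \int[mu]_x (h x * (p x)%:E).
Proof.
move=> mh h0.
have numu : nu `<< mu.
  apply/null_content_dominatesP => A mA muA0; rewrite nuE//.
  apply: null_set_integral => //; first exact/measurable_funTS/measurable_EFinP.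
rewrite -(Radon_Nikodym_SigmaFinite.change_of_variables numu)//.
have := Radon_Nikodym_SigmaFinite.f_integrable numu; set f := Radon_Nikodym_SigmaFinite.f _ _; move=> intf.
have mf : measurable_fun setT f by exact: measurable_int intf.
apply: ae_eq_integral => //.
- exact: emeasurable_funM.
- by apply: emeasurable_funM => //; exact/measurable_EFinP.
have : ae_eq mu setT f (EFin \o p).
  apply: integral_ae_eq => //; first exact/measurable_EFinP.
  move=> E _ mE; rewrite -nuE// [RHS](Radon_Nikodym_SigmaFinite.f_integral numu)//.
exact: ae_eqe_mul2l.
Qed.

End density.

Section gaussian.
Context (R : realType) (s : R) (s0 : (0 < s)%R).
Let mu := @lebesgue_measure R.
Let f := normal_pdf 0 s.

Let sn0 : s != 0%R. Proof. by rewrite gt_eqF. Qed.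
Let fE x : f x = (normal_peak s * expR (- x ^+ 2 / (s ^+ 2 *+ 2)))%R.
Proof. by rewrite /f normal_pdfE// /normal_fun subr0. Qed.
Let f0 x : (0 <= f x)%R. Proof. exact: normal_pdf_ge0. Qed.
Let cf : continuous f. Proof. exact: continuous_normal_pdf. Qed.
Let mf : measurable_fun setT f. Proof. exact: measurable_normal_pdf. Qed.
Let fN x : f (- x)%R = f x. Proof. by rewrite !fE sqrrN. Qed.

(** The Gaussian density f satisfies f' = - x f / s^2. Hence x f has the primitive
    - s^2 f, and x^2 f - s^2 f has the primitive - s^2 x f: both moments come from
    these two primitives. *)
Let dF (x : R) : is_derive x 1%R (fun x : R => - s ^+ 2 * f x)%R (x * f x)%R.
Proof.
have -> : f = (fun x => normal_peak s * expR (- x ^+ 2 / (s ^+ 2 *+ 2)))%R.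
  exact/funext.
apply: is_derive_eq; rewrite /GRing.scale/=.
by field.
Qed.

Let dG (x : R) : is_derive x 1%R (fun x : R => - s ^+ 2 * (x * f x))%R
  (x ^+ 2 * f x - s ^+ 2 * f x)%R.
Proof.
have -> : (fun x => - s ^+ 2 * (x * f x))%R = (fun x => x * (- s ^+ 2 * f x))%R.
  by apply/funext => y; ring.
have h := dF x.
apply: (@is_derive_eq _ _ _ _ _ _ _ _ (@is_deriveM _ _ id _ x 1%R _ _ (is_derive_id x 1%R) h)).
rewrite /GRing.scale/=.
by ring.
Qed.

(** From 1 + y <= exp y with y = x^2 / (2 s^2); it makes x f(x) vanish at infinity. *)
Let f_ub (x : R) : (0 < x)%R -> (x ^+ 2 * f x <= normal_peak s * (s ^+ 2 *+ 2))%R.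
Proof.
move=> x0; rewrite fE mulNr expRN mulrCA ler_wpM2l ?normal_peak_ge0//.
have s2 : (0 < s ^+ 2 *+ 2)%R by rewrite pmulrn_lgt0// exprn_gt0.
rewrite ler_pdivrMr ?expR_gt0// mulrC -ler_pdivrMr//.
by rewrite (le_trans _ (expR_ge1Dx _))// lerDr.
Qed.

Let lim_xf : (x * f x)%R @[x --> +oo%R] --> (0 : R)%R.
Proof.
apply: (@squeeze_cvgr _ _ _ _ (cst 0%R)
  (fun x => (normal_peak s * (s ^+ 2 *+ 2)) * x^-1)%R).
- near=> x.
  have x0 : (0 < x)%R by near: x; exact: nbhs_pinfty_gt.
  apply/andP; split; first by rewrite mulr_ge0// ltW.
  by rewrite /= ler_pdivlMr// mulrAC -expr2 f_ub.
- exact: cvg_cst.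
- rewrite -[X in _ --> X](mulr0 (normal_peak s * (s ^+ 2 *+ 2))%R).
  apply: cvgM; first exact: cvg_cst.
  by apply/gtr0_cvgV0; [near do exact|exact: cvg_id].
Unshelve. all: by end_near. Qed.

Let lim_f : (- s ^+ 2 * f x)%R @[x --> +oo%R] --> (0 : R)%R.
Proof.
rewrite -[X in _ --> X](mulr0 (- s ^+ 2)%R).
apply: cvgM; first exact: cvg_cst.
apply: (@squeeze_cvgr _ _ _ _ (cst 0%R) (fun x => x * f x)%R) => //.
  near=> x; rewrite f0 ler_peMl//.
exact: cvg_cst.
Unshelve. all: by end_near. Qed.

Let int_xf : \int[mu]_(x in `[0%R, +oo[) (x * f x)%:E = (s ^+ 2 * f 0)%:E.
Proof.
rewrite (@ge0_continuous_FTC2y R (fun x => x * f x)%R (fun x => - s ^+ 2 * f x)%R 0 0).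
- by rewrite -EFinB mulNr sub0r opprK.
- by move=> x x0; rewrite mulr_ge0.
- apply: continuous_subspaceT => x; apply: cvgM; [exact: cvg_id|exact: cf].
- exact: lim_f.
- by move=> x _; exact: ex_derive.
- by apply: cvg_at_right_filter; apply: cvgM; [exact: cvg_cst|exact: cf].
- by move=> x _; rewrite derive1E; exact: derive_val.
Qed.

Let int_f : \int[mu]_(x in `[0%R, +oo[) (f x)%:E = (2^-1)%:E.
Proof.
have := integral_normal_pdf 0 s; rewrite ge0_symfun_integralT//; last first.
  by move=> x /=; rewrite -/f fN.
rewrite -set_itvcy => /(congr1 (fun x => (2^-1)%:E * x)).
by rewrite muleA -EFinM mulVf// mul1e mule1.
Qed.

Let mx2f : measurable_fun setT (fun x : R => (x ^+ 2 * f x)%:E).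
Proof. by apply/measurable_EFinP/measurable_funM => //; exact: measurable_funX. Qed.

(** Integration by parts on [0, n + 1] instead of the half-line, since the integrand
    x^2 f - s^2 f of the primitive - s^2 x f changes sign; then n tends to infinity. *)
Let int_x2f : \int[mu]_(x in `[0%R, +oo[) (x ^+ 2 * f x)%:E = (s ^+ 2 / 2)%:E.
Proof.
pose F n : set R := `[0%R, n.+1%:R]%classic.
have ndF : {homo F : n m / (n <= m)%N >-> (n <= m)%O}.
  move=> n m nm; apply/subsetPset => x; rewrite /F/= !in_itv/= => /andP[-> /le_trans]; apply.
  by rewrite ler_nat.
have UF : \bigcup_n F n = `[0%R, +oo[%classic.
  apply/seteqP; split => x /=.
    by move=> [n _]; rewrite /F/= !in_itv/= => /andP[->].
  rewrite in_itv/= andbT => x0; exists (Num.truncn x) => //.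
  by rewrite /F/= in_itv/= x0/= ltW// truncnS_gt.
have c1 : \int[mu]_(x in F n) (x ^+ 2 * f x)%:E @[n --> \oo] -->
    \int[mu]_(x in `[0%R, +oo[) (x ^+ 2 * f x)%:E.
  rewrite -UF; apply: ge0_nondecreasing_set_cvg_integral => //.
  - by move=> i; exact: measurable_itv.
  - by move=> i; exact: measurable_funTS.
  - by move=> i x _; rewrite lee_fin mulr_ge0 ?sqr_ge0.
have c2 : \int[mu]_(x in F n) (f x)%:E @[n --> \oo] --> (2^-1)%:E.
  rewrite -int_f -UF; apply: ge0_nondecreasing_set_cvg_integral => //.
  - by move=> i; exact: measurable_itv.
  - by move=> i; exact/measurable_funTS/measurable_EFinP.
  - by move=> i x _; rewrite lee_fin.
have cnt (g : R -> R) A : continuous g -> {within A, continuous g}.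
  by move=> cg; exact: continuous_subspaceT.
have cg1 : continuous (fun x : R => x ^+ 2 * f x)%R.
  by move=> x; apply: cvgM; [exact: exprn_continuous|exact: cf].
have cg2 : continuous (fun x : R => s ^+ 2 * f x)%R.
  by move=> x; apply: cvgM; [exact: cvg_cst|exact: cf].
have step n : \int[mu]_(x in F n) (x ^+ 2 * f x)%:E =
    (s ^+ 2)%:E * \int[mu]_(x in F n) (f x)%:E +
    (- s ^+ 2 * (n.+1%:R * f n.+1%:R))%:E.
  have := @continuous_FTC2 R (fun x => x ^+ 2 * f x - s ^+ 2 * f x)%R
    (fun x => - s ^+ 2 * (x * f x))%R 0 n.+1%:R (ltr0Sn _ n).
  rewrite mul0r mulr0 sube0.
  have intc (g : R -> R) : continuous g -> mu.-integrable (F n) (EFin \o g).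
    move=> cg; apply: continuous_compact_integrable; first exact: segment_compact.
    exact: cnt.
  move=> <-.
  - under [X in _ + X]eq_integral do rewrite EFinB.
    rewrite integralB_EFin//=; [|exact: (intc _ cg1)|exact: (intc _ cg2)].
    under [X in _ + (_ - X)]eq_integral do rewrite EFinM.
    rewrite [X in _ + (_ - X)]integralZl//; last exact: (intc _ cf).
    rewrite addeCA subee ?adde0//.
    by apply/fin_numM => //; apply: integrable_fin_num; [exact: measurable_itv|exact: (intc _ cf)].
  - by apply: cnt => x; apply: cvgB; [exact: cg1|exact: cg2].
  - have cG : continuous (fun x : R => - s ^+ 2 * (x * f x))%R.
      by move=> x; apply: cvgM; [exact: cvg_cst|apply: cvgM; [exact: cvg_id|exact: cf]].
    split.
    + by move=> x _; exact: ex_derive.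
    + by apply: cvg_at_right_filter; exact: cG.
    + by apply: cvg_at_left_filter; exact: cG.
  - by move=> x _; rewrite derive1E; exact: derive_val.
apply/esym/(cvg_unique _ _ c1) => //.
rewrite /= (funext step).
rewrite -[X in _ --> X]adde0 (_ : (s ^+ 2 / 2)%:E = (s ^+ 2)%:E * (2^-1)%:E)//.
apply: cvgeD => //.
  by apply: cvgeZl.
apply: cvg_EFin; first by near=> n.
rewrite /comp/= -[X in _ --> X](mulr0 (- s ^+ 2)%R).
apply: cvgM; first exact: cvg_cst.
apply: (cvg_comp (fun n : nat => n.+1%:R : R) (fun x => x * f x)%R _ lim_xf).
by rewrite (cvg_shiftS (fun n => n%:R : R)); exact: cvgr_idn.
Unshelve. all: by end_near. Qed.

Let NE (h : R -> \bar R) : measurable_fun setT h -> (forall x, 0 <= h x) ->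
  \int[normal_prob 0 s]_x h x = \int[mu]_x (h x * (f x)%:E).
Proof. by move=> mh h0; apply: (@ge0_integral_density _ _ R (normal_prob 0%R s) mu f). Qed.

Lemma normal_second_moment :
  \int[normal_prob 0 s]_x (x ^+ 2)%:E = (s ^+ 2)%:E.
Proof.
rewrite NE//; [|exact/measurable_EFinP/measurable_funX|by move=> x; rewrite lee_fin sqr_ge0].
under eq_integral do rewrite -EFinM.
rewrite ge0_symfun_integralT.
- by rewrite -set_itvcy int_x2f -EFinM mulrCA mulfV// mulr1.
- by move=> x; rewrite mulr_ge0 ?sqr_ge0.
- by move=> x; apply: cvgM; [exact: exprn_continuous|exact: cf].
- by move=> x /=; rewrite sqrrN fN.
Qed.

Lemma normal_first_moment :
  (normal_prob 0 s).-integrable setT (fun x : R => x%:E) /\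
  \int[normal_prob 0 s]_x x%:E = 0.
Proof.
have mid : measurable_fun setT (fun x : R => x%:E) by exact/measurable_EFinP.
have ip : \int[normal_prob 0 s]_x (fun x : R => x%:E)^\+ x = (s ^+ 2 * f 0)%:E.
  rewrite NE//; last exact: measurable_funepos.
  rewrite -int_xf [RHS]integral_mkcond; apply: eq_integral => x _.
  rewrite patchE mem_setE in_itv/= andbT funeposE.
  by case: leP => x0; [rewrite max_l|rewrite max_r ?mul0e// lee_fin ltW].
have im : \int[normal_prob 0 s]_x (fun x : R => x%:E)^\- x = (s ^+ 2 * f 0)%:E.
  rewrite NE//; last exact: measurable_funeneg.
  transitivity (\int[mu]_(x in `]-oo, (- 0)%R]) (- x * f x)%:E).
    rewrite [RHS]integral_mkcond; apply: eq_integral => x _.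
    rewrite patchE mem_setE in_itv/= oppr0 funenegE.
    case: leP => x0; first by rewrite max_l// lee_fin oppr_ge0.
    by rewrite max_r ?mul0e// lee_fin oppr_le0 ltW.
  rewrite ge0_integration_by_substitutionNy.
  - by rewrite -int_xf; apply: eq_integral => x _ /=; rewrite opprK fN.
  - apply: continuous_subspaceT => x; apply: cvgM; [|exact: cf].
    exact: (@cvgN _ R^o).
  - by move=> x; rewrite in_itv/= oppr0 => x0; rewrite mulr_ge0// oppr_ge0 ltW.
split; last by rewrite integralE ip im subee.
apply/integrableP; split => //.
rewrite (_ : (fun x => _) = (fun x : R => x%:E)^\+ \+ (fun x : R => x%:E)^\-)%E; last first.
  by rewrite -fune_abse.
rewrite ge0_integralD//; [by rewrite ip im ltry|exact: measurable_funepos|exact: measurable_funeneg].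
Qed.

End gaussian.

(** * Euclidean norm and Borel sets of matrices *)

Section euclidean_norm.
Context (R : realType) (p q : nat).
Implicit Types A B : 'M[R]_(p, q).
Local Open Scope ring_scope.

Definition mxdot A B : R := \sum_i \sum_j A i j * B i j.

Lemma mxdot_xx A : mxdot A A = \sum_i \sum_j (A i j) ^+ 2.
Proof. by []. Qed.

Lemma enorm_ge0 A : 0 <= enorm A. Proof. exact: sqrtr_ge0. Qed.

Lemma sqr_enorm A : enorm A ^+ 2 = \sum_i \sum_j (A i j) ^+ 2.
Proof.
by rewrite sqr_sqrtr// sumr_ge0// => i _; rewrite sumr_ge0// => j _; rewrite sqr_ge0.
Qed.

Lemma mxdotDl A B C : mxdot (A + B) C = mxdot A C + mxdot B C.
Proof.
rewrite -big_split/=; apply: eq_bigr => i _; rewrite -big_split/=.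
by apply: eq_bigr => j _; rewrite mxE mulrDl.
Qed.

Lemma mxdotC A B : mxdot A B = mxdot B A.
Proof. by do 2 apply: eq_bigr => ? _; rewrite mulrC. Qed.

Lemma mxdotZl c A B : mxdot (c *: A) B = c * mxdot A B.
Proof.
rewrite mulr_sumr; apply: eq_bigr => i _; rewrite mulr_sumr.
by apply: eq_bigr => j _; rewrite mxE mulrA.
Qed.

Lemma sqr_enormZ c A : enorm (c *: A) ^+ 2 = c ^+ 2 * enorm A ^+ 2.
Proof. by rewrite !sqr_enorm -!mxdot_xx mxdotZl mxdotC mxdotZl mulrA. Qed.

Lemma enormZ c A : enorm (c *: A) = `|c| * enorm A.
Proof.
apply/eqP; rewrite -(@eqrXn2 _ 2)// ?enorm_ge0 ?mulr_ge0 ?enorm_ge0//.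
by rewrite sqr_enormZ exprMn real_normK ?num_real.
Qed.

Lemma enormN A : enorm (- A) = enorm A.
Proof. by rewrite -scaleN1r enormZ normrN1 mul1r. Qed.

Lemma enormC A B : enorm (A - B) = enorm (B - A).
Proof. by rewrite -enormN opprB. Qed.

Lemma enorm0 : enorm (0 : 'M[R]_(p, q)) = 0.
Proof. by rewrite -(scale0r 0) enormZ normr0 mul0r. Qed.

Lemma enorm_eq0 A : enorm A = 0 -> A = 0.
Proof.
move=> A0; apply/matrixP => i j; rewrite mxE; apply/eqP.
move: A0 => /(congr1 (fun x => x ^+ 2)); rewrite sqr_enorm expr0n/= => /eqP.
rewrite psumr_eq0 => [/allP/(_ i (mem_index_enum _))/=|? _]; last first.
  by rewrite sumr_ge0// => ? _; rewrite sqr_ge0.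
rewrite psumr_eq0 => [/allP/(_ j (mem_index_enum _))/=|? _]; last by rewrite sqr_ge0.
by rewrite sqrf_eq0.
Qed.

Lemma sqr_enormD A B :
  enorm (A + B) ^+ 2 = enorm A ^+ 2 + 2 * mxdot A B + enorm B ^+ 2.
Proof.
rewrite !sqr_enorm -!mxdot_xx !mxdotDl !(mxdotC _ (A + B)) !mxdotDl (mxdotC B A).
by ring.
Qed.

(** Cauchy-Schwarz: expand the square of |B| A - |A| B. *)
Lemma mxdot_le A B : mxdot A B <= enorm A * enorm B.
Proof.
have [A0|A0] := eqVneq (enorm A) 0.
  by rewrite A0 mul0r (enorm_eq0 A0) -(scale0r 0) mxdotZl mul0r.
have [B0|B0] := eqVneq (enorm B) 0.
  by rewrite B0 mulr0 (enorm_eq0 B0) -(scale0r 0) mxdotC mxdotZl mul0r.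
have := sqr_ge0 (enorm (enorm B *: A - enorm A *: B)).
rewrite sqr_enormD enormN -scaleNr !sqr_enormZ mxdotZl mxdotC mxdotZl mxdotC.
have a0 : 0 < enorm A by rewrite lt_def A0 enorm_ge0.
have b0 : 0 < enorm B by rewrite lt_def B0 enorm_ge0.
have ab0 := mulr_gt0 a0 b0.
move=> h; rewrite -(ler_pM2l ab0).
by lra.
Qed.

Lemma enormD A B : enorm (A + B) <= enorm A + enorm B.
Proof.
rewrite -(@ler_pXn2r _ 2)// ?nnegrE ?addr_ge0 ?enorm_ge0//.
by rewrite sqr_enormD; have := mxdot_le A B; nra.
Qed.

Lemma enorm_entry A i j : `|A i j| <= enorm A.
Proof.
rewrite -(@ler_pXn2r _ 2)// ?nnegrE ?enorm_ge0// sqr_enorm real_normK ?num_real//.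
rewrite (bigD1 i)//= (bigD1 j)//= -addrA lerDl addr_ge0//.
  by rewrite sumr_ge0// => ? _; rewrite sqr_ge0.
by rewrite sumr_ge0// => ? _; rewrite sumr_ge0// => ? _; rewrite sqr_ge0.
Qed.

(** Young's inequality; the weight c is chosen close to 0 when the first term must be
    kept almost unchanged. *)
Lemma sqr_enormD_le (c : R) A B : 0 < c ->
  enorm (A + B) ^+ 2 <= (1 + c) * enorm A ^+ 2 + (1 + c^-1) * enorm B ^+ 2.
Proof.
move=> c0; rewrite sqr_enormD.
have := mxdot_le A B; move: (enorm A) (enorm B) => a b h.
have : 0 <= c^-1 * (c * a - b) ^+ 2 by rewrite mulr_ge0 ?sqr_ge0// invr_ge0 ltW.
suff -> : c^-1 * (c * a - b) ^+ 2 = c * a ^+ 2 - 2 * (a * b) + c^-1 * b ^+ 2 by lra.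
by field; rewrite gt_eqF.
Qed.

End euclidean_norm.

Section borel_matrices.
Context (R : realType) (p q : nat).

Lemma borel_mx_coord (i : 'I_p) (j : 'I_q) (B : set R) : measurable B ->
  borel_mx [set M : 'M[R]_(p, q) | B (M i j)].
Proof.
move=> mB.
pose G := [set B : set 'M[R]_(p, q) | open B].
suff /(_ _ B mB) : @measurable_fun _ _ (g_sigma_algebraType G) R setT
    (fun M : 'M[R]_(p, q) => M i j) by rewrite setTI; apply.
apply: (measurability _ (RGenOpens.measurableE R)) => _ [_ [x [y ->]] <-].
rewrite setTI; apply: sub_sigma_algebra; rewrite /G/=.
apply: open_comp => // M _; exact: coord_continuous.
Qed.

Lemma measurable_wrt_coord (U : Type) (D : set U) (S : set (set U))
    (f : U -> 'M[R]_(p, q)) i j (B : set R) : measurable_wrt D S f ->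
  measurable B -> S (D `&` [set x | B (f x i j)]).
Proof. by move=> mf mB; exact: (mf _ (borel_mx_coord i j mB)). Qed.

(** An open set of matrices is a countable union of balls with rational centres, and
    a ball of the maximum norm is an intersection of conditions on the entries. *)
Lemma measurable_borel_mx d (U : measurableType d) (D : set U)
    (f : U -> 'M[R]_(p, q)) (B : set 'M[R]_(p, q)) : measurable D ->
  (forall i j, measurable_fun D (fun x => f x i j)) ->
  borel_mx B -> measurable (D `&` f @^-1` B).
Proof.
move=> mD mf.
pose C := [set B : set 'M[R]_(p, q) | measurable (D `&` f @^-1` B)].
suff : borel_mx (p := p) (q := q) `<=` C by apply.
apply: smallest_sub.
  split.
  - by rewrite /C/= preimage_set0 setI0.
  - move=> A CA; rewrite /C/= (_ : _ `&` _ = D `\` (D `&` f @^-1` A)).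
      exact: measurableD.
    by apply/seteqP; split => x /= [Dx]; [move=> [_ nA]; split => // -[]|
      move=> nA; split => //; split => // ?; apply: nA].
  - move=> F CF; rewrite /C/= preimage_bigcup setI_bigcupr.
    exact: bigcupT_measurable.
move=> O /= oO; rewrite /C/=.
pose bx (cn : 'M[rat]_(p, q) * nat) : set 'M[R]_(p, q) :=
  ball (map_mx ratr cn.1 : 'M[R]_(p, q)) (cn.2.+1%:R^-1).
rewrite (_ : f @^-1` O =
    \bigcup_(cn in [set cn | bx cn `<=` O]) (f @^-1` bx cn)); last first.
  apply/seteqP; split => [x /= Ox|x [cn /= cnO] /cnO//].
  move: (oO); rewrite openE => /(_ _ Ox)/nbhs_ballP[e /= e0 eO].
  have [n ne] : exists n : nat, (n.+1%:R^-1 < e / 2)%R.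
    have e20 : (0 < e / 2)%R by rewrite divr_gt0.
    by have [n _ /(_ n (leqnn n))] := near_infty_natSinv_lt (PosNum e20); exists n.
  have n0 : (0 < n.+1%:R^-1 :> R)%R by rewrite invr_gt0.
  have rc (r : R) : exists a : rat, (`|ratr a - r| < n.+1%:R^-1)%R.
    move: n0; move: (n.+1%:R^-1)%R => z z0.
    have rr : (r - z < r + z)%R by lra.
    have [a ha] := rat_in_itvoo rr.
    exists a; rewrite in_itv/= in ha; rewrite ltr_norml; lra.
  pose c : 'M[rat]_(p, q) := \matrix_(i, j) projT1 (cid (rc (f x i j))).
  have cx : bx (c, n) (f x).
    split => //= i j; rewrite !mxE.
    by case: cid => a /= ha; rewrite /ball/=.
  exists (c, n) => //= M cM; apply: eO.
  have h1 : ball (f x) (e / 2)%R (map_mx ratr c : 'M[R]_(p, q)).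
    by apply: ball_sym; apply: le_ball cx; exact/ltW.
  have h2 : ball (map_mx ratr c : 'M[R]_(p, q)) (e / 2)%R M.
    by apply: le_ball cM; exact/ltW.
  by rewrite [e]splitr; exact: ball_triangle h1 h2.
rewrite setI_bigcupr bigcup_mkcond.
apply: countable_bigcupT_measurable => // cn; case: ifPn => // _.
rewrite (_ : D `&` _ = \bigcap_(ij in [set: 'I_p * 'I_q])
    (D `&` [set x | (`|ratr (cn.1 ij.1 ij.2) - f x ij.1 ij.2| < cn.2.+1%:R^-1)%R])
    `&` D); last first.
  apply/seteqP; split => x.
    move=> [Dx [_ h]]; split => // -[i j] _; split => //=.
    by have := h i j; rewrite !mxE.
  move=> [h Dx]; split => //; split; first by rewrite invr_gt0.
  by move=> i j; have [_] := h (i, j) Logic.I; rewrite /= !mxE.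
apply: measurableI => //; apply: fin_bigcap_measurable => // -[i j] _ /=.
have mc : measurable_fun D (fun x => `|ratr (cn.1 i j) - f x i j|%R).
  apply: measurableT_comp => //; exact: measurable_funB.
have := mc mD `]-oo, (cn.2.+1%:R^-1)%R[%classic (measurable_itv _).
by congr (measurable (_ `&` _)); apply/seteqP; split => x /=; rewrite in_itv/=.
Qed.

End borel_matrices.

(** * Square-integrable random variables and independence *)

Section square_integrable.
Context dT (T : measurableType dT) (R : realType) (P : probability T R).
Implicit Types f g : T -> R.

Definition sqint f :=
  measurable_fun setT f /\ P.-integrable setT (fun w => (f w ^+ 2)%:E).

Lemma integrable_le f (h : T -> R) : measurable_fun setT f ->
  (forall w, `|f w| <= h w)%R -> P.-integrable setT (EFin \o h) ->
  P.-integrable setT (EFin \o f).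
Proof.
move=> mf fh; apply: le_integrable => //; first exact/measurable_EFinP.
by move=> w _ /=; rewrite lee_fin (le_trans (fh w))// ler_norm.
Qed.

Lemma integrableD_EFin f g : P.-integrable setT (EFin \o f) ->
  P.-integrable setT (EFin \o g) -> P.-integrable setT (fun w => (f w + g w)%:E).
Proof. by move=> h1 h2; exact: (integrableD measurableT h1 h2). Qed.

Lemma integrableZ_EFin c f : P.-integrable setT (EFin \o f) ->
  P.-integrable setT (fun w => (c * f w)%:E).
Proof. by move=> h1; exact: (integrableZl measurableT c h1). Qed.

Lemma sqint_mul_int f g : sqint f -> sqint g ->
  P.-integrable setT (fun w => (f w * g w)%:E).
Proof.
move=> [mf f2] [mg g2].
apply: (@integrable_le _ (fun w => f w ^+ 2 + g w ^+ 2)%R).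
- exact: measurable_funM.
- move=> w; rewrite normrM -(real_normK (num_real (f w))) -(real_normK (num_real (g w))).
  move: (normr_ge0 (f w)) (normr_ge0 (g w)); nra.
- exact: integrableD_EFin.
Qed.

Lemma sqintD f g : sqint f -> sqint g -> sqint (fun w => f w + g w)%R.
Proof.
move=> [mf f2] [mg g2]; split; first exact: measurable_funD.
apply: (@integrable_le _ (fun w => 2 * (f w ^+ 2 + g w ^+ 2))%R).
- by apply: measurable_funX; exact: measurable_funD.
- move=> w; rewrite ger0_norm ?sqr_ge0//.
  have := sqr_ge0 (f w - g w)%R; lra.
- by apply: integrableZ_EFin; exact: integrableD_EFin.
Qed.

Lemma sqintZ c f : sqint f -> sqint (fun w => c * f w)%R.
Proof.
move=> [mf f2]; split; first exact: measurable_funM.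
under eq_fun do rewrite exprMn; exact: integrableZ_EFin.
Qed.

Lemma sqintB f g : sqint f -> sqint g -> sqint (fun w => f w - g w)%R.
Proof.
move=> sf sg; have := sqintD sf (sqintZ (-1) sg).
by congr sqint; apply/funext => w; rewrite mulN1r.
Qed.

Lemma integrable_bounded f C : measurable_fun setT f ->
  (forall w, `|f w| <= C)%R -> P.-integrable setT (EFin \o f).
Proof.
move=> mf fC; apply: (integrable_le mf fC).
exact: finite_measure_integrable_cst.
Qed.

Lemma sqint_bounded f C : measurable_fun setT f -> (forall w, `|f w| <= C)%R ->
  sqint f.
Proof.
move=> mf fC; split => //.
apply: (@integrable_bounded _ (C ^+ 2)%R); first exact: measurable_funX.
by move=> w; rewrite normrX lerXn2r// nnegrE (le_trans _ (fC w)).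
Qed.

Lemma sqint_cst c : sqint (fun=> c).
Proof. by apply: (@sqint_bounded _ `|c|%R) => //. Qed.

Lemma sqint_int f : sqint f -> P.-integrable setT (EFin \o f).
Proof.
move=> sf; have := sqint_mul_int sf (sqint_cst 1).
by congr (_.-integrable setT); apply/funext => w; rewrite mulr1.
Qed.

Lemma sqint_sum (I : Type) (s : seq I) (F : I -> T -> R) :
  (forall i, sqint (F i)) -> sqint (fun w => \sum_(i <- s) F i w)%R.
Proof.
move=> sF; elim: s => [|i s IH].
  by under eq_fun do rewrite big_nil; exact: sqint_cst.
by under eq_fun do rewrite big_cons; exact: sqintD.
Qed.

Lemma integrable_boundedM f g C : measurable_fun setT f ->
  (forall w, `|f w| <= C)%R -> P.-integrable setT (EFin \o g) ->
  P.-integrable setT (fun w => (f w * g w)%:E).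
Proof.
move=> mf fC ig; have mg : measurable_fun setT g.
  by apply/measurable_EFinP; exact: measurable_int ig.
apply: (@integrable_le _ (fun w => C * `|g w|)%R).
- exact: measurable_funM.
- by move=> w; rewrite normrM ler_wpM2r.
- by apply: integrableZ_EFin; exact: (integrable_norm ig).
Qed.

Lemma sqint_boundedM f g C : measurable_fun setT f ->
  (forall w, `|f w| <= C)%R -> sqint g -> sqint (fun w => f w * g w)%R.
Proof.
move=> mf fC [mg g2]; split; first exact: measurable_funM.
under eq_fun do rewrite exprMn.
apply: (integrable_boundedM (C := (C ^+ 2)%R)) => //; first exact: measurable_funX.
by move=> w; rewrite normrX lerXn2r// nnegrE (le_trans _ (fC w)).
Qed.

Local Notation E f := (\int[P]_w f w)%R.

Lemma expD f g : P.-integrable setT (EFin \o f) -> P.-integrable setT (EFin \o g) ->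
  (E (fun w => f w + g w) = E f + E g)%R.
Proof. by move=> *; exact: RintegralD. Qed.

Lemma expZ c f : P.-integrable setT (EFin \o f) -> (E (fun w => c * f w) = c * E f)%R.
Proof. by move=> *; exact: RintegralZl. Qed.

Lemma exp_sum (I : Type) (s : seq I) (F : I -> T -> R) :
  (forall i, P.-integrable setT (EFin \o F i)) ->
  P.-integrable setT (EFin \o (fun w => \sum_(i <- s) F i w)%R) /\
  (E (fun w => \sum_(i <- s) F i w) = \sum_(i <- s) E (F i))%R.
Proof.
move=> sF; elim: s => [|i s [IH1 IH2]].
  split; first by under eq_fun do rewrite /comp/= big_nil; exact: finite_measure_integrable_cst.
  by under eq_Rintegral do rewrite big_nil; rewrite big_nil Rintegral_cst// mul0r.
split.
  have -> : (EFin \o (fun w => \sum_(j <- i :: s) F j w)%R) =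
      (fun w => (F i w + \sum_(j <- s) F j w)%:E).
    by apply/funext => w /=; rewrite big_cons.
  exact: integrableD_EFin.
under eq_Rintegral do rewrite big_cons.
by rewrite expD// IH2 big_cons.
Qed.

Lemma le_exp f g : P.-integrable setT (EFin \o f) -> P.-integrable setT (EFin \o g) ->
  (forall w, f w <= g w)%R -> (E f <= E g)%R.
Proof. by move=> ? ? fg; apply: le_Rintegral. Qed.

Lemma EFin_exp f : P.-integrable setT (EFin \o f) -> (E f)%:E = \int[P]_w (f w)%:E.
Proof. by move=> h; rewrite fineK//; exact: integrable_fin_num. Qed.

Lemma exp_ge0 f : (forall w, 0 <= f w)%R -> (0 <= E f)%R.
Proof. by move=> f0; exact: Rintegral_ge0. Qed.

(** The polynomial t |-> E((f - t g)^2) is nonnegative. *)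
Lemma cauchy_schwarz f g : sqint f -> sqint g ->
  ((E (fun w => f w * g w)) ^+ 2 <= E (fun w => f w ^+ 2) * E (fun w => g w ^+ 2))%R.
Proof.
move=> sf sg; have ifg := sqint_mul_int sf sg.
have [[mf f2] [mg g2]] := (sf, sg).
set a := E (fun w => f w ^+ 2)%R; set b := E (fun w => f w * g w)%R.
set c := E (fun w => g w ^+ 2)%R.
have quad t : (0 <= a + (-2 * t) * b + t ^+ 2 * c)%R.
  suff <- : E (fun w => (f w - t * g w) ^+ 2)%R = (a + (-2 * t) * b + t ^+ 2 * c)%R.
    by apply: exp_ge0 => w; exact: sqr_ge0.
  rewrite /a /b /c -expZ// -expZ// -expD//; last exact: integrableZ_EFin.
  rewrite -expD; [|by apply: integrableD_EFin => //; exact: integrableZ_EFin|exact: integrableZ_EFin].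
  by apply: eq_Rintegral => w _; ring.
have c0 : (0 <= c)%R by apply: exp_ge0 => w; exact: sqr_ge0.
have [c00|cn0] := eqVneq c 0%R.
  rewrite c00 mulr0; have [->|b0] := eqVneq b 0%R; first by rewrite expr0n.
  have := quad ((a + 1) / (2 * b))%R; rewrite c00 mulr0 addr0.
  suff -> : (a + (-2 * ((a + 1) / (2 * b))) * b = -1)%R by rewrite ler0N1.
  by field.
have cp : (0 < c)%R by rewrite lt_def cn0.
have := quad (b / c)%R.
suff -> : (a + -2 * (b / c) * b + (b / c) ^+ 2 * c = (a * c - b ^+ 2) / c)%R.
  by rewrite pmulr_lge0 ?invr_gt0// subr_ge0.
by field.
Qed.

End square_integrable.

Section independence.
Context dT (T : measurableType dT) (R : realType) (P : probability T R).

(** Rectangles are a pi-system that generates the product sigma-algebra. *)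
Lemma eq_measure_prod d1 d2 (T1 : measurableType d1) (T2 : measurableType d2)
    (m1 m2 : {measure set (T1 * T2) -> \bar R}) :
  m1 setT < +oo ->
  (forall A B, measurable A -> measurable B -> m1 (A `*` B) = m2 (A `*` B)) ->
  forall D, measurable D -> m1 D = m2 D.
Proof.
move=> m1T m12; apply: (measure_unique
  [set A `*` B | A in @measurable _ T1 & B in @measurable _ T2] (fun=> setT)).
- exact: measurable_prod_measurableType.
- move=> _ _ [A mA [B mB <-]] [A' mA' [B' mB' <-]]; rewrite -setXI.
  by exists (A `&` A'); [exact: measurableI|exists (B `&` B') => //; exact: measurableI].
- by move=> _; exists setT => //; exists setT => //; rewrite setXTT.
- by rewrite bigcup_const//; exists 0%N.
- by move=> _ [A mA [B mB <-]]; exact: m12.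
- by move=> _.
Qed.

(** Independence of C from the rectangles in (X1, X2) extends to all events in
    (X1, X2): as functions of the event both sides are finite measures. *)
Lemma indep_pair d1 d2 (T1 : measurableType d1) (T2 : measurableType d2)
    (X1 : T -> T1) (X2 : T -> T2) (C : set T) (c : \bar R) :
  measurable_fun setT X1 -> measurable_fun setT X2 -> measurable C ->
  c \is a fin_num -> 0 <= c ->
  (forall A B, measurable A -> measurable B ->
    P (X1 @^-1` A `&` X2 @^-1` B `&` C) = P (X1 @^-1` A `&` X2 @^-1` B) * c) ->
  forall D, measurable D ->
    P ((fun w => (X1 w, X2 w)) @^-1` D `&` C) =
    P ((fun w => (X1 w, X2 w)) @^-1` D) * c.
Proof.
move=> mX1 mX2 mC cfin c0 h D mD.
have mX : measurable_fun setT (fun w => (X1 w, X2 w)) by exact/measurable_fun_pair.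
pose r := NngNum (fine_ge0 c0).
pose m1 := measure_function_pushforward__canonical__measure_function_Measure
  (mrestr P mC) mX.
pose m2 := mscale r (measure_function_pushforward__canonical__measure_function_Measure P mX).
have := @eq_measure_prod _ _ _ _ m1 m2.
rewrite /m1 /m2 /= /mscale/= /pushforward/= /mrestr/= => -> //.
- by rewrite fineK// muleC.
- by rewrite preimage_setT setTI (le_lt_trans (probability_le1 P mC))// ltry.
- move=> A B mA mB; rewrite fineK// muleC; exact: h.
Qed.

(** The joint law of independent variables is the product of their laws, so the claim
    is the theorem of Fubini for the function (x, y) |-> x y. *)
Lemma indep_integralM (X Y : T -> R) :
  measurable_fun setT X -> measurable_fun setT Y ->
  (forall A B, measurable A -> measurable B ->
    P (X @^-1` A `&` Y @^-1` B) = P (X @^-1` A) * P (Y @^-1` B)) ->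
  P.-integrable setT (EFin \o X) -> P.-integrable setT (EFin \o Y) ->
  P.-integrable setT (fun w => (X w * Y w)%:E) /\
  \int[P]_w (X w * Y w)%:E = \int[P]_w (X w)%:E * \int[P]_w (Y w)%:E.
Proof.
move=> mX mY XY iX iY.
have mXY : measurable_fun setT (fun w => (X w, Y w)) by exact/measurable_fun_pair.
pose X' : {mfun T >-> R} := mfun_Sub (mem_set mX).
pose Y' : {mfun T >-> R} := mfun_Sub (mem_set mY).
pose XY' : {mfun T >-> (R * R)%type} := mfun_Sub (mem_set mXY).
pose pX := distribution P X'; pose pY := distribution P Y'.
pose pXY := distribution P XY'.
have pE D : measurable D -> (pX \x pY) D = pXY D.
  move=> mD.
  have key A B : measurable A -> measurable B -> pXY (A `*` B) = pX A * pY B.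
    by move=> mA mB; exact: XY.
  exact: (product_measure_unique key).
pose h (z : R * R) := (z.1 * z.2)%:E.
have mh : measurable_fun setT h.
  by apply/measurable_EFinP; apply: measurable_funM.
have mid : measurable_fun setT (@EFin R) by exact/measurable_EFinP.
have absX : \int[P]_w `|(X w)%:E| = \int[pX]_x `|x%:E|.
  rewrite ge0_integral_distribution//.
  exact: measurableT_comp.
have absY : \int[P]_w `|(Y w)%:E| = \int[pY]_x `|x%:E|.
  rewrite ge0_integral_distribution//.
  exact: measurableT_comp.
have lX : \int[pX]_x `|x%:E| < +oo by rewrite -absX; case/integrableP: iX.
have lY : \int[pY]_x `|x%:E| < +oo by rewrite -absY; case/integrableP: iY.
have mabs : measurable_fun setT (fun x : R => `|x%:E|) by exact: measurableT_comp.
have lprod : \int[pX \x pY]_z `|h z| < +oo.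
  rewrite fubini_tonelli1//; last exact: measurableT_comp.
  rewrite /fubini_F /=.
  under eq_integral => x _.
    under eq_integral do rewrite /h/= normrM EFinM.
    rewrite ge0_integralZl//.
    over.
  rewrite /= ge0_integralZr//; last exact: integral_ge0.
  by rewrite lte_mul_pinfty ?integral_ge0// ge0_fin_numE// integral_ge0.
have iprod : (pX \x pY).-integrable setT h by apply/integrableP.
have iXY : P.-integrable setT (fun w => (X w * Y w)%:E).
  apply/integrableP; split; first by apply/measurable_EFinP; exact: measurable_funM.
  move: lprod; rewrite (eq_measure_integral pXY) => [|A mA _]; last exact: pE.
  by rewrite ge0_integral_distribution//; exact: measurableT_comp.
have EX : \int[P]_w (X w)%:E = \int[pX]_x x%:E by rewrite integral_distribution.
have EY : \int[P]_w (Y w)%:E = \int[pY]_x x%:E by rewrite integral_distribution.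
split=> //; rewrite EX EY.
transitivity (\int[pXY]_z h z); first by rewrite integral_distribution.
rewrite (eq_measure_integral (pX \x pY)) => [|A mA _]; last by rewrite [RHS]pE.
rewrite -integral12_prod_meas1// /fubini_F/=.
have iY' : pY.-integrable setT (@EFin R) by apply/integrableP.
have iX' : pX.-integrable setT (@EFin R) by apply/integrableP.
under eq_integral => x _.
  under eq_integral do rewrite /h/= EFinM.
  rewrite integralZl//.
  over.
have fY : \int[pY]_x x%:E \is a fin_num by exact: integrable_fin_num.
by rewrite /= -(fineK fY) integralZr.
Qed.

End independence.

(** * Increments of Brownian motion *)

Section brownian_increments.
Context (R : realType) (dO : measure_display) (Omega : measurableType dO)
  (P : probability Omega R) (d : nat) (T : \bar R) (W : Omega -> R -> 'cV[R]_d).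
Hypothesis basisW : brownian_basis P T W.

Definition bgen (t : \bar R) : set (set Omega) :=
  [set A | (exists s B, [/\ (0 <= s)%R, s%:E <= t, borel_mx B
                          & A = (fun w => W w s) @^-1` B])
           \/ P.-negligible A].

Lemma bfiltE t : bfilt P W t = <<s bgen t >>. Proof. by []. Qed.

(** Measurability of a real random variable with respect to F_t, as measurability on
    the type carrying the generated sigma-algebra, so that the closure properties of
    measurable functions apply. *)
Definition fmeas (t : \bar R) (X : Omega -> R) : Prop :=
  @measurable_fun _ _ (g_sigma_algebraType (bgen t)) R setT X.

Lemma fmeasP t X : fmeas t X <-> forall B, measurable B -> bfilt P W t (X @^-1` B).
Proof.
by split => [mX B mB|h _ B mB]; [have := mX measurableT B mB|rewrite setTI; exact: h];
  rewrite ?setTI.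
Qed.

Lemma bfilt_le s t : s <= t -> bfilt P W s `<=` bfilt P W t.
Proof.
move=> st; rewrite !bfiltE; apply: sub_sigma_algebra2 => A [[r [B [r0 rs mB ->]]]|nA]; last by right.
by left; exists r, B; split => //; exact: le_trans st.
Qed.

Lemma bfilt_measurable t : t <= T -> bfilt P W t `<=` measurable.
Proof.
by move=> tT A /(bfilt_le tT); case: basisW => _ _ _ ->.
Qed.

Lemma fmeas_le s t X : s <= t -> fmeas s X -> fmeas t X.
Proof. by move=> st /fmeasP h; apply/fmeasP => B /h; exact: bfilt_le. Qed.

Lemma fmeas_measurable t X : t <= T -> fmeas t X -> measurable_fun setT X.
Proof.
by move=> tT /fmeasP h _ B mB; rewrite setTI; exact: (bfilt_measurable tT (h _ mB)).
Qed.

Definition incr (s t : R) (j : 'I_d) (w : Omega) : R := (W w t - W w s)%R j ord0.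

Lemma fmeas_W s t j : (0 <= s)%R -> s%:E <= t -> fmeas t (fun w => W w s j ord0).
Proof.
move=> s0 st; apply/fmeasP => B mB; apply: sub_sigma_algebra; left.
exists s, [set M : 'cV[R]_d | B (M j ord0)]; split => //.
exact: borel_mx_coord.
Qed.

Lemma fmeas_incr s t u j : (0 <= s)%R -> (s <= t)%R -> t%:E <= u ->
  fmeas u (incr s t j).
Proof.
move=> s0 st tu.
have -> : incr s t j = (fun w => W w t j ord0 - W w s j ord0)%R.
  by apply/funext => w; rewrite /incr !mxE.
apply: measurable_funB; apply: fmeas_W => //; first exact: le_trans st.
by rewrite (le_trans _ tu)// lee_fin.
Qed.

Lemma measurable_incr s t j : (0 <= s)%R -> (s <= t)%R -> t%:E <= T ->
  measurable_fun setT (incr s t j).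
Proof. by move=> s0 st tT; apply: (fmeas_measurable tT); exact: fmeas_incr. Qed.

Section fixed_increment.
Context (s t : R) (s0 : (0 <= s)%R) (st : (s < t)%R) (tT : t%:E <= T).
Let N := normal_prob 0%R (Num.sqrt (t - s)%R).

Let brown := let: And4 bm _ _ _ := basisW in let: And3 _ _ h := bm in h.

(** The law of the vector of increments, used with all but one, respectively two, of
    the coordinates unconstrained. *)
Lemma incr_law C i B : bfilt P W s%:E C -> measurable B ->
  P (C `&` incr s t i @^-1` B) = P C * N B.
Proof.
move=> FC mB.
have := brown s0 st tT (B := fun k => if k == i then B else setT) FC.
rewrite (bigD1 i)//= eqxx big1 => [|k /negbTE ->]; last exact: probability_setT.
rewrite mule1 => <-; last by move=> k; case: ifP.
congr (P (C `&` _)); apply/seteqP; split => w /=.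
  by move=> Bw k; case: eqP => // ->.
by move/(_ i); rewrite eqxx.
Qed.

Lemma incr_law2 C i j A B : bfilt P W s%:E C -> i != j ->
  measurable A -> measurable B ->
  P (C `&` incr s t i @^-1` A `&` incr s t j @^-1` B) =
  P (C `&` incr s t i @^-1` A) * N B.
Proof.
move=> FC ij mA mB; rewrite [in RHS]incr_law//.
have := brown s0 st tT
  (B := fun k => if k == i then A else if k == j then B else setT) FC.
rewrite (bigD1 i)//= eqxx (bigD1 j)/=; last by rewrite eq_sym.
rewrite [j == i]eq_sym (negbTE ij) eqxx big1 => [|k /andP[/negbTE -> /negbTE ->]];
  last exact: probability_setT.
rewrite mule1 muleA => <-; last by move=> k; do 2?case: ifP.
congr (P _); rewrite -setIA; congr (C `&` _); apply/seteqP; split => w /=.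
  by move=> [Aw Bw] k; case: eqP => [->//|_]; case: eqP => [->|].
move=> h; split; first by have := h i; rewrite eqxx.
by have := h j; rewrite eq_sym (negbTE ij) eqxx.
Qed.

Let mW i : measurable_fun setT (incr s t i).
Proof. by apply: measurable_incr => //; exact: ltW. Qed.

Let incr_prob i B : measurable B -> P (incr s t i @^-1` B) = N B.
Proof.
move=> mB; have := @incr_law setT i B _ mB.
rewrite setTI probability_setT mul1e; apply.
exact: (@measurableT _ (g_sigma_algebraType (bgen s%:E))).
Qed.

Let transfer i (h : R -> \bar R) : measurable_fun setT h -> N.-integrable setT h ->
  P.-integrable setT (h \o incr s t i) /\
  \int[P]_w h (incr s t i w) = \int[N]_x h x.
Proof.
move=> mh ih.
have mW' : measurable_fun setT (incr s t i : Omega -> measurableTypeR R) := mW i.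
pose Y : {mfun Omega >-> measurableTypeR R} :=
  @mfun_Sub _ _ Omega (measurableTypeR R) _ (mem_set mW').
have YN (f : R -> \bar R) : \int[distribution P Y]_x f x = \int[N]_x f x.
  by apply: eq_measure_integral => A mA _; exact: incr_prob.
have iP : P.-integrable setT (h \o incr s t i).
  apply/integrableP; split; first exact: measurableT_comp.
  have /integrableP[_] := ih; rewrite -YN ge0_integral_distribution//.
  exact: measurableT_comp.
by split => //; rewrite -YN integral_distribution.
Qed.

Let sd0 : (0 < Num.sqrt (t - s))%R.
Proof. by rewrite sqrtr_gt0 subr_gt0. Qed.

Let incr1 i : P.-integrable setT (EFin \o incr s t i) /\
  \int[P]_w (incr s t i w)%:E = 0.
Proof.
have [i1 e1] := normal_first_moment sd0.
by have [] := @transfer i (@EFin R) _ i1; [exact/measurable_EFinP|move=> ?; rewrite e1].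
Qed.

Let incr2 i : P.-integrable setT (fun w => (incr s t i w ^+ 2)%:E) /\
  \int[P]_w (incr s t i w ^+ 2)%:E = (t - s)%:E.
Proof.
have e2 := normal_second_moment sd0; rewrite sqr_sqrtr ?subr_ge0 ?ltW// in e2.
have m2 : measurable_fun setT (fun x : R => (x ^+ 2)%:E).
  exact/measurable_EFinP/measurable_funX.
have := @transfer i (fun x => (x ^+ 2)%:E) m2; rewrite e2; apply.
apply/integrableP; split => //.
under eq_integral do rewrite gee0_abs ?lee_fin ?sqr_ge0//.
by rewrite e2 ltry.
Qed.

(** The increment is centred and independent of F_s. *)
Lemma incr_mean_lt X i : fmeas s%:E X -> P.-integrable setT (EFin \o X) ->
  P.-integrable setT (fun w => (X w * incr s t i w)%:E) /\
  \int[P]_w (X w * incr s t i w)%:E = 0.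
Proof.
move=> FX iX; have [i1 e1] := incr1 i.
have [] := @indep_integralM _ _ _ P X (incr s t i) _ (mW i) _ iX i1.
- by apply: (fmeas_measurable _ FX); rewrite (le_trans _ tT)// lee_fin ltW.
- move=> A B mA mB; rewrite incr_law ?incr_prob//.
  by move/fmeasP : FX; exact.
- by move=> ? ->; rewrite e1 mule0.
Qed.

(** On the diagonal this is independence and the second moment. Off the diagonal,
    coordinate j is independent of the pair formed by X and coordinate i, and it is
    centred. *)
Lemma incr_cov_lt X i j : fmeas s%:E X -> P.-integrable setT (EFin \o X) ->
  P.-integrable setT (fun w => (X w * (incr s t i w * incr s t j w))%:E) /\
  \int[P]_w (X w * (incr s t i w * incr s t j w))%:E =
  ((i == j)%:R * (t - s))%:E * \int[P]_w (X w)%:E.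
Proof.
move=> FX iX; have sT : s%:E <= T by rewrite (le_trans _ tT)// lee_fin ltW.
have mX : measurable_fun setT X by exact: fmeas_measurable FX.
have FXA A : measurable A -> bfilt P W s%:E (X @^-1` A) by move/fmeasP : FX; exact.
have [<-|ij] := eqVneq i j.
  have [i2 e2] := incr2 i.
  under eq_fun do rewrite -expr2.
  have [||] := @indep_integralM _ _ _ P X (fun w => incr s t i w ^+ 2)%R mX _ _ iX i2.
  - exact: measurable_funX.
  - move=> A B mA mB.
    have mB2 : measurable ((fun x : R => x ^+ 2)%R @^-1` B).
      have : measurable_fun setT (fun x : R => x ^+ 2)%R by exact: exprn_measurable.
      by move=> /(_ measurableT B mB); rewrite setTI.
    rewrite -[_ @^-1` B]/(incr s t i @^-1` ((fun x : R => x ^+ 2)%R @^-1` B)).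
    by rewrite incr_law ?incr_prob//; exact: FXA.
  - move=> ? e; split => //.
    by rewrite e e2 mul1r muleC.
have [i1 e1] := incr1 j.
have [iXW eXW] := incr_mean_lt i FX iX.
under eq_fun do rewrite mulrA.
have [||] := @indep_integralM _ _ _ P (fun w => X w * incr s t i w)%R (incr s t j)
  _ (mW j) _ iXW i1.
- exact: measurable_funM.
- move=> A B mA mB; rewrite incr_prob//.
  pose D := [set z : R * R | A (z.1 * z.2)%R].
  have mD : measurable D.
    have : measurable_fun setT (fun z : R * R => z.1 * z.2)%R by apply: measurable_funM.
    by move=> /(_ measurableT A mA); rewrite setTI.
  apply: (@indep_pair _ _ _ P _ _ _ _ X (incr s t i) (incr s t j @^-1` B) (N B)) mD => //.
  + by rewrite -[X in measurable X]setTI; exact: mW.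
  + exact: fin_num_measure.
  + by move=> A' B' mA' mB'; rewrite incr_law2//; exact: FXA.
- by move=> ? ->; rewrite e1 mule0 mul0r mul0e.
Qed.

End fixed_increment.

Lemma incr_mean s t X i : (0 <= s)%R -> (s <= t)%R -> t%:E <= T ->
  fmeas s%:E X -> P.-integrable setT (EFin \o X) ->
  P.-integrable setT (fun w => (X w * incr s t i w)%:E) /\
  \int[P]_w (X w * incr s t i w)%:E = 0.
Proof.
move=> s0; rewrite le_eqVlt => /predU1P[<- _ _ _|st tT]; last exact: incr_mean_lt.
have incr0 w : (X w * incr s s i w)%:E = 0.
  by rewrite /incr subrr mxE mulr0.
split; first by under eq_fun do rewrite incr0; exact: integrable0.
by under eq_integral do rewrite incr0; rewrite integral0.
Qed.

Lemma incr_cov s t X i j : (0 <= s)%R -> (s <= t)%R -> t%:E <= T ->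
  fmeas s%:E X -> P.-integrable setT (EFin \o X) ->
  P.-integrable setT (fun w => (X w * (incr s t i w * incr s t j w))%:E) /\
  \int[P]_w (X w * (incr s t i w * incr s t j w))%:E =
  ((i == j)%:R * (t - s))%:E * \int[P]_w (X w)%:E.
Proof.
move=> s0; rewrite le_eqVlt => /predU1P[<- _ _ _|st tT]; last exact: incr_cov_lt.
have incr0 w : (X w * (incr s s i w * incr s s j w))%:E = 0.
  by rewrite /incr subrr mxE mul0r mulr0.
split; first by under eq_fun do rewrite incr0; exact: integrable0.
by under eq_integral do rewrite incr0; rewrite integral0 subrr mulr0 mul0e.
Qed.

Lemma incrD r s t j w : (incr r s j w + incr s t j w = incr r t j w)%R.
Proof. by rewrite /incr !mxE; ring. Qed.

End brownian_increments.

(** * Stochastic integrals of simple integrands *)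

Section simple_integrals.
Context (R : realType) (dO : measure_display) (Omega : measurableType dO)
  (P : probability Omega R) (d : nat) (T : \bar R) (W : Omega -> R -> 'cV[R]_d).
Hypothesis basisW : brownian_basis P T W.
Local Notation fmeas := (fmeas P W).
Local Notation incr := (incr W).

(** The length of ]l, r] :&: ]l', r']. *)
Definition overlap (l r l' r' : R) : R :=
  if (Num.max l l' < Num.min r r')%R then (Num.min r r' - Num.max l l')%R else 0%R.

Lemma overlapC l r l' r' : overlap l r l' r' = overlap l' r' l r.
Proof. by rewrite /overlap maxC minC. Qed.

(** Cut the increments at the end points of the intervals. Each product of increments
    over disjoint intervals has mean zero, because the later one is centred given
    the past; what remains is the covariance of the increments over the common part. *)
Let incr_pair_le l r l' r' i j (a b : Omega -> R) (Ca Cb : R) :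
  (0 <= l)%R -> (l <= r)%R -> r%:E <= T ->
  (l' <= r')%R -> r'%:E <= T -> (l <= l')%R ->
  fmeas l%:E a -> fmeas l'%:E b ->
  (forall w, `|a w| <= Ca)%R -> (forall w, `|b w| <= Cb)%R ->
  P.-integrable setT (fun w => ((a w * incr l r i w) * (b w * incr l' r' j w))%:E) /\
  \int[P]_w ((a w * incr l r i w) * (b w * incr l' r' j w))%:E =
  ((i == j)%:R * overlap l r l' r')%:E * \int[P]_w (a w * b w)%:E.
Proof.
move=> l0 lr rT lr' rT' ll' Fa Fb aC bC.
have l'0 : (0 <= l')%R by exact: le_trans ll'.
have l'T : l'%:E <= T by rewrite (le_trans _ rT')// lee_fin.
have lT : l%:E <= T by rewrite (le_trans _ rT)// lee_fin.
have Fa' : fmeas l'%:E a by apply: fmeas_le Fa; rewrite lee_fin.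
have ma := fmeas_measurable basisW lT Fa.
have mb := fmeas_measurable basisW l'T Fb.
have Fab : fmeas l'%:E (fun w => a w * b w)%R by exact: measurable_funM.
have iab : P.-integrable setT (EFin \o (fun w => a w * b w)%R).
  apply: (@integrable_boundedM _ _ _ P _ _ Ca) => //.
  exact: (@integrable_bounded _ _ _ P _ Cb).
(* the part of the first increment before l' is known at time l', so that the
   later increment is centred given it *)
have before x : (l <= x)%R -> (x <= l')%R ->
    P.-integrable setT (fun w => ((b w * (a w * incr l x i w)) * incr l' r' j w)%:E) /\
    \int[P]_w ((b w * (a w * incr l x i w)) * incr l' r' j w)%:E = 0.
  move=> lx xl'; have xT : x%:E <= T by rewrite (le_trans _ l'T)// lee_fin.
  apply: (incr_mean basisW) => //.
    apply: measurable_funM => //; apply: measurable_funM => //.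
    by apply: fmeas_incr => //; rewrite lee_fin.
  apply: (@integrable_boundedM _ _ _ P _ _ Cb) => //.
  have ia : P.-integrable setT (EFin \o a) by exact: (@integrable_bounded _ _ _ P _ Ca).
  by have [] := incr_mean basisW i l0 lx xT Fa ia.
have ovE : overlap l r l' r' = if (l' < Num.min r r')%R then (Num.min r r' - l')%R else 0%R.
  by rewrite /overlap max_r.
rewrite ovE.
have [rl'|l'r] := leP r l'.
  have [h1 h2] := before r lr rl'.
  have -> : (fun w => ((a w * incr l r i w) * (b w * incr l' r' j w))%:E) =
            (fun w => ((b w * (a w * incr l r i w)) * incr l' r' j w)%:E).
    by apply/funext => w; congr EFin; ring.
  rewrite h2 ifF ?mulr0 ?mul0e//.
  by apply/negbTE; rewrite -leNgt ge_min rl'.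
have [h1 h2] := before l' ll' (lexx l').
have r0 : (0 <= r)%R by exact: le_trans lr.
have r'0 : (0 <= r')%R by exact: le_trans lr'.
have [hi he] : P.-integrable setT
    (fun w => (a w * b w * (incr l' r i w * incr l' r' j w))%:E) /\
    \int[P]_w (a w * b w * (incr l' r i w * incr l' r' j w))%:E =
    ((i == j)%:R * (Num.min r r' - l'))%:E * \int[P]_w (a w * b w)%:E.
  have [rr'|r'r] := leP r r'.
    have [c1 c2] := incr_cov basisW i j l'0 (ltW l'r) rT Fab iab.
    have Fx : fmeas r%:E (fun w => a w * b w * incr l' r i w)%R.
      apply: measurable_funM; first by apply: fmeas_le Fab; rewrite lee_fin ltW.
      by apply: fmeas_incr => //; exact: ltW.
    have [ix _] := incr_mean basisW i l'0 (ltW l'r) rT Fab iab.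
    have [e1 e2] := incr_mean basisW j r0 rr' rT' Fx ix.
    have -> : (fun w => (a w * b w * (incr l' r i w * incr l' r' j w))%:E) =
        (fun w => (a w * b w * (incr l' r i w * incr l' r j w))%:E +
                  (a w * b w * incr l' r i w * incr r r' j w)%:E).
      by apply/funext => w; rewrite -EFinD -(incrD W l' r r'); congr EFin; ring.
    split; first exact: integrableD.
    rewrite [LHS](@integralD _ _ _ P setT measurableT _ _ c1 e1).
    by rewrite e2 adde0 c2.
  have [c1 c2] := incr_cov basisW i j l'0 lr' rT' Fab iab.
  have Fx : fmeas r'%:E (fun w => a w * b w * incr l' r' j w)%R.
    apply: measurable_funM; first by apply: fmeas_le Fab; rewrite lee_fin.
    by apply: fmeas_incr => //; exact: ltW.
  have [ix _] := incr_mean basisW j l'0 lr' rT' Fab iab.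
  have [e1 e2] := incr_mean basisW i r'0 (ltW r'r) rT Fx ix.
  have -> : (fun w => (a w * b w * (incr l' r i w * incr l' r' j w))%:E) =
      (fun w => (a w * b w * (incr l' r' i w * incr l' r' j w))%:E +
                (a w * b w * incr l' r' j w * incr r' r i w)%:E).
    by apply/funext => w; rewrite -EFinD -(incrD W l' r' r); congr EFin; ring.
  split; first exact: integrableD.
  rewrite [LHS](@integralD _ _ _ P setT measurableT _ _ c1 e1).
  by rewrite e2 adde0 c2.
have -> : (fun w => ((a w * incr l r i w) * (b w * incr l' r' j w))%:E) =
    (fun w => ((b w * (a w * incr l l' i w)) * incr l' r' j w)%:E +
              (a w * b w * (incr l' r i w * incr l' r' j w))%:E).
  by apply/funext => w; rewrite -EFinD -(incrD W l l' r); congr EFin; ring.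
split; first exact: integrableD.
rewrite [LHS](@integralD _ _ _ P setT measurableT _ _ h1 hi) h2 add0e he.
congr (_ * _); congr (_ * _)%:E; case: ifPn => //.
rewrite -leNgt => le_l'; apply/eqP; rewrite subr_eq0 eq_le le_l'/= le_min lr' andbT.
exact: ltW.
Qed.

(** The bilinear form behind the isometry: by symmetry one may assume l <= l'. *)
Lemma incr_pair l r l' r' i j (a b : Omega -> R) (Ca Cb : R) :
  (0 <= l)%R -> (l <= r)%R -> r%:E <= T ->
  (0 <= l')%R -> (l' <= r')%R -> r'%:E <= T ->
  fmeas l%:E a -> fmeas l'%:E b ->
  (forall w, `|a w| <= Ca)%R -> (forall w, `|b w| <= Cb)%R ->
  P.-integrable setT (fun w => ((a w * incr l r i w) * (b w * incr l' r' j w))%:E) /\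
  \int[P]_w ((a w * incr l r i w) * (b w * incr l' r' j w))%:E =
  ((i == j)%:R * overlap l r l' r')%:E * \int[P]_w (a w * b w)%:E.
Proof.
move=> l0 lr rT l'0 lr' rT' Fa Fb aC bC.
have [ll'|/ltW l'l] := leP l l'; first exact: (incr_pair_le i j l0 lr rT lr' rT' ll' Fa Fb aC bC).
have := incr_pair_le j i l'0 lr' rT' lr rT l'l Fb Fa bC aC.
rewrite overlapC eq_sym.
have -> : (fun w => ((b w * incr l' r' j w) * (a w * incr l r i w))%:E) =
  (fun w => ((a w * incr l r i w) * (b w * incr l' r' j w))%:E).
  by apply/funext => w; rewrite mulrC.
by have -> : (fun w => (b w * a w)%:E) = (fun w => (a w * b w)%:E)
  by apply/funext => w; rewrite mulrC.
Qed.

Section one_integrand.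
Context (m : nat) (H : simple_integrand P T W m).
Local Notation n := (si_size H).
Local Notation l := (@si_l _ _ _ _ _ _ _ _ H).
Local Notation r := (@si_r _ _ _ _ _ _ _ _ H).
Local Notation c := (@si_coef _ _ _ _ _ _ _ _ H).

Let l0 k : (0 <= l k)%R := si_l0 (s:=H) k.
Let lr k : (l k <= r k)%R := si_lr (s:=H) k.
Let rT k : (r k)%:E <= T := si_rT (s:=H) k.
Let r0 k : (0 <= r k)%R. Proof. exact: le_trans (lr k). Qed.
Let lT k : (l k)%:E <= T. Proof. by rewrite (le_trans _ (rT k))// lee_fin. Qed.

Lemma si_coef_fmeas k i j : fmeas (l k)%:E (fun w => c k w i j).
Proof.
apply/fmeasP => B mB; rewrite -[X in bfilt _ _ _ X]setTI.
exact: (measurable_wrt_coord i j (si_meas (s:=H) (k:=k)) mB).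
Qed.

Lemma si_coef_bounded k : exists C : R, forall i j w, (`|c k w i j| <= C)%R.
Proof.
have [C hC] := si_bounded (s:=H) k; exists C => i j w.
exact: le_trans (enorm_entry _ _ _) (hC w).
Qed.

Let mc k i j : measurable_fun setT (fun w => c k w i j).
Proof. apply: (fmeas_measurable basisW (lT k)). exact: si_coef_fmeas. Qed.

Lemma sqint_incr s t j : (0 <= s)%R -> (s <= t)%R -> t%:E <= T -> sqint P (incr s t j).
Proof.
move=> s0 st tT; split; first exact: (measurable_incr basisW).
have [] := @incr_cov _ _ _ _ _ _ _ basisW s t (fun=> 1%R) j j s0 st tT.
- exact: measurable_cst.
- exact: finite_measure_integrable_cst.
- by move=> + _; congr (_.-integrable setT); apply/funext => w; rewrite mul1r.
Qed.

(** The end point x of an interval, stopped at time t. *)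
Let clip (t : \bar R) (x : R) : R := fine (Order.min t x%:E).

Let clipE t x : 0 <= t -> (0 <= x)%R -> (clip t x)%:E = Order.min t x%:E.
Proof.
move=> t0 x0; rewrite /clip fineK//; case: t t0 => [t| |]//= _.
by rewrite -EFin_min.
Qed.

Lemma si_integralE w t i : si_integral H w t i ord0 =
  (\sum_k \sum_j c k w i j * incr (clip t (l k)) (clip t (r k)) j w)%R.
Proof.
rewrite /si_integral summxE; apply: eq_bigr => k _.
by rewrite mxE; apply: eq_bigr => j _.
Qed.

Let clip_ok t k : 0 <= t -> t <= T ->
  [/\ (0 <= clip t (l k))%R, (clip t (l k) <= clip t (r k))%R & (clip t (r k))%:E <= T].
Proof.
move=> t0 tT; split.
- by rewrite -lee_fin clipE// le_min t0 lee_fin l0.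
- by rewrite -lee_fin !clipE// le_min ge_min lexx/= ge_min lee_fin lr orbT.
- by rewrite clipE// ge_min tT.
Qed.

Lemma sqint_si_integral t i : 0 <= t -> t <= T ->
  sqint P (fun w => si_integral H w t i ord0).
Proof.
move=> t0 tT; under eq_fun do rewrite si_integralE.
apply: sqint_sum => k; apply: sqint_sum => j.
have [C hC] := si_coef_bounded k.
apply: (@sqint_boundedM _ _ _ P _ _ C) => //.
by have [] := clip_ok k t0 tT; exact: sqint_incr.
Qed.

(** Between the times s and t the k-th term is either constant or moves by an increment
    over an interval that starts after both s and the left end point of the k-th
    interval, so that the coefficient is known when this increment starts. *)
Let clip_incr s t k : 0 <= s -> s <= t -> t <= T ->
  (forall w j, incr (clip t (l k)) (clip t (r k)) j w =
    incr (clip s (l k)) (clip s (r k)) j w)%R \/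
  exists x y, [/\ (0 <= x)%R, (x <= y)%R, y%:E <= T, s <= x%:E & (l k <= x)%R] /\
   forall w j, (incr (clip t (l k)) (clip t (r k)) j w -
    incr (clip s (l k)) (clip s (r k)) j w = incr x y j w)%R.
Proof.
move=> s0 st tT; have t0 : 0 <= t by exact: le_trans st.
have incr0 x w j : incr x x j w = 0%R by rewrite /incr subrr mxE.
have clip_small u k' : u <= (l k')%:E -> clip u (l k') = clip u (r k').
  move=> ul; rewrite /clip !min_l//.
  by rewrite (le_trans ul)// lee_fin.
have clip_ge u x : x%:E <= u -> clip u x = x by move=> xu; rewrite /clip min_r.
have [tl|lt] := leP t (l k)%:E.
  left => w j; rewrite (clip_small t)// (clip_small s) ?incr0//.
  exact: le_trans tl.
have [sl|ls] := leP s (l k)%:E.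
  right; exists (l k), (clip t (r k)); split.
    have [h1 h2 h3] := clip_ok k t0 tT; rewrite (clip_ge t) in h1 h2; last exact: ltW.
    by split.
  by move=> w j; rewrite (clip_small s)// incr0 subr0 (clip_ge t)// ltW.
rewrite !(clip_ge _ (l k)); [|exact: ltW..].
have [rs|sr] := leP (r k)%:E s.
  by left => w j; rewrite !clip_ge//; exact: le_trans st.
right; exists (clip s (r k)), (clip t (r k)); split.
  have [_ _ h3] := clip_ok k t0 tT.
  split => //.
  - by rewrite -lee_fin clipE// le_min s0 lee_fin r0.
  - by rewrite -lee_fin !clipE// le_min ge_min st/= ge_min lexx orbT.
  - by rewrite clipE// le_min lexx ltW.
  - by rewrite -lee_fin clipE// le_min lee_fin lr andbT ltW.
by move=> w j; rewrite -(incrD W (l k) (clip s (r k))); ring.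
Qed.

Lemma si_integral_martingale s t X i : 0 <= s -> s <= t -> t <= T ->
  fmeas s X -> sqint P X ->
  (\int[P]_w (X w * (si_integral H w t i ord0 - si_integral H w s i ord0)) = 0)%R.
Proof.
move=> s0 st tT FX sX; have t0 : 0 <= t by exact: le_trans st.
pose D k j w := (X w * (c k w i j * (incr (clip t (l k)) (clip t (r k)) j w -
    incr (clip s (l k)) (clip s (r k)) j w)))%R.
have DE w : (X w * (si_integral H w t i ord0 - si_integral H w s i ord0) =
    \sum_k \sum_j D k j w)%R.
  rewrite !si_integralE -sumrB mulr_sumr; apply: eq_bigr => k _.
  rewrite -sumrB mulr_sumr; apply: eq_bigr => j _.
  by rewrite /D; ring.
under eq_Rintegral do rewrite DE.
have key k j : P.-integrable setT (EFin \o D k j) /\ (\int[P]_w D k j w = 0)%R.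
  have [h|[x [y [[x0 xy yT sx lx] h]]]] := clip_incr k s0 st tT.
    have D0 : D k j = fun=> 0%R by apply/funext => w; rewrite /D h subrr !mulr0.
    by rewrite D0; split; [exact: integrable0|rewrite Rintegral_cst// mul0r].
  have DD : D k j = (fun w => (c k w i j * X w) * incr x y j w)%R.
    by apply/funext => w; rewrite /D h; ring.
  have xT : x%:E <= T by rewrite (le_trans _ yT)// lee_fin.
  have [C hC] := si_coef_bounded k.
  have [||h1 h2] := @incr_mean _ _ _ _ _ _ _ basisW x y (fun w => c k w i j * X w)%R j x0 xy yT.
  - apply: measurable_funM; last by apply: fmeas_le FX.
    by apply: (@fmeas_le _ _ _ _ _ _ (l k)%:E); [rewrite lee_fin|exact: si_coef_fmeas].
  - apply: (@integrable_boundedM _ _ _ P _ _ C) => //; exact: sqint_int.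
  - by rewrite DD; split => //; rewrite /Rintegral h2.
have key2 k : P.-integrable setT (EFin \o (fun w => \sum_j D k j w)%R) /\
    (\int[P]_w (\sum_j D k j w) = 0)%R.
  have [h1 h2] := @exp_sum _ _ _ P _ (index_enum _) (D k) (fun j => (key k j).1).
  by split => //; rewrite h2 big1// => j _; exact: (key k j).2.
have [_ ->] := @exp_sum _ _ _ P _ (index_enum _) _ (fun k => (key2 k).1).
by rewrite big1// => k _; exact: (key2 k).2.
Qed.

Local Notation mu := (@lebesgue_measure R).
(* Both squared norms are expanded as sums over a coordinate i and two terms (k, j),
   (k', j') of the integrand; the two sums are then compared term by term. *)
Local Notation idx := ('I_m * (('I_n * 'I_d) * ('I_n * 'I_d)))%type.
Let cc (x : idx) w : R := (c x.2.1.1 w x.1 x.2.1.2 * c x.2.2.1 w x.1 x.2.2.2)%R.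
Let zz (x : idx) w : R :=
  ((c x.2.1.1 w x.1 x.2.1.2 * incr (l x.2.1.1) (r x.2.1.1) x.2.1.2 w) *
   (c x.2.2.1 w x.1 x.2.2.2 * incr (l x.2.2.1) (r x.2.2.1) x.2.2.2 w))%R.
Let ov (x : idx) : R :=
  ((x.2.1.2 == x.2.2.2)%:R * overlap (l x.2.1.1) (r x.2.1.1) (l x.2.2.1) (r x.2.2.1))%R.
Let I k (s : R) : R := if (l k)%:E < s%:E <= (r k)%:E then 1%R else 0%R.

Let sum_idx (F : 'I_m -> 'I_n * 'I_d -> R) :
  (\sum_i (\sum_p F i p) ^+ 2 = \sum_(x : idx) F x.1 x.2.1 * F x.1 x.2.2)%R.
Proof.
under eq_bigr do rewrite expr2 big_distrlr/= pair_bigA/=.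
by rewrite pair_bigA.
Qed.

Let sum_idx_diag (F : 'I_m -> 'I_n -> 'I_d -> R) :
  (\sum_i \sum_j (\sum_k F i k j) ^+ 2 =
   \sum_(x : idx) (x.2.1.2 == x.2.2.2)%:R *
     (F x.1 x.2.1.1 x.2.1.2 * F x.1 x.2.2.1 x.2.2.2))%R.
Proof.
rewrite -(pair_bigA _ (fun i (y : ('I_n * 'I_d) * ('I_n * 'I_d)) =>
  (y.1.2 == y.2.2)%:R * (F i y.1.1 y.1.2 * F i y.2.1 y.2.2)))%R /=.
apply: eq_bigr => i _.
rewrite -(pair_bigA _ (fun p p' : 'I_n * 'I_d =>
  (p.2 == p'.2)%:R * (F i p.1 p.2 * F i p'.1 p'.2)))%R /=.
rewrite -(pair_bigA _ (fun k j => \sum_(p' : 'I_n * 'I_d)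
  (j == p'.2)%:R * (F i k j * F i p'.1 p'.2)))%R /=.
rewrite exchange_big/=; apply: eq_bigr => j _.
rewrite expr2 big_distrlr/=; apply: eq_bigr => k _.
rewrite -(pair_bigA _ (fun k' j' => (j == j')%:R * (F i k j * F i k' j')))%R /=.
apply: eq_bigr => k' _; rewrite (bigD1 j)//= eqxx mul1r big1 ?addr0// => j' jj'.
by rewrite eq_sym (negbTE jj') mul0r.
Qed.

Let sqr_si_integral w :
  (enorm (si_integral H w T) ^+ 2 = \sum_(x : idx) zz x w)%R.
Proof.
rewrite sqr_enorm.
under eq_bigr do rewrite big_ord1 si_integralE.
rewrite -(sum_idx (fun i p => c p.1 w i p.2 * incr (l p.1) (r p.1) p.2 w))%R.
apply: eq_bigr => i _; congr (_ ^+ 2)%R.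
rewrite pair_bigA/=; apply: eq_bigr => -[k j] _ /=.
by rewrite /clip !min_r.
Qed.

Let sqr_si_process w (s : R) : (enorm (si_process H w s%:E) ^+ 2 =
  \sum_(x : idx) cc x w * ((x.2.1.2 == x.2.2.2)%:R * (I x.2.1.1 s * I x.2.2.1 s)))%R.
Proof.
rewrite sqr_enorm; transitivity
  (\sum_i \sum_j (\sum_k I k s * c k w i j) ^+ 2)%R.
  apply: eq_bigr => i _; apply: eq_bigr => j _; congr (_ ^+ 2)%R.
  rewrite /si_process summxE; apply: eq_bigr => k _ /=.
  by rewrite /I; case: ifP => _; rewrite ?mul1r// mul0r mxE.
rewrite (sum_idx_diag (fun i k j => I k s * c k w i j))%R.
by apply: eq_bigr => x _; rewrite /cc; ring.
Qed.

Lemma measurable_rtimes : measurable (rtimes T : set R).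
Proof.
have : measurable_fun setT (@EFin R) by exact/measurable_EFinP.
move=> /(_ measurableT _ (emeasurable_itv `[0, T])); rewrite setTI.
by congr measurable; apply/seteqP; split => s; rewrite /= in_itv.
Qed.

Let int_II k k' : mu.-integrable (rtimes T) (fun s => (I k s * I k' s)%:E) /\
  \int[mu]_(s in rtimes T) (I k s * I k' s)%:E = (overlap (l k) (r k) (l k') (r k'))%:E.
Proof.
pose A := `]Num.max (l k) (l k'), Num.min (r k) (r k')]%classic.
have mA : measurable A by exact: measurable_itv.
have AE s : (I k s * I k' s)%R = \1_A s.
  rewrite /I indicE mem_setE in_itv/= gt_max le_min !lte_fin !lee_fin.
  case: (l k < s)%R => /=; last by rewrite mul0r.
  case: (l k' < s)%R => /=; last by rewrite mulr0.
  by case: (s <= r k)%R; case: (s <= r k')%R => /=; rewrite ?mulr1 ?mulr0 ?mul0r.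
have AT : A `<=` rtimes T.
  move=> s; rewrite /A/= in_itv/= /rtimes/= gt_max le_min lee_fin.
  move=> /andP[/andP[ls _] /andP[sr _]].
  by rewrite (le_trans (l0 k) (ltW ls))/= (le_trans _ (rT k))// lee_fin.
have -> : (fun s => (I k s * I k' s)%:E) = (fun s => (\1_A s)%:E).
  by apply/funext => s; rewrite AE.
have e : \int[mu]_(s in rtimes T) (\1_A s)%:E = (overlap (l k) (r k) (l k') (r k'))%:E.
  rewrite integral_indic//; last exact: measurable_rtimes.
  rewrite setIidl// /A; etransitivity; first exact: lebesgue_measure_itv.
  rewrite /= lte_fin /overlap.
  by case: ifP.
split => //; apply/integrableP; split.
  exact/measurable_EFinP/measurable_indic.
under eq_integral do rewrite gee0_abs ?lee_fin//.
by rewrite e ltry.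
Qed.

(** Both sides expand into the same finite sum: the covariance of two increments is the
    length of the overlap of their intervals, which is also the time integral of the
    product of the indicators of these intervals. *)
Lemma ito_isometry_simple :
  \int[P]_w (enorm (si_integral H w T) ^+ 2)%:E =
  \int[P]_w \int[mu]_(s in rtimes T) (enorm (si_process H w s%:E) ^+ 2)%:E.
Proof.
have inner w : \int[mu]_(s in rtimes T) (enorm (si_process H w s%:E) ^+ 2)%:E =
    (\sum_(x : idx) ov x * cc x w)%:E.
  under eq_integral do rewrite sqr_si_process -sumEFin.
  rewrite integral_sum; last 2 first.
  - exact: measurable_rtimes.
  - move=> x; have [h _] := int_II x.2.1.1 x.2.2.1.
    rewrite (_ : (fun _ => _) = (fun s => (cc x w * (x.2.1.2 == x.2.2.2)%:R)%:E *
        (I x.2.1.1 s * I x.2.2.1 s)%:E)).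
      by apply: integrableZl h; exact: measurable_rtimes.
    by apply/funext => s; rewrite -EFinM mulrA.
  rewrite -sumEFin; apply: eq_bigr => x _.
  have [h1 h2] := int_II x.2.1.1 x.2.2.1.
  under eq_integral do rewrite mulrA EFinM.
  rewrite integralZl//; last exact: measurable_rtimes.
  by rewrite h2 -EFinM /ov; congr EFin; ring.
under [RHS]eq_integral do rewrite inner.
under [LHS]eq_integral do rewrite sqr_si_integral.
have key (x : idx) : P.-integrable setT (EFin \o zz x) /\
    (\int[P]_w zz x w = \int[P]_w (ov x * cc x w))%R /\
    P.-integrable setT (EFin \o (fun w => ov x * cc x w)%R).
  have [C hC] := si_coef_bounded x.2.1.1; have [C' hC'] := si_coef_bounded x.2.2.1.
  have [h1 h2] := @incr_pair (l x.2.1.1) (r x.2.1.1) (l x.2.2.1) (r x.2.2.1)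
    x.2.1.2 x.2.2.2 (fun w => c x.2.1.1 w x.1 x.2.1.2) (fun w => c x.2.2.1 w x.1 x.2.2.2)
    C C' (l0 _) (lr _) (rT _) (l0 _) (lr _) (rT _) (@si_coef_fmeas _ _ _)
    (@si_coef_fmeas _ _ _) (hC _ _) (hC' _ _).
  have icc : P.-integrable setT (EFin \o cc x).
    apply: (@integrable_boundedM _ _ _ P _ _ C) => //.
    exact: (@integrable_bounded _ _ _ P _ C').
  split => //; split; last exact: integrableZ_EFin.
  rewrite expZ//; move: h2; rewrite -(EFin_exp h1) -(EFin_exp icc) -EFinM.
  by case.
have [i1 e1] := @exp_sum _ _ _ P _ (index_enum _) zz (fun x => (key x).1).
have [i2 e2] := @exp_sum _ _ _ P _ (index_enum _) _ (fun x => (key x).2.2).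
rewrite -(EFin_exp i1) -(EFin_exp i2) e1 e2; congr EFin.
by apply: eq_bigr => x _; exact: (key x).2.1.
Qed.

End one_integrand.
End simple_integrals.

Arguments measurable_rtimes {R T}.

(** * Predictable processes and the squared norms of S^2 and H^2 *)

Lemma preimage_generated d (U : measurableType d) V (D : set V) (G : set (set V))
    (phi : U -> V) : measurable (phi @^-1` D) ->
  (forall S, G S -> measurable (phi @^-1` S)) ->
  forall S, <<s D, G >> S -> measurable (phi @^-1` S).
Proof.
move=> mD mG.
suff : <<s D, G >> `<=` [set S | measurable (phi @^-1` S)] by apply.
apply: smallest_sub => //; split => /=.
- by rewrite preimage_set0.
- by move=> A mA; rewrite -[X in measurable X]/(phi @^-1` D `\` phi @^-1` A); exact: measurableD.
- by move=> F mF; rewrite preimage_bigcup; exact: bigcupT_measurable.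
Qed.

(** The integral of a nonnegative function is a supremum over the simple functions
    below it, hence monotone for arbitrary functions. *)
Lemma le_ge0_integral d (U : measurableType d) (R : realType)
    (mu : {measure set U -> \bar R}) (f g : U -> \bar R) :
  (forall x, 0 <= f x) -> (forall x, f x <= g x) ->
  \int[mu]_x f x <= \int[mu]_x g x.
Proof.
move=> f0 fg; rewrite !ge0_integralTE//; last by move=> x; exact: le_trans (fg x).
apply: ge_ereal_sup => _ [h hf <-]; apply: ereal_sup_ubound; exists h => //.
by move=> x; exact: le_trans (hf x) (fg x).
Qed.

Section squares.
Context (R : realType).
Implicit Types x y : \bar R.

Lemma poweR2 x : 0 <= x -> x `^ 2 = x ^+ 2.
Proof.
case: x => [r r0| |]//.
- by rewrite poweR_EFin (powR_mulrn 2)// EFin_expe.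
- by rewrite poweRyr// expe2 mulyy.
Qed.

Lemma sqre_half x : 0 <= x -> (x `^ 2^-1) ^+ 2 = x.
Proof. by move=> x0; rewrite -poweR2 ?poweR_ge0// -poweRrM mulVf// poweRe1. Qed.

Lemma sqre_lty x : 0 <= x -> x < +oo -> x ^+ 2 < +oo.
Proof. by case: x => [r| |]// _ _; rewrite -EFin_expe ltry. Qed.

(** Stated for values in [0, +oo], because the norms below are extended reals. *)
Lemma cvge0P (u : (\bar R)^nat) : (forall n, 0 <= u n) ->
  (u n @[n --> \oo] --> 0) <->
  (forall e : R, (0 < e)%R -> \forall n \near \oo, u n <= e%:E).
Proof.
move=> u0; split => [/fine_cvgP[ufin ucvg] e e0|h].
  near=> n; have un : u n \is a fin_num by near: n.
  rewrite -(fineK un) lee_fin ltW//.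
  have -> : fine (u n) = `|0 - fine (u n)|%R.
    by rewrite sub0r normrN ger0_norm// fine_ge0.
  by near: n; move/cvgrPdist_lt : ucvg; exact.
have hfin : \forall n \near \oo, u n \is a fin_num.
  near=> n; rewrite ge0_fin_numE// (@le_lt_trans _ _ 1%:E) ?ltry//.
  by near: n; exact: h.
apply/fine_cvgP; split => //; apply/cvgrPdist_le => e e0.
near=> n; have un : u n \is a fin_num by near: n.
rewrite sub0r normrN ger0_norm ?fine_ge0// -lee_fin fineK//.
by near: n; exact: h.
Unshelve. all: by end_near. Qed.

Lemma cvge0_sqr (u : (\bar R)^nat) : (forall n, 0 <= u n) ->
  (u n @[n --> \oo] --> 0) <-> ((u n) ^+ 2 @[n --> \oo] --> 0).
Proof.
move=> u0; have u20 n : 0 <= u n ^+ 2 by exact: expe_ge0.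
split => /cvge0P h; apply/cvge0P => // e e0.
- have e1 : (0 < Num.min e 1)%R by rewrite lt_min e0 ltr01.
  near=> n; have : u n <= (Num.min e 1)%:E by near: n; exact: h.
  case: (u n) (u0 n) => [r| |]//; rewrite -EFin_expe !lee_fin le_min => r0 /andP[re r1].
  by rewrite expr2; nra.
- have e2 : (0 < e ^+ 2)%R by rewrite exprn_gt0.
  near=> n; have : u n ^+ 2 <= (e ^+ 2)%:E by near: n; exact: h.
  case: (u n) (u0 n) => [r| |]//.
  rewrite -EFin_expe !lee_fin => r0.
  by rewrite ler_pXn2r// nnegrE ltW.
Unshelve. all: by end_near. Qed.

End squares.

Section processes.
Context (R : realType) (dO : measure_display) (Omega : measurableType dO)
  (P : probability Omega R) (d : nat) (T : \bar R) (W : Omega -> R -> 'cV[R]_d).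
Hypothesis T_gt0 : 0 < T.
Hypothesis basisW : brownian_basis P T W.
Local Notation mu := (@lebesgue_measure R).

Section predictable_sections.
Context (p q : nat) (X : process Omega R p q).
Hypothesis predX : predictable P T W X.

(** Three maps into Omega x [0, T] are used below: fixing the scenario (regularity of
    paths), fixing the time (adaptedness), and embedding the real times (joint
    measurability). *)
Lemma predictable_preimage dU (U : measurableType dU) (phi : U -> Omega * \bar R) S :
  measurable (phi @^-1` pdom T) ->
  (forall A, bfilt P W 0 A -> measurable (phi @^-1` (A `*` [set 0]))) ->
  (forall A s t, 0 <= s -> s < t -> t <= T -> bfilt P W s A ->
    measurable (phi @^-1` (A `*` [set r | s < r <= t]))) ->
  predictable_sets P T W S -> measurable (phi @^-1` S).
Proof.
move=> mD m0 mst; apply: preimage_generated => // _ [[A [FA ->]]|[A [s [t [s0 st tT FA ->]]]]].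
  exact: m0.
exact: mst.
Qed.

Lemma measurable_times : measurable (times T).
Proof.
have := emeasurable_itv `[0, T].
by congr measurable; apply/seteqP; split => t; rewrite /= in_itv.
Qed.

Let mitv (s t : \bar R) : measurable [set r | s < r <= t].
Proof.
have := emeasurable_itv `]s, t].
by congr measurable; apply/seteqP; split => r; rewrite /= in_itv.
Qed.

Let mEFin : measurable_fun setT (@EFin R).
Proof. exact/measurable_EFinP. Qed.

Lemma predictable_path_set w S : predictable_sets P T W S ->
  measurable [set t | S (w, t)].
Proof.
move=> pS; apply: (predictable_preimage (phi := fun t => (w, t))) pS => /=.
- exact: measurable_times.
- move=> A _; have [wA|wA] := pselect (A w).
    by rewrite (_ : _ @^-1` _ = [set 0])//; apply/seteqP; split => t /=; [case|].
  by rewrite (_ : _ @^-1` _ = set0)//; apply/seteqP; split => t //= [].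
- move=> A s t _ _ _ _; have [wA|wA] := pselect (A w).
    by rewrite (_ : _ @^-1` _ = [set r | s < r <= t])//; apply/seteqP; split => r /=; [case|].
  by rewrite (_ : _ @^-1` _ = set0)//; apply/seteqP; split => r //= [].
Qed.

Lemma predictable_adapted_set t S : times T t -> predictable_sets P T W S ->
  bfilt P W t [set w | S (w, t)].
Proof.
move=> tT pS.
apply: (@predictable_preimage _ (g_sigma_algebraType (bgen P W t)) (fun w => (w, t))) pS => /=.
- rewrite (_ : _ @^-1` _ = setT); last by apply/seteqP; split.
  exact: measurableT.
- move=> A FA; have [t0|t0] := pselect (t = 0).
    rewrite (_ : _ @^-1` _ = A); last by apply/seteqP; split => w /=; [case|].
    by rewrite t0.
  by rewrite (_ : _ @^-1` _ = set0)//; apply/seteqP; split => w //= [].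
- move=> A r s r0 rs sT FA; have [t0|t0] := pselect (r < t <= s).
    rewrite (_ : _ @^-1` _ = A); last by apply/seteqP; split => w /=; [case|].
    by apply: bfilt_le FA; case/andP : t0 => /ltW.
  by rewrite (_ : _ @^-1` _ = set0)//; apply/seteqP; split => w //= [].
Qed.

Lemma predictable_joint_set S : predictable_sets P T W S ->
  measurable [set x : Omega * R | S (x.1, x.2%:E)].
Proof.
have bm t A : t <= T -> bfilt P W t A -> measurable A.
  by move=> tT; exact: (bfilt_measurable basisW tT).
have mE (B : set (\bar R)) : measurable B -> measurable [set s : R | B s%:E].
  by move=> /(mEFin measurableT); rewrite setTI.
move=> pS; apply: (predictable_preimage (phi := fun x : Omega * R => (x.1, x.2%:E))) pS => /=.
- rewrite (_ : _ @^-1` _ = setT `*` [set s : R | times T s%:E]); last first.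
    by apply/seteqP; split => x //= [].
  by apply: measurableX => //; exact: mE measurable_times.
- move=> A FA; rewrite (_ : _ @^-1` _ = A `*` [set s : R | [set 0] s%:E])//.
  by apply: measurableX; [apply: bm FA; exact: ltW|exact: mE].
- move=> A s t _ st tT FA.
  rewrite (_ : _ @^-1` _ = A `*` [set r : R | [set r | s < r <= t] r%:E])//.
  by apply: measurableX; [apply: bm FA; exact: le_trans (ltW st) tT|exact: mE].
Qed.

Lemma predictable_path w i j : measurable_fun (times T) (fun t => X w t i j).
Proof.
move=> _ B mB.
have := predictable_path_set w (measurable_wrt_coord i j predX mB).
by congr measurable; apply/seteqP; split => t.
Qed.

Lemma predictable_adapted t i j : times T t -> fmeas P W t (fun w => X w t i j).
Proof.
move=> tT; apply/fmeasP => B mB.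
have := predictable_adapted_set tT (measurable_wrt_coord i j predX mB).
by congr bfilt; apply/seteqP; split => w //= [].
Qed.

End predictable_sections.

(** The process as a function on the product of Omega and the real line, extended by 0,
    so that the integrals in time and on Omega can be exchanged. *)
Definition real_path (p q : nat) (Z : process Omega R p q) (x : Omega * R) : 'M[R]_(p, q) :=
  if 0 <= x.2%:E <= T then Z x.1 x.2%:E else 0%R.

Lemma predictable_joint (p q : nat) (Z : process Omega R p q) i j :
  predictable P T W Z -> measurable_fun setT (fun x => real_path Z x i j).
Proof.
move=> pZ.
pose D := [set x : Omega * R | times T x.2%:E].
have mD : measurable D.
  suff -> : D = setT `*` (rtimes T) by apply: measurableX => //; exact: measurable_rtimes.
  by apply/seteqP; split => x //= [].
have mZ : measurable_fun D (fun x : Omega * R => Z x.1 x.2%:E i j).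
  move=> _ B mB.
  have := predictable_joint_set (measurable_wrt_coord i j pZ mB).
  by congr measurable; apply/seteqP; split => x.
have := (measurable_restrictT _ mD).1 mZ.
congr measurable_fun; apply/funext => x; rewrite patchE /real_path.
have -> : (x \in D) = (0 <= x.2%:E <= T) by apply/idP/idP => [/set_mem|/mem_set].
by case: ifP => // _; rewrite mxE.
Qed.

Definition jmeas (p q : nat) (Z : process Omega R p q) :=
  forall i j, measurable_fun setT (fun x => real_path Z x i j).

Lemma jmeasB (p q : nat) (Z Z' : process Omega R p q) : jmeas Z -> jmeas Z' ->
  jmeas (fun w t => Z w t - Z' w t)%R.
Proof.
move=> mZ mZ' i j; have := measurable_funB (mZ i j) (mZ' i j).
congr measurable_fun; apply/funext => x; rewrite /real_path/=.
by case: ifP => _; rewrite !mxE// subrr.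
Qed.

Lemma measurable_sqr_enorm dU (U : measurableType dU) (D : set U) (p q : nat)
    (f : U -> 'M[R]_(p, q)) : (forall i j, measurable_fun D (fun x => f x i j)) ->
  measurable_fun D (fun x => enorm (f x) ^+ 2)%R.
Proof.
move=> mf; under eq_fun do rewrite sqr_enorm.
apply: measurable_sum => i; apply: measurable_sum => j; exact: measurable_funX.
Qed.

Lemma measurable_enorm dU (U : measurableType dU) (D : set U) (p q : nat)
    (f : U -> 'M[R]_(p, q)) : (forall i j, measurable_fun D (fun x => f x i j)) ->
  measurable_fun D (fun x => enorm (f x)).
Proof.
move=> mf.
suff : measurable_fun D (@Num.sqrt R \o (fun x => \sum_i \sum_j (f x i j) ^+ 2)%R) by [].
apply: measurableT_comp.
  by apply: continuous_measurable_fun; exact: sqrt_continuous.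
apply: measurable_sum => i; apply: measurable_sum => j; exact: measurable_funX.
Qed.

Definition energy (p q : nat) (Z : process Omega R p q) (w : Omega) : \bar R :=
  \int[mu]_(s in rtimes T) (enorm (Z w s%:E) ^+ 2)%:E.

Lemma energyE (p q : nat) (Z : process Omega R p q) w :
  energy Z w = \int[mu]_s (enorm (real_path Z (w, s)) ^+ 2)%:E.
Proof.
rewrite /energy integral_mkcond; apply: eq_integral => s _.
rewrite patchE /real_path/=.
have -> : (s \in rtimes T) = (0 <= s%:E <= T) by apply/idP/idP => [/set_mem|/mem_set].
by case: ifP => // _; rewrite enorm0 expr0n.
Qed.

Lemma energy_ge0 (p q : nat) (Z : process Omega R p q) w : 0 <= energy Z w.
Proof. by apply: integral_ge0 => s _; rewrite lee_fin sqr_ge0. Qed.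

Let mrp (p q : nat) (Z : process Omega R p q) : jmeas Z ->
  measurable_fun setT (fun x : Omega * R => (enorm (real_path Z x) ^+ 2)%:E).
Proof. by move=> mZ; apply/measurable_EFinP; exact: measurable_sqr_enorm. Qed.

Lemma measurable_energy (p q : nat) (Z : process Omega R p q) : jmeas Z ->
  measurable_fun setT (energy Z).
Proof.
move=> mZ; rewrite (_ : energy Z =
    fubini_F mu (fun x : Omega * R => (enorm (real_path Z x) ^+ 2)%:E)); last first.
  by apply/funext => w; rewrite energyE.
apply: measurable_fun_fubini_tonelli_F; first exact: mrp.
by move=> x; rewrite lee_fin sqr_ge0.
Qed.

Lemma integral_energy (p q : nat) (Z : process Omega R p q) : jmeas Z ->
  \int[P]_w energy Z w = \int[P \x mu]_x (enorm (real_path Z x) ^+ 2)%:E.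
Proof.
move=> mZ.
have f0 (x : Omega * R) : 0 <= (enorm (real_path Z x) ^+ 2)%:E by rewrite lee_fin sqr_ge0.
transitivity (\int[P]_w fubini_F mu (fun x => (enorm (real_path Z x) ^+ 2)%:E) w).
  by apply: eq_integral => w _; rewrite energyE.
have h := @fubini_tonelli1 _ _ _ _ R P mu (fun x => (enorm (real_path Z x) ^+ 2)%:E) (mrp mZ) f0.
by symmetry; apply: h.
Qed.

Lemma sqr_H2norm (p q : nat) (Z : process Omega R p q) :
  H2norm P T Z ^+ 2 = \int[P]_w energy Z w.
Proof. by rewrite sqre_half//; apply: integral_ge0 => w _; exact: energy_ge0. Qed.

Lemma H2norm_ge0 (p q : nat) (Z : process Omega R p q) : 0 <= H2norm P T Z.
Proof. exact: poweR_ge0. Qed.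

Definition supsq (p q : nat) (X : process Omega R p q) (w : Omega) : \bar R :=
  ereal_sup [set (enorm (X w t) ^+ 2)%:E | t in times T].

Let times0 : times T 0. Proof. by rewrite /times/= lexx ltW. Qed.

Lemma supsq_ub (p q : nat) (X : process Omega R p q) w t : times T t ->
  (enorm (X w t) ^+ 2)%:E <= supsq X w.
Proof. by move=> tT; apply: ereal_sup_ubound; exists t. Qed.

Lemma supsq_ge0 (p q : nat) (X : process Omega R p q) w : 0 <= supsq X w.
Proof. by apply: le_trans (supsq_ub X w times0); rewrite lee_fin sqr_ge0. Qed.

Lemma supsqE (p q : nat) (X : process Omega R p q) w :
  ereal_sup [set (enorm (X w t))%:E | t in times T] ^+ 2 = supsq X w.
Proof.
set a := ereal_sup _.
have a0 : 0 <= a.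
  apply: (@le_trans _ _ (enorm (X w 0))%:E); first by rewrite lee_fin enorm_ge0.
  by apply: ereal_sup_ubound; exists 0.
apply/eqP; rewrite eq_le; apply/andP; split; last first.
  apply: ge_ereal_sup => _ [t tT <-].
  have : (enorm (X w t))%:E <= a by apply: ereal_sup_ubound; exists t.
  case: a a0 => [r| |]//; last by rewrite expe2 mulyy !leey.
  by rewrite -EFin_expe !lee_fin => r0 h; rewrite lerXn2r// nnegrE ?enorm_ge0.
have := supsq_ge0 X w; case E : (supsq X w) => [r| |]// r0; last by rewrite leey.
rewrite lee_fin in r0; have : a <= (Num.sqrt r)%:E.
  apply: ge_ereal_sup => _ [t tT <-]; rewrite lee_fin.
  rewrite -(@ler_pXn2r _ 2)// ?nnegrE ?enorm_ge0 ?sqrtr_ge0// (sqr_sqrtr r0).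
  by have := supsq_ub X w tT; rewrite E lee_fin.
case: a a0 => [s| |]//; rewrite -EFin_expe !lee_fin => s0 h.
by rewrite -(sqr_sqrtr r0) lerXn2r// nnegrE sqrtr_ge0.
Qed.

Lemma sqr_S2norm (p q : nat) (X : process Omega R p q) :
  S2norm P T X ^+ 2 = \int[P]_w supsq X w.
Proof.
rewrite -poweR2 ?Lnorm_ge0// poweR_Lnorm//; apply: eq_integral => w _.
by rewrite poweR2 ?abse_ge0// gee0_abs ?supsqE// -?supsqE;
  apply: (@le_trans _ _ (enorm (X w 0))%:E); rewrite ?lee_fin ?enorm_ge0//;
  apply: ereal_sup_ubound; exists 0.
Qed.

Lemma S2norm_ge0 (p q : nat) (X : process Omega R p q) : 0 <= S2norm P T X.
Proof. exact: Lnorm_ge0. Qed.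

(** Every time t < T is a limit from the right of rational times; T itself, which may
    be irrational or +oo, is enumerated too. *)
Definition rtime (n : nat) : \bar R :=
  if (unpickle n : option rat) is Some a then
    (if 0 <= (ratr a : R)%:E <= T then (ratr a : R)%:E else T) else T.

Lemma times_rtime n : times T (rtime n).
Proof.
have TT : times T T by rewrite /times/= lexx ltW.
by rewrite /rtime; case: unpickle => // a; case: ifP.
Qed.

Lemma rtime_rat (a : rat) : times T (ratr a : R)%:E -> exists n, rtime n = (ratr a : R)%:E.
Proof. by move=> h; exists (pickle a); rewrite /rtime pickleK h. Qed.

Lemma rtime_T : exists n, rtime n = T.
Proof.
(* a rational that is not a time is sent to T *)
exists (pickle (-1 : rat)); rewrite /rtime pickleK ifF//.
by rewrite lee_fin rmorphN1 oppr_ge0 ler10.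
Qed.

Lemma supsq_countable (p q : nat) (X : process Omega R p q) w :
  {within times T, continuous (X w)} ->
  supsq X w = ereal_sup (range (fun n => (enorm (X w (rtime n)) ^+ 2)%:E)).
Proof.
move=> cX; apply/eqP; rewrite eq_le; apply/andP; split; last first.
  by apply: ge_ereal_sup => _ [n _ <-]; apply: supsq_ub; exact: times_rtime.
apply: ge_ereal_sup => _ [t tT <-].
have [->|tneT] := eqVneq t T.
  by have [n <-] := rtime_T; apply: ereal_sup_ubound; exists n.
have /andP[t0 tT'] := tT.
have {tneT tT'}ltT : t < T by rewrite lt_neqAle tneT.
case: t t0 ltT tT => [r| |]//= r0 ltT rT; last by case: (T) ltT.
set B := ereal_sup _.
have B0 : 0 <= B.
  by apply: (@le_trans _ _ (enorm (X w (rtime 0)) ^+ 2)%:E);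
    [rewrite lee_fin sqr_ge0|apply: ereal_sup_ubound; exists 0%N].
rewrite leNgt; apply/negP.
case E : B B0 => [b| |]// b0; rewrite lte_fin => bX.
have cn : continuous (fun M : 'M[R]_(p, q) => enorm M ^+ 2)%R.
  rewrite (_ : (fun _ => _) = fun M : 'M[R]_(p, q) => (\sum_i \sum_j M i j ^+ 2)%R); last first.
    by apply/funext => M; rewrite sqr_enorm.
  apply: continuous_big => [|i _]; first exact: add_continuous.
  apply: continuous_big => [|j _ M]; first exact: add_continuous.
  apply: (cvg_comp (fun M : 'M[R]_(p, q) => M i j) (fun x => x ^+ 2)%R).
    exact: coord_continuous.
  exact: exprn_continuous.
have /subspace_continuousP/(_ _ rT) cr := cX.
have {}cr := cvg_comp _ _ cr (cn (X w r%:E)).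
have : \forall s \near within (times T) (nbhs r%:E), (b < enorm (X w s) ^+ 2)%R.
  by apply: (cr _ (lt_nbhsr bX)).
rewrite /within/= => /nbhs_EFin/nbhs_ballP[e /= e0 he].
have [a /andP[ra ae] aT] : exists2 a : rat, (r < ratr a < r + e)%R & (ratr a)%:E <= T.
  case: T ltT => [T'| |]//.
    rewrite lte_fin => rT'.
    have /rat_in_itvoo[a] : (r < Num.min (r + e) T')%R by rewrite lt_min rT' andbT ltrDl.
    rewrite in_itv/= lt_min => /andP[ra /andP[ae aT]].
    by exists a; rewrite ?ra ?ae// lee_fin ltW.
  have /rat_in_itvoo[a] : (r < r + e)%R by rewrite ltrDl.
  by rewrite in_itv/= => rae; exists a => //; rewrite leey.
have aT' : times T (ratr a)%:E.
  by rewrite /times/= aT andbT lee_fin (le_trans _ (ltW ra)).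
have := he (ratr a); rewrite /ball/= => /(_ _ aT').
have -> : (`|r - ratr a| < e)%R by rewrite distrC ger0_norm ?subr_ge0 ?ltW//; lra.
move=> /(_ isT); apply/negP; rewrite -leNgt -lee_fin -E.
by have [n <-] := rtime_rat aT'; apply: ereal_sup_ubound; exists n.
Qed.

Definition cproc (p q : nat) (X : process Omega R p q) : Prop :=
  (forall t, times T t -> forall i j, measurable_fun setT (fun w => X w t i j)) /\
  {ae P, forall w, {within times T, continuous (X w)}}.

Lemma in_S2_cproc (p q : nat) (X : process Omega R p q) : in_S2 P T W X -> cproc X.
Proof.
move=> [pX cX _]; split => // t tT i j.
apply: (fmeas_measurable basisW _ (predictable_adapted pX i j tT)).
by case/andP: tT.
Qed.

Lemma cprocB (p q : nat) (X Y : process Omega R p q) : cproc X -> cproc Y ->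
  cproc (fun w t => X w t - Y w t)%R.
Proof.
move=> [mX cX] [mY cY]; split.
  move=> t tT i j; under eq_fun do rewrite !mxE.
  by apply: measurable_funB; [exact: mX|exact: mY].
apply: filterS2 cX cY => w cX cY x; apply: cvgB; [exact: cX|exact: cY].
Qed.

(** The supremum is almost surely a countable one, and the probability is complete. *)
Lemma measurable_supsq (p q : nat) (X : process Omega R p q) : cproc X ->
  measurable_fun setT (supsq X).
Proof.
move=> [mX cX]; have [_ cP _ _] := basisW.
pose f w := ereal_sup (range (fun n => (enorm (X w (rtime n)) ^+ 2)%:E)).
have mf : measurable_fun setT f.
  rewrite (_ : f = (fun w => esups (fun n => (enorm (X w (rtime n)) ^+ 2)%:E) 0%N)); last first.
    apply/funext => w; rewrite /f /esups; congr ereal_sup; rewrite /sdrop.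
    by apply/seteqP; split => _ [n _ <-]; exists n.
  apply: measurable_fun_esups => n; apply/measurable_EFinP.
  by apply: measurable_sqr_enorm => i j; apply: mX; exact: times_rtime.
apply: (ae_measurable_fun cP _ mf).
by apply: filterS cX => w cw _; rewrite supsq_countable.
Qed.

End processes.

(** * Martingale property and isometry of the stochastic integral *)

Lemma le_ge0_lincomb_integral d (U : measurableType d) (R : realType)
    (mu : {measure set U -> \bar R}) (f g h : U -> \bar R) (a b : R) :
  (0 <= a)%R -> (0 <= b)%R ->
  measurable_fun setT f -> measurable_fun setT g ->
  (forall x, 0 <= h x) -> (forall x, 0 <= f x) -> (forall x, 0 <= g x) ->
  {ae mu, forall x, h x <= a%:E * f x + b%:E * g x} -> measurable_fun setT h ->
  \int[mu]_x h x <= a%:E * \int[mu]_x f x + b%:E * \int[mu]_x g x.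
Proof.
move=> a0 b0 mf mg h0 f0 g0 hfg mh.
have maf : measurable_fun setT (fun x => a%:E * f x) by exact: measurable_funeM.
have mbg : measurable_fun setT (fun x => b%:E * g x) by exact: measurable_funeM.
apply: (@le_trans _ _ (\int[mu]_x (a%:E * f x + b%:E * g x))).
  apply: ae_ge0_le_integral => //.
  - by move=> x _; rewrite adde_ge0 ?mule_ge0.
  - exact: emeasurable_funD.
  - by apply: filterS hfg => x h1 _.
rewrite ge0_integralD//; [|by move=> x _; rewrite mule_ge0..].
by rewrite !ge0_integralZl.
Qed.

Lemma le_eps (R : realType) (x : \bar R) (b C : R) :
  (forall e : R, (0 < e)%R -> x <= (b + C * e)%:E) -> x <= b%:E.
Proof.
move=> h; apply/lee_addgt0Pr => e e0.
have C1 : (0 < `|C| + 1)%R by rewrite ltr_pwDr.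
apply: le_trans (h (e / (`|C| + 1))%R _) _; first by rewrite divr_gt0.
rewrite lee_fin lerD2l mulrA ler_pdivrMr// mulrC ler_pM2l//.
by rewrite (le_trans (ler_norm C))// lerDl.
Qed.

Section squared_norm.
Context (R : realType) dU (U : measurableType dU) (mu : {measure set U -> \bar R}) (p q : nat).

Lemma sqnorm_split (f g : U -> 'M[R]_(p, q)) (c : R) : (0 < c)%R ->
  (forall i j, measurable_fun setT (fun x => f x i j)) ->
  (forall i j, measurable_fun setT (fun x => g x i j)) ->
  \int[mu]_x (enorm (f x) ^+ 2)%:E <=
  (1 + c)%:E * \int[mu]_x (enorm (g x) ^+ 2)%:E +
  (1 + c^-1)%:E * \int[mu]_x (enorm (f x - g x) ^+ 2)%:E.
Proof.
move=> c0 mf mg.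
have m1 := measurable_sqr_enorm mf; have m2 := measurable_sqr_enorm mg.
have m3 : measurable_fun setT (fun x => enorm (f x - g x) ^+ 2)%R.
  apply: measurable_sqr_enorm => i j.
  by under eq_fun do rewrite !mxE; exact: measurable_funB.
apply: le_ge0_lincomb_integral.
- by rewrite addr_ge0// ltW.
- by rewrite addr_ge0// invr_ge0 ltW.
- exact/measurable_EFinP.
- exact/measurable_EFinP.
- by move=> x; rewrite lee_fin sqr_ge0.
- by move=> x; rewrite lee_fin sqr_ge0.
- by move=> x; rewrite lee_fin sqr_ge0.
- apply: aeW => x; rewrite -!EFinM -EFinD lee_fin.
  rewrite -[X in (enorm X ^+ 2 <= _)%R](subrK (g x)) addrC.
  exact: sqr_enormD_le.
- exact/measurable_EFinP.
Qed.

End squared_norm.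

(** An equality of L^2 norms along two approximating sequences passes to the limit. Only
    one inequality is stated; the triangle inequality is used in the form of Young's
    inequality, with a weight that tends to 0 after the approximation. *)
Lemma sqnorm_limit_le (R : realType) dU dV (U : measurableType dU) (V : measurableType dV)
  (mu : {measure set U -> \bar R}) (nu : {measure set V -> \bar R}) (p q p' q' : nat)
  (F_ : nat -> U -> 'M[R]_(p, q)) (F : U -> 'M[R]_(p, q))
  (G_ : nat -> V -> 'M[R]_(p', q')) (G : V -> 'M[R]_(p', q')) :
  (forall k i j, measurable_fun setT (fun x => F_ k x i j)) ->
  (forall i j, measurable_fun setT (fun x => F x i j)) ->
  (forall k i j, measurable_fun setT (fun x => G_ k x i j)) ->
  (forall i j, measurable_fun setT (fun x => G x i j)) ->
  (forall k, \int[mu]_x (enorm (F_ k x) ^+ 2)%:E = \int[nu]_x (enorm (G_ k x) ^+ 2)%:E) ->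
  \int[mu]_x (enorm (F_ k x - F x) ^+ 2)%:E @[k --> \oo] --> 0 ->
  \int[nu]_x (enorm (G_ k x - G x) ^+ 2)%:E @[k --> \oo] --> 0 ->
  \int[nu]_x (enorm (G x) ^+ 2)%:E < +oo ->
  \int[mu]_x (enorm (F x) ^+ 2)%:E <= \int[nu]_x (enorm (G x) ^+ 2)%:E.
Proof.
move=> mF_ mF mG_ mG FG F0 G0 Goo.
set b := \int[nu]_x _ in Goo *.
have b0 : 0 <= b by apply: integral_ge0 => x _; rewrite lee_fin sqr_ge0.
have bfin : b \is a fin_num by rewrite ge0_fin_numE.
rewrite -(fineK bfin).
set r := fine b; have r0 : (0 <= r)%R by exact: fine_ge0.
have key (c e : R) : (0 < c)%R -> (0 < e)%R ->
    \int[mu]_x (enorm (F x) ^+ 2)%:E <=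
    ((1 + c) * ((1 + c) * r + (1 + c^-1) * e) + (1 + c^-1) * e)%:E.
  move=> c0 e0.
  have /cvge0P hF := F0; have /cvge0P hG := G0.
  have c1 : (0 <= 1 + c)%R by rewrite addr_ge0// ltW.
  have c2 : (0 <= 1 + c^-1)%R by rewrite addr_ge0// invr_ge0 ltW.
  have [k [ke1 ke2]] : exists k,
    \int[mu]_x (enorm (F_ k x - F x) ^+ 2)%:E <= e%:E /\
    \int[nu]_x (enorm (G_ k x - G x) ^+ 2)%:E <= e%:E.
    have [||k _ /(_ k (leqnn k)) [h1 h2]] := filterI (hF _ e e0) (hG _ e e0).
    - by move=> n; apply: integral_ge0 => x _; rewrite lee_fin sqr_ge0.
    - by move=> n; apply: integral_ge0 => x _; rewrite lee_fin sqr_ge0.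
    by exists k.
  apply: (le_trans (sqnorm_split mu c0 mF (mF_ k))).
  rewrite [leRHS]EFinD EFinM [in leRHS]EFinM; apply: leeD.
    rewrite lee_wpmul2l ?lee_fin// FG.
    apply: (le_trans (sqnorm_split nu c0 (mG_ k) mG)).
    rewrite [leRHS]EFinD ![in leRHS]EFinM; apply: leeD; first by rewrite -/b -(fineK bfin).
    by rewrite lee_wpmul2l ?lee_fin.
  rewrite lee_wpmul2l ?lee_fin//.
  by under eq_integral do rewrite enormC.
have key2 (c : R) : (0 < c)%R ->
    \int[mu]_x (enorm (F x) ^+ 2)%:E <= ((1 + c) ^+ 2 * r)%:E.
  move=> c0; apply: (@le_eps _ _ _ ((1 + c) * (1 + c^-1) + (1 + c^-1))%R) => e e0.
  by apply: le_trans (key c e c0 e0) _; rewrite lee_fin; lra.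
apply: (@le_eps _ _ _ (3 * r)%R) => e e0.
have e1 : (0 < Num.min e 1)%R by rewrite lt_min e0 ltr01.
apply: le_trans (key2 _ e1) _; rewrite lee_fin.
have : (Num.min e 1 <= e)%R by rewrite ge_min lexx.
have : (Num.min e 1 <= 1)%R by rewrite ge_min lexx orbT.
move: e1; move: (Num.min e 1)%R => m m0 m1 me.
have h1 : (r * m <= r * e)%R by rewrite ler_wpM2l.
have h2 : (r * (m * m) <= r * m)%R by rewrite ler_wpM2l// ler_piMl// ltW.
by rewrite expr2; lra.
Qed.

Section ito.
Context (R : realType) (dO : measure_display) (Omega : measurableType dO)
  (P : probability Omega R) (d : nat) (T : \bar R) (W : Omega -> R -> 'cV[R]_d).
Hypothesis T_gt0 : 0 < T.
Hypothesis basisW : brownian_basis P T W.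
Local Notation mu := (@lebesgue_measure R).
Context (m : nat).
Implicit Types (H : simple_integrand P T W m).
Local Notation supsq := (supsq T).
Local Notation fmeas := (fmeas P W).

Lemma si_jmeas H : jmeas T (si_process H).
Proof.
move=> i j; pose l := @si_l _ _ _ _ _ _ _ _ H; pose r := @si_r _ _ _ _ _ _ _ _ H.
pose c := @si_coef _ _ _ _ _ _ _ _ H.
have rT k : (r k)%:E <= T := si_rT (s:=H) k.
have lr k : (l k <= r k)%R := si_lr (s:=H) k.
have l0 k : (0 <= l k)%R := si_l0 (s:=H) k.
have -> : (fun x => real_path T (si_process H) x i j) =
    (fun x => \sum_k c k x.1 i j * \1_(`]l k, r k]) x.2)%R.
  apply/funext => x; rewrite /real_path /si_process; case: ifPn => h.
    rewrite summxE; apply: eq_bigr => k _; rewrite indicE mem_setE in_itv/=.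
    by rewrite !lte_fin lee_fin; case: ifP => _; rewrite ?mulr1 ?mulr0// mxE.
  rewrite mxE big1// => k _; rewrite indicE mem_setE in_itv/=.
  case: andP => [[lx xr]|_]; last by rewrite mulr0.
  exfalso; move/negP : h; apply; rewrite lee_fin (le_trans (l0 k) (ltW lx))/=.
  by rewrite (le_trans _ (rT k))// lee_fin.
apply: measurable_sum => k; apply: measurable_funM.
  apply: (measurableT_comp (f := fun w => c k w i j)) => //.
  apply: (fmeas_measurable basisW) (si_coef_fmeas (H := H) (k := k) i j).
  by rewrite (le_trans _ (rT k))// lee_fin; exact: lr.
have m1 : measurable_fun setT (\1_(`]l k, r k]) : R -> R).
  by apply: measurable_indic; exact: measurable_itv.
exact: (measurableT_comp m1 measurable_snd).
Qed.

(** Concatenate the terms of H and the opposites of the terms of H'. *)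
Lemma si_sub H H' : exists D : simple_integrand P T W m,
  (forall w t, si_process D w t = si_process H w t - si_process H' w t)%R /\
  (forall w t, si_integral D w t = si_integral H w t - si_integral H' w t)%R.
Proof.
pose n := si_size H; pose n' := si_size H'.
pose sel (V : Type) (f : 'I_n -> V) (g : 'I_n' -> V) (k : 'I_(n + n')) : V :=
  match fintype.split k with inl i => f i | inr i => g i end.
pose l := sel _ (@si_l _ _ _ _ _ _ _ _ H) (@si_l _ _ _ _ _ _ _ _ H').
pose r := sel _ (@si_r _ _ _ _ _ _ _ _ H) (@si_r _ _ _ _ _ _ _ _ H').
pose c := sel _ (@si_coef _ _ _ _ _ _ _ _ H)
                (fun k w => - @si_coef _ _ _ _ _ _ _ _ H' k w)%R.
have h1 k : (0 <= l k)%R by rewrite /l /sel; case: (fintype.split _) => i; exact: si_l0.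
have h2 k : (l k <= r k)%R by rewrite /l /r /sel; case: (fintype.split _) => i; exact: si_lr.
have h3 k : (r k)%:E <= T by rewrite /r /sel; case: (fintype.split _) => i; exact: si_rT.
have h4 k : measurable_wrt setT (bfilt P W (l k)%:E) (c k).
  rewrite /l /c /sel; case: (fintype.split _) => i; first exact: si_meas.
  move=> B mB; rewrite bfiltE.
  apply: (@measurable_borel_mx _ _ _ _ (g_sigma_algebraType (bgen P W _))) mB => //.
  move=> i' j'; under eq_fun do rewrite mxE.
  by apply: measurable_funN; exact: si_coef_fmeas.
have h5 k : exists C : R, forall w, (enorm (c k w) <= C)%R.
  rewrite /c /sel; case: (fintype.split _) => i; first exact: si_bounded.
  by have [C hC] := si_bounded (s:=H') i; exists C => w; rewrite enormN.
exists (SimpleIntegrand h1 h2 h3 h4 h5); split => w t.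
- rewrite /si_process/= big_split_ord/= -sumrN; congr (_ + _)%R; apply: eq_bigr => k _.
    by rewrite /l /r /c /sel (unsplitK (inl k)).
  by rewrite /l /r /c /sel (unsplitK (inr k)); case: ifP; rewrite ?oppr0.
- rewrite /si_integral/= big_split_ord/= -sumrN; congr (_ + _)%R; apply: eq_bigr => k _.
    by rewrite /l /r /c /sel (unsplitK (inl k)).
  by rewrite /l /r /c /sel (unsplitK (inr k)) mulNmx.
Qed.

Lemma sqint_supsq (X : process Omega R m 1) t i : times T t ->
  measurable_fun setT (fun w => X w t i ord0) -> \int[P]_w supsq X w < +oo ->
  sqint P (fun w => X w t i ord0) /\
  ((\int[P]_w (X w t i ord0 ^+ 2))%R%:E <= \int[P]_w supsq X w).
Proof.
move=> tT mX Xoo.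
have le1 : \int[P]_w ((X w t i ord0) ^+ 2)%:E <= \int[P]_w supsq X w.
  apply: le_ge0_integral => w; first by rewrite lee_fin sqr_ge0.
  apply: le_trans (supsq_ub X w tT); rewrite lee_fin sqr_enorm.
  rewrite (bigD1 i)//= big_ord1 lerDl sumr_ge0// => k _.
  by rewrite sumr_ge0// => j _; rewrite sqr_ge0.
have sX : sqint P (fun w => X w t i ord0).
  split => //; apply/integrableP; split.
    by apply/measurable_EFinP; exact: measurable_funX.
  under eq_integral do rewrite gee0_abs ?lee_fin ?sqr_ge0//.
  exact: le_lt_trans Xoo.
by split => //; rewrite EFin_exp//; case: sX.
Qed.

Section one_integral.
Context (Z : process Omega R m d) (M : process Omega R m 1).
Hypothesis ZM : ito_integral P T W Z M.

Lemma ito_approx : exists H : nat -> simple_integrand P T W m,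
  \int[P]_w energy T (fun w t => si_process (H k) w t - Z w t)%R w @[k --> \oo] --> 0 /\
  \int[P]_w supsq (fun w t => si_integral (H k) w t - M w t)%R w @[k --> \oo] --> 0.
Proof.
have [_ [H [hH hS]]] := ZM; exists H; split.
- under eq_fun do rewrite -sqr_H2norm.
  by apply: (cvge0_sqr _).1 hH => n; exact: H2norm_ge0.
- under eq_fun do rewrite -(sqr_S2norm P T_gt0).
  by apply: (cvge0_sqr _).1 hS => n; exact: S2norm_ge0.
Qed.

Let M_S2 : in_S2 P T W M. Proof. by case: ZM. Qed.

Lemma in_S2_supsq (X : process Omega R m 1) : in_S2 P T W X -> \int[P]_w supsq X w < +oo.
Proof.
move=> [_ _ Xoo]; rewrite -(sqr_S2norm P T_gt0).
by apply: sqre_lty => //; exact: S2norm_ge0.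
Qed.

Lemma ito_sqint t i : times T t -> sqint P (fun w => M w t i ord0).
Proof.
move=> tT; have [mM _] := in_S2_cproc basisW M_S2.
by have [] := sqint_supsq tT (mM t tT i ord0) (in_S2_supsq M_S2).
Qed.

(** Orthogonality of the increment to X passes to the limit by Cauchy-Schwarz, since the
    approximation error at the times s and t is at most the error in S^2. *)
Lemma ito_martingale s t X i : 0 <= s -> s <= t -> t <= T ->
  fmeas s X -> sqint P X ->
  (\int[P]_w (X w * (M w t i ord0 - M w s i ord0)) = 0)%R.
Proof.
move=> s0 st tT FX sX.
have times_t : times T t by rewrite /times/= tT andbT (le_trans s0).
have times_s : times T s by rewrite /times/= s0 (le_trans st).
have t0 : 0 <= t by case/andP: times_t.
have sT : s <= T by case/andP: times_s.
have [H [_ /cvge0P HM]] := ito_approx.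
set x := (\int[P]_w _)%R.
pose C := (\int[P]_w (X w ^+ 2))%R.
have C0 : (0 <= C)%R by apply: exp_ge0 => w; exact: sqr_ge0.
suff : (x ^+ 2)%:E <= 0%R%:E.
  by rewrite lee_fin => h; apply/eqP; rewrite -sqrf_eq0 eq_le h sqr_ge0.
apply: (@le_eps _ _ _ (4 * C)%R) => e e0; rewrite add0r.
have [|k _ /(_ k (leqnn k)) /= ke] := HM _ e e0.
  by move=> n; apply: integral_ge0 => w _; exact: supsq_ge0.
set D := (fun w t => si_integral (H k) w t - M w t)%R in ke.
have Doo : \int[P]_w supsq D w < +oo by rewrite (le_lt_trans ke)// ltry.
have mD r : times T r -> measurable_fun setT (fun w => D w r i ord0).
  move=> rT; rewrite /D; under eq_fun do rewrite !mxE.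
  have [r0 rT'] := andP rT.
  apply: measurable_funB; last by case: (ito_sqint i rT).
  by case: (sqint_si_integral basisW (H k) i r0 rT').
have [sDt eDt] := sqint_supsq times_t (mD t times_t) Doo.
have [sDs eDs] := sqint_supsq times_s (mD s times_s) Doo.
pose u := (\int[P]_w (X w * D w t i ord0))%R; pose v := (\int[P]_w (X w * D w s i ord0))%R.
have xuv : x = (v - u)%R.
  have sI r : times T r -> sqint P (fun w => si_integral (H k) w r i ord0).
    by move=> /andP[? ?]; exact: (sqint_si_integral basisW).
  have := si_integral_martingale basisW (H k) i s0 st tT FX sX.
  set y := (\int[P]_w _)%R => y0.
  suff : (x + u = y + v)%R by lra.
  rewrite /x /u /y /v -!expD.
  - by apply: eq_Rintegral => w _; rewrite /D !mxE; ring.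
  - by apply: sqint_mul_int => //; apply: sqintB; exact: sI.
  - exact: sqint_mul_int.
  - by apply: sqint_mul_int => //; apply: sqintB; exact: ito_sqint.
  - exact: sqint_mul_int.
have bnd (r : \bar R) : times T r -> sqint P (fun w => D w r i ord0) ->
    (\int[P]_w (D w r i ord0 ^+ 2))%R%:E <= \int[P]_w supsq D w ->
    ((\int[P]_w (X w * D w r i ord0)) ^+ 2 <= C * e)%R.
  move=> rT sD eD; apply: le_trans (cauchy_schwarz sX sD) _.
  by rewrite ler_wpM2l// -lee_fin (le_trans eD).
have := bnd t times_t sDt eDt; rewrite -/u => hu.
have := bnd s times_s sDs eDs; rewrite -/v => hv.
by rewrite lee_fin xuv; have := sqr_ge0 (u + v)%R; nra.
Qed.

End one_integral.

(** The isometry for the difference of the approximating simple integrands, in the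
    limit. *)
Lemma ito_isometry_le (Z Z' : process Omega R m d) (M M' : process Omega R m 1) :
  ito_integral P T W Z M -> ito_integral P T W Z' M' ->
  jmeas T Z -> jmeas T Z' ->
  \int[P]_w energy T (fun w t => Z w t - Z' w t)%R w <=
  \int[P]_w (enorm (M w T - M' w T) ^+ 2)%:E.
Proof.
move=> ZM ZM' mZ mZ'.
have TT : times T T by rewrite /times/= lexx ltW.
have T0 : 0 <= T by exact: ltW.
have [H [HZ HM]] := ito_approx ZM; have [H' [HZ' HM']] := ito_approx ZM'.
pose D k := projT1 (cid (si_sub (H k) (H' k))).
have DP k w t : (si_process (D k) w t = si_process (H k) w t - si_process (H' k) w t)%R.
  by rewrite /D; case: cid => D' /= [].
have DI k w t : (si_integral (D k) w t = si_integral (H k) w t - si_integral (H' k) w t)%R.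
  by rewrite /D; case: cid => D' /= [].
have [mM _] := in_S2_cproc basisW (proj1 ZM).
have [mM' _] := in_S2_cproc basisW (proj1 ZM').
rewrite integral_energy; last exact: jmeasB.
pose G_ k w := si_integral (D k) w T; pose G w := (M w T - M' w T)%R.
have mG i j : measurable_fun setT (fun w => G w i j).
  by rewrite /G; under eq_fun do rewrite !mxE; apply: measurable_funB; [exact: mM|exact: mM'].
have mI (K : simple_integrand P T W m) i j : measurable_fun setT (fun w => si_integral K w T i j).
  by rewrite (ord1 j); case: (sqint_si_integral basisW K i T0 (lexx T)).
have sq0 (u v w : (\bar R)^nat) : (forall n, 0 <= u n) -> (forall n, 0 <= v n) ->
    (forall n, 0 <= w n) -> (forall n, w n <= 2%:E * u n + 2%:E * v n) ->
    u n @[n --> \oo] --> 0 -> v n @[n --> \oo] --> 0 -> w n @[n --> \oo] --> 0.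
  move=> u0 v0 w0 wuv /(cvge0P u0) hu /(cvge0P v0) hv; apply/(cvge0P w0) => e e0.
  have e4 : (0 < e / 4)%R by rewrite divr_gt0.
  near=> n; apply: le_trans (wuv n) _.
  apply: (@le_trans _ _ (2%:E * (e / 4)%:E + 2%:E * (e / 4)%:E)).
    apply: leeD; rewrite lee_wpmul2l ?lee_fin//; near: n; [exact: hu|exact: hv].
  by rewrite -!EFinM -EFinD lee_fin; lra.
have sqB (p q : nat) (A B : 'M[R]_(p, q)) :
    (enorm (A - B) ^+ 2 <= 2 * enorm A ^+ 2 + 2 * enorm B ^+ 2)%R.
  have := sqr_enormD_le A (- B)%R (@ltr01 R); rewrite enormN invr1.
  by rewrite (_ : 1 + 1 = 2)%R//; lra.
apply: (@sqnorm_limit_le _ _ _ _ _ (P \x mu) P _ _ _ _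
  (fun k => real_path T (si_process (D k)))
  (real_path T (fun w t => Z w t - Z' w t)%R) G_ G).
- by move=> k; exact: si_jmeas.
- exact: jmeasB.
- by move=> k i j; exact: mI.
- exact: mG.
- move=> k; rewrite -integral_energy; last exact: si_jmeas.
  exact/esym/(ito_isometry_simple basisW).
- apply: (sq0 _ _ _ _ _ _ _ HZ HZ').
  + by move=> n; apply: integral_ge0 => w _; exact: energy_ge0.
  + by move=> n; apply: integral_ge0 => w _; exact: energy_ge0.
  + by move=> n; apply: integral_ge0 => x _; rewrite lee_fin sqr_ge0.
  + move=> n; rewrite !integral_energy; last 2 first.
    * by apply: jmeasB => //; exact: si_jmeas.
    * by apply: jmeasB => //; exact: si_jmeas.
    have mE (K : simple_integrand P T W m) (Y : process Omega R m d) : jmeas T Y ->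
        measurable_fun setT (fun x => (enorm (real_path T (fun w t => si_process K w t - Y w t)%R x) ^+ 2)%:E).
      move=> mY; apply/measurable_EFinP; apply: measurable_sqr_enorm; apply: jmeasB => //.
      exact: si_jmeas.
    apply: le_ge0_lincomb_integral => //; try exact: mE; try by move=> x; rewrite lee_fin sqr_ge0.
      apply: aeW => x; rewrite -!EFinM -EFinD lee_fin.
      apply: le_trans (sqB _ _ _ _); rewrite le_eqVlt; apply/orP; left; apply/eqP.
      congr (enorm _ ^+ 2)%R; rewrite /real_path; case: ifP => _; last by rewrite !subr0.
      by rewrite DP; apply/matrixP => i j; rewrite !mxE; ring.
    apply/measurable_EFinP; apply: measurable_sqr_enorm => i j.
    under eq_fun do rewrite !mxE; apply: measurable_funB; first exact: si_jmeas.
    exact: jmeasB.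
- have hS (K : simple_integrand P T W m) (M0 : process Omega R m 1) :
      (forall i j, measurable_fun setT (fun w => M0 w T i j)) ->
      measurable_fun setT (fun w => (enorm (si_integral K w T - M0 w T) ^+ 2)%:E).
    move=> mM0; apply/measurable_EFinP; apply: measurable_sqr_enorm => i j.
    by under eq_fun do rewrite !mxE; exact: measurable_funB.
  apply: (sq0 _ _ _ _ _ _ _ HM HM').
  + by move=> n; apply: integral_ge0 => w _; exact: supsq_ge0.
  + by move=> n; apply: integral_ge0 => w _; exact: supsq_ge0.
  + by move=> n; apply: integral_ge0 => x _; rewrite lee_fin sqr_ge0.
  + move=> n.
    apply: (@le_trans _ _
      (2%:E * \int[P]_w (enorm (si_integral (H n) w T - M w T) ^+ 2)%:E +
       2%:E * \int[P]_w (enorm (si_integral (H' n) w T - M' w T) ^+ 2)%:E)).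
      apply: le_ge0_lincomb_integral => //; try by move=> x; rewrite lee_fin sqr_ge0.
      * by apply: hS; exact: mM.
      * by apply: hS; exact: mM'.
      * apply: aeW => w; rewrite -!EFinM -EFinD lee_fin.
        apply: le_trans (sqB _ _ _ _); rewrite le_eqVlt; apply/orP; left; apply/eqP.
        congr (enorm _ ^+ 2)%R; rewrite /G_ /G DI.
        by apply/matrixP => i j; rewrite !mxE; ring.
      * apply/measurable_EFinP; apply: measurable_sqr_enorm => i j.
        by under eq_fun do rewrite mxE [X in (_ + X)%R]mxE; apply: measurable_funB; [exact: mI|exact: mG].
    apply: leeD; rewrite lee_wpmul2l ?lee_fin//; apply: le_ge0_integral => w;
      rewrite ?lee_fin ?sqr_ge0//.
      exact: (supsq_ub (fun w t => si_integral (H n) w t - M w t)%R w TT).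
    exact: (supsq_ub (fun w t => si_integral (H' n) w t - M' w t)%R w TT).
- apply: (@le_lt_trans _ _ (2%:E * \int[P]_w supsq M w + 2%:E * \int[P]_w supsq M' w)).
    have mS (M0 : process Omega R m 1) : in_S2 P T W M0 -> measurable_fun setT (supsq M0).
      by move=> h; exact: (measurable_supsq T_gt0 basisW (in_S2_cproc basisW h)).
    apply: le_ge0_lincomb_integral => //.
    + exact: mS (proj1 ZM).
    + exact: mS (proj1 ZM').
    + by move=> x; rewrite lee_fin sqr_ge0.
    + by move=> x; exact: supsq_ge0.
    + by move=> x; exact: supsq_ge0.
    + apply: aeW => w; apply: (@le_trans _ _ ((2 * enorm (M w T) ^+ 2 + 2 * enorm (M' w T) ^+ 2)%R)%:E).
        by rewrite lee_fin sqB.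
      by rewrite EFinD !EFinM; apply: leeD; rewrite lee_wpmul2l ?lee_fin//; exact: supsq_ub.
    + by apply/measurable_EFinP; exact: measurable_sqr_enorm.
  apply: lte_add_pinfty; rewrite lte_mul_pinfty//; try exact: in_S2_supsq (proj1 _).
  + exact: in_S2_supsq (proj1 ZM).
  + exact: in_S2_supsq (proj1 ZM').
Unshelve. all: by end_near. Qed.

End ito.

(** * The maximal inequality of Doob in L^2 *)

Section running_maximum.
Context (R : realType).
Implicit Type f : nat -> R.

(** Only used for norms, so that starting from 0 adds nothing to the maximum. *)
Fixpoint runmax f n : R := if n is k.+1 then Num.max (runmax f k) (f k) else 0%R.

Lemma runmax_ge0 f n : (0 <= runmax f n)%R.
Proof. by elim: n => //= n IH; rewrite le_max IH. Qed.

Lemma runmax_ub f n k : (k < n)%N -> (f k <= runmax f n)%R.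
Proof.
elim: n => // n IH; rewrite ltnS leq_eqVlt => /predU1P[->|/IH h] /=.
  by rewrite le_max lexx orbT.
by rewrite le_max h.
Qed.

Lemma runmax_le f n (b : R) : (0 <= b)%R -> (forall k, (k < n)%N -> (f k <= b)%R) ->
  (runmax f n <= b)%R.
Proof.
move=> b0; elim: n => //= n IH fb; rewrite ge_max fb// andbT.
by apply: IH => k kn; apply: fb; exact: ltnW.
Qed.

Lemma measurable_runmax dU (U : measurableType dU) (f : nat -> U -> R) n :
  (forall k, (k < n)%N -> measurable_fun setT (f k)) ->
  measurable_fun setT (fun x => runmax (f ^~ x) n).
Proof.
elim: n => [_|n IH mf] /=; first exact: measurable_cst.
apply: measurable_maxr; last exact: mf.
by apply: IH => k kn; apply: mf; exact: ltnW.
Qed.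

End running_maximum.

Section doob.
Context (R : realType) (dO : measure_display) (Omega : measurableType dO)
  (P : probability Omega R) (d : nat) (T : \bar R) (W : Omega -> R -> 'cV[R]_d).
Hypothesis T_gt0 : 0 < T.
Hypothesis basisW : brownian_basis P T W.
Context (m : nat) (L : process Omega R m 1).
Local Notation fmeas := (fmeas P W).
Local Notation E f := (\int[P]_w f w)%R.

Hypothesis L_adapted : forall t i, times T t -> fmeas t (fun w => L w t i ord0).
Hypothesis L_sqint : forall t i, times T t -> sqint P (fun w => L w t i ord0).
Hypothesis L_mart : forall s t X i, 0 <= s -> s <= t -> t <= T ->
  fmeas s X -> sqint P X -> (E (fun w => X w * (L w t i ord0 - L w s i ord0)) = 0)%R.

Section discrete.
Context (tau : nat -> \bar R).
Hypothesis tau_times : forall k, times T (tau k).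
Hypothesis tau_le : forall k, tau k <= tau k.+1.

Let a k w : R := enorm (L w (tau k)).
Let mx k w : R := runmax (a ^~ w) k.+1.

Let a0 k w : (0 <= a k w)%R. Proof. exact: enorm_ge0. Qed.
Let mx_ge0 k w : (0 <= mx k w)%R. Proof. exact: runmax_ge0. Qed.
Let mx0 w : mx 0 w = a 0 w. Proof. by rewrite /mx/= max_r. Qed.
Let mxS k w : mx k.+1 w = Num.max (mx k w) (a k.+1 w). Proof. by []. Qed.

Let Fa k : fmeas (tau k) (a k).
Proof.
apply: measurable_enorm => i j; rewrite (ord1 j); exact: L_adapted.
Qed.

Let Fmx k : fmeas (tau k) (mx k).
Proof.
elim: k => [|k IH].
  by rewrite (_ : mx 0 = a 0); [exact: Fa|apply/funext => w; rewrite mx0].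
apply: measurable_maxr; last exact: Fa.
exact: fmeas_le (tau_le k) IH.
Qed.

Let fm k X : fmeas (tau k) X -> measurable_fun setT X.
Proof. by apply: (fmeas_measurable basisW); case/andP: (tau_times k). Qed.

Let sqint_a k : sqint P (a k).
Proof.
split; first exact: fm (@Fa k).
have -> : (fun w => (a k w ^+ 2)%:E) = (EFin \o (fun w => \sum_i (L w (tau k) i ord0) ^+ 2)%R).
  apply/funext => w /=; rewrite /a sqr_enorm; congr EFin.
  by apply: eq_bigr => i _; rewrite big_ord1.
by apply: (proj1 (@exp_sum _ _ _ P _ _ _ _)) => i; case: (L_sqint i (tau_times k)).
Qed.

Let sqint_mx k : sqint P (mx k).
Proof.
elim: k => [|k IH].
  by rewrite (_ : mx 0 = a 0); [exact: sqint_a|apply/funext => w; rewrite mx0].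
split; first exact: fm (@Fmx k.+1).
apply: (@integrable_le _ _ _ P _ (fun w => mx k w ^+ 2 + a k.+1 w ^+ 2)%R).
- by apply: measurable_funX; exact: fm (@Fmx k.+1).
- move=> w; rewrite ger0_norm ?sqr_ge0// mxS.
  by rewrite /Num.max; case: ifP => _; rewrite ?lerDl ?lerDr sqr_ge0.
- apply: integrableD_EFin; first by case: IH.
  by case: (sqint_a k.+1).
Qed.

(** |L_k+1| - |L_k| is at least the scalar product of L_k / |L_k| with L_k+1 - L_k. This
    lower bound is a martingale increment multiplied by a bounded variable known at
    time k, and it stays centred when multiplied by the running maximum. Where L_k
    vanishes its inverse norm is 0 and the bound is trivial. *)
Let submartingale k : (0 <= E (fun w => mx k w * (a k.+1 w - a k w)))%R.
Proof.
pose X i w := ((a k w)^-1 * L w (tau k) i ord0 * mx k w)%R.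
have minv : fmeas (tau k) (fun w => (a k w)^-1)%R.
  have -> : (fun w => (a k w)^-1)%R = (fun x => x `^ -1)%R \o a k.
    by apply/funext => w /=; rewrite powR_inv1.
  by apply: measurableT_comp (@Fa k); exact: measurable_powR.
have FX i : fmeas (tau k) (X i).
  apply: measurable_funM; last exact: Fmx.
  by apply: measurable_funM => //; exact: L_adapted.
have sX i : sqint P (X i).
  rewrite /X; apply: (@sqint_boundedM _ _ _ P _ _ 1%R); last exact: sqint_mx.
    apply: (fm (k := k)); apply: measurable_funM => //; exact: L_adapted.
  move=> w; rewrite normrM normfV (ger0_norm (a0 k w)).
  have [->|an0] := eqVneq (a k w) 0%R; first by rewrite invr0 mul0r ler01.
  rewrite mulrC ler_pdivrMr ?mul1r; first exact: enorm_entry.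
  by rewrite lt_def an0 a0.
pose D i w := (X i w * (L w (tau k.+1) i ord0 - L w (tau k) i ord0))%R.
have sD i : P.-integrable setT (EFin \o D i).
  by apply: sqint_mul_int => //; apply: sqintB; apply: L_sqint.
have [iS eS] := @exp_sum _ _ _ P _ (index_enum _) D sD.
have -> : 0%R = E (fun w => \sum_i D i w)%R.
  rewrite eS big1// => i _; apply: L_mart => //.
  - by case/andP: (tau_times k).
  - by case/andP: (tau_times k.+1).
apply: le_exp => //.
  by apply: sqint_mul_int => //; apply: sqintB.
move=> w.
have -> : (\sum_i D i w = mx k w * ((a k w)^-1 *
    (mxdot (L w (tau k)) (L w (tau k.+1)) - a k w ^+ 2)))%R.
  rewrite /a sqr_enorm -mxdot_xx /mxdot -sumrB !mulr_sumr.
  by apply: eq_bigr => i _; rewrite !big_ord1 /D /X; ring.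
rewrite ler_wpM2l//.
have [ak0|an0] := eqVneq (a k w) 0%R; first by rewrite ak0 invr0 mul0r subr0.
have ak : (0 < a k w)%R by rewrite lt_def an0 a0.
rewrite mulrC ler_pdivrMr//.
have := mxdot_le (L w (tau k)) (L w (tau k.+1)); rewrite -/(a k w) -/(a k.+1 w).
by lra.
Qed.

(** With m_k the running maximum and a_k = |L_k|, the quantity m_k a_k - m_k^2 / 2 has
    nonnegative expectation: its increment is at least m_k (a_k+1 - a_k), because
    either the maximum does not move or it becomes a_k+1. Then
    m a - m^2 / 2 <= a^2 - m^2 / 4, that is 0 <= (a - m / 2)^2, gives the constant 4. *)
Lemma doob_discrete n :
  sqint P (fun w => runmax (fun k => enorm (L w (tau k))) n.+1) /\
  (E (fun w => runmax (fun k => enorm (L w (tau k))) n.+1 ^+ 2) <=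
   4 * E (fun w => enorm (L w (tau n)) ^+ 2))%R.
Proof.
split; first exact: (sqint_mx n).
pose Phi k w := (mx k w * a k w - 2^-1 * mx k w ^+ 2)%R.
have i1 k : P.-integrable setT (EFin \o (fun w => mx k w * a k w)%R) by exact: sqint_mul_int.
have i2 k : P.-integrable setT (EFin \o (fun w => mx k w ^+ 2)%R) by case: (sqint_mx k).
have i3 k : P.-integrable setT (EFin \o (fun w => a k w ^+ 2)%R) by case: (sqint_a k).
have iPhi k : P.-integrable setT (EFin \o Phi k).
  have := integrableD_EFin (i1 k) (integrableZ_EFin (- 2^-1) (i2 k)).
  by congr (_.-integrable setT); apply/funext => w /=; rewrite /Phi mulNr.
have Phi0 k : (0 <= E (Phi k))%R.
  elim: k => [|k IH].
    apply: exp_ge0 => w; rewrite /Phi mx0.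
    by have := sqr_ge0 (a 0 w); rewrite expr2; lra.
  have is_ : P.-integrable setT (EFin \o (fun w => mx k w * (a k.+1 w - a k w))%R).
    by apply: sqint_mul_int => //; exact: sqintB.
  apply: (@le_trans _ _ (E (Phi k) + E (fun w => mx k w * (a k.+1 w - a k w)))%R).
    by rewrite addr_ge0// submartingale.
  rewrite -expD//; apply: le_exp => //; first exact: integrableD_EFin.
  move=> w; rewrite /Phi mxS /Num.max.
  case: ifP => _; last by lra.
  have := sqr_ge0 (a k.+1 w - mx k w)%R; rewrite !expr2; lra.
have h : (E (Phi n) <= E (fun w => a n w ^+ 2 + (- 4^-1) * mx n w ^+ 2))%R.
  apply: le_exp => //; first by apply: integrableD_EFin => //; exact: integrableZ_EFin.
  move=> w; rewrite /Phi; have := sqr_ge0 (a n w - 2^-1 * mx n w)%R; rewrite !expr2; lra.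
rewrite (expD (i3 n) (integrableZ_EFin (- 4^-1) (i2 n))) expZ// in h.
have := Phi0 n; rewrite /mx /a in h *; lra.
Qed.

End discrete.

Hypothesis L_cont : {ae P, forall w, {within times T, continuous (L w)}}.

(** By continuity the supremum is over the countable set of times [rtime], hence the
    monotone limit of maxima over finite sets of times, each completed by T. *)
Lemma doob : \int[P]_w supsq T L w <= 4%:E * \int[P]_w (enorm (L w T) ^+ 2)%:E.
Proof.
have TT : times T T by rewrite /times/= lexx ltW.
have cL : cproc P T L.
  split => // t tT i j; rewrite (ord1 j); by case: (L_sqint i tT).
pose h k w := (enorm (L w (rtime T k)) ^+ 2)%R.
pose g n w := (runmax (h ^~ w) n)%:E.
have mh k : measurable_fun setT (h k).
  by apply: measurable_sqr_enorm => i j; apply: cL.1; exact: times_rtime.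
have h0 k w : (0 <= h k w)%R by exact: sqr_ge0.
have mg n : measurable_fun setT (g n).
  by apply/measurable_EFinP; exact: measurable_runmax.
have g0 n w : 0 <= g n w by rewrite lee_fin runmax_ge0.
have ndg w : nondecreasing_seq (g ^~ w).
  by apply/nondecreasing_seqP => n; rewrite /g lee_fin /= le_max lexx.
have supE w : ereal_sup (range (fun n => (h n w)%:E)) = ereal_sup (range (g ^~ w)).
  apply/eqP; rewrite eq_le; apply/andP; split; apply: ge_ereal_sup => _ [n _ <-].
    apply: (@le_trans _ _ (g n.+1 w)); last by apply: ereal_sup_ubound; exists n.+1.
    by rewrite lee_fin; exact: (@runmax_ub R (h ^~ w) n.+1 n).
  have s0 : 0 <= ereal_sup (range (fun n => (h n w)%:E)).
    by apply: (@le_trans _ _ (h 0 w)%:E); [rewrite lee_fin|apply: ereal_sup_ubound; exists 0%N].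
  rewrite /g; case E : (ereal_sup _) s0 => [b| |]// b0; last by rewrite leey.
  rewrite lee_fin in b0 *; apply: runmax_le => // k _.
  by rewrite -lee_fin -E; apply: ereal_sup_ubound; exists k.
have lim_g w : limn (g ^~ w) = ereal_sup (range (fun n => (h n w)%:E)).
  by rewrite supE; apply/cvg_lim => //; exact: ereal_nondecreasing_cvgn.
have -> : \int[P]_w supsq T L w = \int[P]_w limn (g ^~ w).
  apply: ge0_ae_eq_integral => //.
  - exact: (measurable_supsq T_gt0 basisW).
  - under eq_fun do rewrite lim_g supE.
    rewrite (_ : (fun _ => _) = (fun w => esups (g ^~ w) 0%N)); last first.
      apply/funext => w; rewrite /esups; congr ereal_sup; rewrite /sdrop.
      by apply/seteqP; split => _ [n _ <-]; exists n.
    exact: measurable_fun_esups.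
  - by move=> w _; exact: supsq_ge0.
  - move=> w _; rewrite lim_g supE; apply: le_trans (g0 0%N w) _.
    by apply: ereal_sup_ubound; exists 0%N.
  - apply: filterS L_cont => w cw _.
    by rewrite lim_g (supsq_countable T_gt0 cw).
rewrite (@monotone_convergence _ _ _ P setT measurableT g)//.
have iLT : P.-integrable setT (EFin \o (fun w => enorm (L w T) ^+ 2)%R).
  have -> : (EFin \o (fun w => enorm (L w T) ^+ 2)%R) =
      (EFin \o (fun w => \sum_i (L w T i ord0) ^+ 2)%R).
    apply/funext => w /=; rewrite sqr_enorm; congr EFin.
    by apply: eq_bigr => i _; rewrite big_ord1.
  by apply: (proj1 (@exp_sum _ _ _ P _ _ _ _)) => i; case: (L_sqint i TT).
apply: lime_le.
  apply: ereal_nondecreasing_is_cvgn => n n' nn'; apply: ge0_le_integral => //.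
  by move=> w _; exact: ndg.
apply: nearW => n; rewrite -(EFin_exp iLT) -EFinM.
(* the discrete inequality needs the first n times of the dense set in increasing order *)
pose s := sort <=%O [seq rtime T k | k <- iota 0 n].
pose tau k := nth T s k.
have s_times x : x \in s -> times T x.
  by rewrite mem_sort => /mapP[k _ ->]; exact: times_rtime.
have tau_times k : times T (tau k).
  rewrite /tau; have [ks|sk] := ltnP k (size s); first by apply: s_times; exact: mem_nth.
  by rewrite nth_default.
have tau_le k : tau k <= tau k.+1.
  rewrite /tau; have [ks|sk] := ltnP k.+1 (size s).
    by apply: (sorted_leq_nth le_trans le_refl) => //; rewrite ?inE ?(ltnW ks)//; exact: sort_le_sorted.
  by rewrite [leRHS]nth_default//; case/andP: (tau_times k).
have tau_T j : (size s <= j)%N -> tau j = T by move=> sj; rewrite /tau nth_default.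
have [[_ im] dm] := doob_discrete tau_times tau_le (size s).
rewrite tau_T// in dm; rewrite -lee_fin in dm; apply: le_trans dm.
rewrite EFin_exp//; apply: le_ge0_integral => // w; rewrite lee_fin.
apply: runmax_le; first exact: sqr_ge0.
move=> k kn; have ks : rtime T k \in s by rewrite mem_sort; apply: map_f; rewrite mem_iota.
have js := ks; rewrite -index_mem in js.
have -> : h k w = (enorm (L w (tau (index (rtime T k) s))) ^+ 2)%R by rewrite /tau nth_index.
have le_m := @runmax_ub R (fun k => enorm (L w (tau k))) (size s).+1 _ (leqW js).
by rewrite lerXn2r// nnegrE ?enorm_ge0// runmax_ge0.
Qed.

End doob.

(** * Delay operators as convolutions *)

Lemma ae_imp d (U : measurableType d) (R : realType) (mu : {measure set U -> \bar R})
    (A B : U -> Prop) : {ae mu, forall x, A x} -> (forall x, A x -> B x) ->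
  {ae mu, forall x, B x}.
Proof. by move=> h AB; apply: filterS h. Qed.

Lemma ae_and d (U : measurableType d) (R : realType) (mu : {measure set U -> \bar R})
    (A B : U -> Prop) : {ae mu, forall x, A x} -> {ae mu, forall x, B x} ->
  {ae mu, forall x, A x /\ B x}.
Proof. by move=> hA hB; apply: filterS2 hA hB => x; split. Qed.

Section matrix_integrals.
Context d (U : measurableType d) (R : realType) (mu : {measure set U -> \bar R})
  (D : set U) (mD : measurable D) (p q : nat).
Implicit Types f g : U -> 'M[R]_(p, q).

Definition mxint f : 'M[R]_(p, q) := (\matrix_(i, j) \int[mu]_(x in D) (f x i j))%R.

Definition mxintegrable f := (forall i j, measurable_fun D (fun x => f x i j)) /\
  \int[mu]_(x in D) (enorm (f x))%:E < +oo.

Lemma mxintegrable_enorm f : mxintegrable f ->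
  mu.-integrable D (fun x => (enorm (f x))%:E).
Proof.
move=> [mf foo]; apply/integrableP; split.
  by apply/measurable_EFinP; exact: measurable_enorm.
by under eq_integral do rewrite gee0_abs ?lee_fin ?enorm_ge0//.
Qed.

Lemma mxintegrable_coord f i j : mxintegrable f ->
  mu.-integrable D (fun x => (f x i j)%:E).
Proof.
move=> intf; apply: (le_integrable mD _ _ (mxintegrable_enorm intf)).
  by apply/measurable_EFinP; case: intf.
by move=> x _ /=; rewrite lee_fin (ger0_norm (enorm_ge0 _)) enorm_entry.
Qed.

Lemma mxintegrableB f g : mxintegrable f -> mxintegrable g ->
  mxintegrable (fun x => f x - g x)%R.
Proof.
move=> [mf foo] [mg goo].
have m1 i j : measurable_fun D (fun x => (f x - g x)%R i j).
  by under eq_fun do rewrite !mxE; exact: measurable_funB.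
split => //.
apply: (@le_lt_trans _ _ (\int[mu]_(x in D) ((enorm (f x))%:E + (enorm (g x))%:E))).
  apply: ge0_le_integral => //.
  - by move=> x _; rewrite lee_fin enorm_ge0.
  - by apply/measurable_EFinP; exact: measurable_enorm.
  - by apply: emeasurable_funD; apply/measurable_EFinP; exact: measurable_enorm.
  - by move=> x _; rewrite -EFinD lee_fin -(enormN (g x)) enormD.
rewrite ge0_integralD//.
- exact: lte_add_pinfty.
- by move=> x _; rewrite lee_fin enorm_ge0.
- by apply/measurable_EFinP; exact: measurable_enorm.
- by move=> x _; rewrite lee_fin enorm_ge0.
- by apply/measurable_EFinP; exact: measurable_enorm.
Qed.

Lemma mxintB f g : mxintegrable f -> mxintegrable g ->
  mxint (fun x => f x - g x)%R = (mxint f - mxint g)%R.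
Proof.
move=> intf intg; apply/matrixP => i j; rewrite !mxE.
under eq_Rintegral do rewrite !mxE.
by rewrite RintegralB//; exact: mxintegrable_coord.
Qed.

(** Pair the integral with the matrix A that it equals: |A|^2 = int <A, f> <= |A| int |f|. *)
Lemma enorm_mxint f : mxintegrable f ->
  (enorm (mxint f))%:E <= \int[mu]_(x in D) (enorm (f x))%:E.
Proof.
move=> intf; have ien := mxintegrable_enorm intf.
have sum_int (I : Type) (s : seq I) (F : I -> U -> R) :
    (forall i, mu.-integrable D (EFin \o F i)) ->
    mu.-integrable D (EFin \o (fun x => \sum_(i <- s) F i x)%R) /\
    (\int[mu]_(x in D) (\sum_(i <- s) F i x) = \sum_(i <- s) \int[mu]_(x in D) F i x)%R.
  move=> iF; elim: s => [|i s [IH1 IH2]].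
    split; first by under eq_fun do rewrite /comp/= big_nil; exact: integrable0.
    by rewrite big_nil; under eq_Rintegral do rewrite big_nil; rewrite /Rintegral integral0.
  split.
    have -> : (EFin \o (fun x => \sum_(j <- i :: s) F j x)%R) =
        (EFin \o F i) \+ (EFin \o (fun x => \sum_(j <- s) F j x)%R).
      by apply/funext => x /=; rewrite big_cons EFinD.
    exact: integrableD.
  by under eq_Rintegral do rewrite big_cons; rewrite RintegralD// IH2 big_cons.
set A := mxint f.
have ic i j : mu.-integrable D (EFin \o (fun x => A i j * f x i j)%R).
  exact: (integrableZl mD (A i j) (mxintegrable_coord i j intf)).
have h1 i := sum_int _ (index_enum _) _ (ic i).
have [i2 e2] := sum_int _ (index_enum _) _ (fun i => (h1 i).1).
have ->: \int[mu]_(x in D) (enorm (f x))%:E = (\int[mu]_(x in D) enorm (f x))%R%:E.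
  by rewrite fineK//; exact: integrable_fin_num.
rewrite lee_fin; have [A0|An0] := eqVneq (enorm A) 0%R.
  by rewrite A0; apply: Rintegral_ge0 => x _; exact: enorm_ge0.
have A0 : (0 < enorm A)%R by rewrite lt_def An0 enorm_ge0.
rewrite -(ler_pM2l A0) -expr2 sqr_enorm.
have -> : (\sum_i \sum_j A i j ^+ 2 = \int[mu]_(x in D) mxdot A (f x))%R.
  rewrite e2; apply: eq_bigr => i _; rewrite (h1 i).2; apply: eq_bigr => j _.
  by rewrite RintegralZl//; [rewrite expr2 {2}/A mxE|exact: mxintegrable_coord].
rewrite -RintegralZl//; apply: le_Rintegral => //.
  exact: (integrableZl mD (enorm A) ien).
by move=> x _; exact: mxdot_le.
Qed.

End matrix_integrals.

Section translation.
Context (R : realType).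
Local Notation mu := (@lebesgue_measure R).

(** The push-forward of Lebesgue measure by a translation gives intervals their length,
    hence is Lebesgue measure. *)
Lemma ge0_integral_shift (r : R) (h : R -> \bar R) : measurable_fun setT h ->
  (forall s, 0 <= h s) -> \int[mu]_s h (s + r)%R = \int[mu]_s h s.
Proof.
move=> mh h0.
have mphi : measurable_fun setT (fun s : measurableTypeR R => (s + r)%R : measurableTypeR R).
  by apply: measurable_funD.
pose nu := measure_function_pushforward__canonical__measure_function_Measure mu mphi.
have munu A : measurable A -> mu A = nu A.
  apply: lebesgue_measure_unique => _ [[a b] /= ab <-].
  rewrite /nu/= /pushforward.
  have -> : (fun s : R => s + r)%R @^-1` `]a, b] = `](a - r)%R, (b - r)%R]%classic.
    by apply/seteqP; split => x /=; rewrite !in_itv/= ltrBlDr lerBrDr.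
  etransitivity; first exact: lebesgue_measure_itv.
  symmetry; etransitivity; first exact: lebesgue_measure_itv.
  rewrite /= !lte_fin ltrD2r; case: ifP => // _.
  by rewrite -!EFinB; congr EFin; ring.
transitivity (\int[nu]_s h s).
  by rewrite ge0_integral_pushforward//; move=> s _; exact: h0.
by apply: eq_measure_integral => A mA _; apply/esym; exact: munu.
Qed.

End translation.

Section delays.
Context (R : realType) (T : \bar R) (T_gt0 : 0 < T).
Local Notation mu := (@lebesgue_measure R).
Local Notation Dl := (delays T).

Lemma measurable_delays : measurable (delays T).
Proof.
have := emeasurable_itv `[- T, 0].
by congr measurable; apply/seteqP; split => t; rewrite /= in_itv.
Qed.

Lemma measurable_ext0 (h : \bar R -> R) : measurable_fun (times T) h ->
  measurable_fun setT (ext0 T h).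
Proof.
move=> mh; have := (measurable_restrictT _ (measurable_times T)).1 mh.
congr measurable_fun; apply/funext => t; rewrite patchE /ext0.
have -> : (t \in times T) = (0 <= t <= T) by apply/idP/idP => [/set_mem|/mem_set].
by [].
Qed.

Lemma measurable_rtimes_comp (h : \bar R -> R) : measurable_fun (times T) h ->
  measurable_fun (rtimes T) (fun s : R => h s%:E).
Proof.
move=> mh; apply: (measurable_comp (measurable_times T) _ mh).
  by move=> _ [s sT <-].
by apply: measurable_funTS; exact/measurable_EFinP.
Qed.

Let mshift : measurable_fun setT (fun x : R * \bar R => x.1%:E + x.2).
Proof.
apply: emeasurable_funD => //.
by apply: (measurableT_comp (f := @EFin R)) => //; exact/measurable_EFinP.
Qed.

Lemma measurable_ext0_shift (h : \bar R -> R) : measurable_fun (times T) h ->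
  measurable_fun setT (fun x : R * \bar R => ext0 T h (x.1%:E + x.2)).
Proof. by move=> mh; apply: (measurableT_comp (measurable_ext0 mh)). Qed.

Definition mass_in (h : \bar R -> R) : \bar R := \int[mu]_s (ext0 T h s%:E)%:E.

Section convolution.
Context (al : {finite_measure set (\bar R) -> \bar R}) (A : set (\bar R)).
Hypotheses (mA : measurable A) (AD : A `<=` Dl).
Context (h : \bar R -> R).
Hypotheses (mh : measurable_fun (times T) h) (h0 : forall t, (0 <= h t)%R).

Let e0 t : (0 <= ext0 T h t)%R. Proof. by rewrite /ext0; case: ifP. Qed.

Let F (x : R * \bar R) : \bar R := (ext0 T h (x.1%:E + x.2) * \1_A x.2)%:E.

Let mF : measurable_fun setT F.
Proof.
apply/measurable_EFinP; apply: measurable_funM; first exact: measurable_ext0_shift.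
have m1 : measurable_fun setT (\1_A : \bar R -> R) by exact: measurable_indic.
exact: (measurableT_comp m1 measurable_snd).
Qed.

Let F0 x : 0 <= F x. Proof. by rewrite lee_fin mulr_ge0. Qed.

Let innerE (s : R) : \int[al]_(r in A) (ext0 T h (s%:E + r))%:E = fubini_F al F s.
Proof.
rewrite integral_mkcond /fubini_F; apply: eq_integral => r _.
by rewrite patchE /F /= indicE; case: ifP; rewrite ?mulr1 ?mulr0.
Qed.

Lemma measurable_conv :
  measurable_fun setT (fun s : R => \int[al]_(r in A) (ext0 T h (s%:E + r))%:E).
Proof.
under eq_fun do rewrite innerE.
exact: measurable_fun_fubini_tonelli_F.
Qed.

(** Exchange the integrals and use the invariance under translation. At the delay
    r = -oo, which belongs to [-T, 0] when T = +oo, the shifted function vanishes. *)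
Lemma conv_le :
  \int[mu]_(s in rtimes T) \int[al]_(r in A) (ext0 T h (s%:E + r))%:E <=
  al A * mass_in h.
Proof.
apply: (@le_trans _ _ (\int[mu]_s \int[al]_(r in A) (ext0 T h (s%:E + r))%:E)).
  apply: ge0_subset_integral => //; first exact: measurable_rtimes.
    exact: measurable_conv.
  by move=> s _; apply: integral_ge0 => r _; rewrite lee_fin.
under eq_integral do rewrite innerE.
have -> : \int[mu]_s fubini_F al F s = \int[al]_r fubini_G mu F r.
  by have h1 := @fubini_tonelli _ _ _ _ R mu al F mF F0; apply: h1.
apply: (@le_trans _ _ (\int[al]_(r in A) mass_in h)); last first.
  by rewrite integral_cst// muleC.
rewrite [leRHS]integral_mkcond; apply: le_ge0_integral => r.
  by apply: integral_ge0 => s _; exact: F0.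
rewrite patchE /fubini_G /F /= indicE; case: ifPn => rA; last first.
  by under eq_integral do rewrite mulr0; rewrite integral0.
under eq_integral do rewrite mulr1.
have mg : measurable_fun setT (fun s : R => (ext0 T h s%:E)%:E).
  apply/measurable_EFinP; apply: (measurableT_comp (measurable_ext0 mh)).
  exact/measurable_EFinP.
move: rA => /set_mem/AD; case: r => [r| |]/= rD.
- rewrite /mass_in -[leRHS](ge0_integral_shift r mg)//.
  by move=> s; rewrite lee_fin.
- by case/andP: rD.
- rewrite integral0_eq; first by apply: integral_ge0 => s _; rewrite lee_fin.
  by move=> s _; rewrite /ext0 /=.
Qed.

End convolution.

Section kernel.
Context dO (Omega : measurableType dO) (p q : nat).
Context (c : \bar R -> R) (mc : measurable_fun (times T) c).
Context (al : {finite_measure set (\bar R) -> \bar R}).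
Implicit Types X : Omega -> \bar R -> 'M[R]_(p, q).

(** The norm of c X in L^1(dt). *)
Definition wnorm X w : \bar R := mass_in (fun t => `|c t| * enorm (X w t))%R.

Let phi X w (t : \bar R) : 'M[R]_(p, q) := (ext0 T c t *: ext0 T (X w) t)%R.

Let enorm_phi X w t : enorm (phi X w t) = ext0 T (fun t => `|c t| * enorm (X w t))%R t.
Proof.
rewrite /phi /ext0; case: ifP => _; first by rewrite enormZ.
by rewrite scale0r enorm0.
Qed.

Definition tmeas X w := forall i j, measurable_fun (times T) (fun t => X w t i j).

Let mw X w : tmeas X w -> measurable_fun (times T) (fun t => `|c t| * enorm (X w t))%R.
Proof.
by move=> mX; apply: measurable_funM; [exact: measurableT_comp|exact: measurable_enorm].
Qed.

Let w0 X w t : (0 <= `|c t| * enorm (X w t))%R.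
Proof. by rewrite mulr_ge0// enorm_ge0. Qed.

Let mphi X w i j : tmeas X w -> measurable_fun setT (fun t => phi X w t i j).
Proof.
move=> mX; have -> : (fun t => phi X w t i j) =
    (fun t => ext0 T c t * ext0 T (fun t => X w t i j) t)%R.
  apply/funext => t; rewrite /phi /ext0; case: ifP => _; first by rewrite mxE.
  by rewrite scale0r mxE mul0r.
by apply: measurable_funM; exact: measurable_ext0.
Qed.

Lemma delay_integralE X w s :
  delay_integral T c al X w s = mxint al Dl (fun r => phi X w (s%:E + r)).
Proof.
apply/matrixP => i j; rewrite !mxE; apply: eq_Rintegral => r _.
by rewrite /phi !mxE.
Qed.

Let mphis X w (s : R) (D : set (\bar R)) i j : tmeas X w ->
  measurable_fun D (fun r => phi X w (s%:E + r) i j).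
Proof.
move=> mX; apply: measurable_funTS; apply: (measurableT_comp (mphi i j mX)).
exact: emeasurable_funD.
Qed.

Lemma measurable_delay_integral X w i j : tmeas X w ->
  measurable_fun (rtimes T) (fun s => delay_integral T c al X w s i j).
Proof.
move=> mX; apply: measurable_funTS.
under eq_fun do rewrite delay_integralE mxE.
pose G (x : R * \bar R) : \bar R := ((phi X w (x.1%:E + x.2) i j) * \1_Dl x.2)%:E.
have mG : measurable_fun setT G.
  apply/measurable_EFinP; apply: measurable_funM.
    exact: (measurableT_comp (mphi i j mX)).
  have m1 : measurable_fun setT (\1_Dl : \bar R -> R).
    by apply: measurable_indic; exact: measurable_delays.
  exact: (measurableT_comp m1 measurable_snd).
have -> : (fun s : R => \int[al]_(r in Dl) phi X w (s%:E + r) i j)%R =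
    fine \o (fun s => fubini_F al G^\+ s - fubini_F al G^\- s).
  apply/funext => s /=; rewrite /Rintegral; congr fine.
  rewrite integral_mkcond integralE; congr (_ - _); apply: eq_integral => r _.
    by rewrite /G !funeposE patchE indicE /=; case: ifP; rewrite ?mulr1 ?mulr0.
  by rewrite /G !funenegE patchE indicE /=; case: ifP; rewrite ?mulr1 ?mulr0.
apply: measurableT_comp; first exact: fine_measurable.
apply: emeasurable_funB.
- apply: measurable_fun_fubini_tonelli_F => //; exact: measurable_funepos.
- apply: measurable_fun_fubini_tonelli_F => //; exact: measurable_funeneg.
Qed.

Let finite_ae X w : tmeas X w -> wnorm X w < +oo ->
  {ae [the measure _ _ of mu], forall s, rtimes T s -> mxintegrable al Dl (fun r => phi X w (s%:E + r))}.
Proof.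
move=> mX Xoo.
pose f (s : R) := \int[al]_(r in Dl) (enorm (phi X w (s%:E + r)))%:E.
have fE s : f s = \int[al]_(r in Dl) (ext0 T (fun t => `|c t| * enorm (X w t))%R (s%:E + r))%:E.
  by apply: eq_integral => r _; rewrite enorm_phi.
have mf : measurable_fun setT f.
  rewrite (funext fE).
  by apply: measurable_conv => //; [exact: measurable_delays|exact: mw].
have f0 s : 0 <= f s by apply: integral_ge0 => r _; rewrite lee_fin enorm_ge0.
have foo : \int[mu]_(s in rtimes T) f s < +oo.
  under eq_integral do rewrite fE.
  apply: le_lt_trans (conv_le _ measurable_delays _ (mw mX) (w0 X w)) _ => //.
  rewrite lte_mul_pinfty//; exact: fin_num_measure measurable_delays.
have : mu.-integrable (rtimes T) f.
  apply/integrableP; split; first exact: measurable_funTS.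
  by under eq_integral do rewrite gee0_abs//.
move=> intf; have := @integrable_ae _ _ _ mu _ measurable_rtimes f intf; apply: filterS => s h sT; split.
  by move=> i j; exact: mphis.
by have := h sT; rewrite ge0_fin_numE.
Qed.

(** The triangle inequality for the integral in r, at the times where the convolution
    is finite, which are almost all. *)
Lemma delay_integral_bound X w : tmeas X w -> wnorm X w < +oo ->
  \int[mu]_(s in rtimes T) (enorm (delay_integral T c al X w s))%:E <=
  al Dl * wnorm X w.
Proof.
move=> mX Xoo.
apply: le_trans (conv_le _ measurable_delays _ (mw mX) (w0 X w)) => //.
apply: ae_ge0_le_integral.
- exact: measurable_rtimes.
- by move=> s _; rewrite lee_fin enorm_ge0.
- apply/measurable_EFinP; apply: measurable_enorm => i j; exact: measurable_delay_integral.
- by move=> s _; apply: integral_ge0 => r _; rewrite lee_fin /ext0; case: ifP.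
- by apply: measurable_funTS; apply: measurable_conv => //; [exact: measurable_delays|exact: mw].
apply: (ae_imp (finite_ae mX Xoo)) => s h sT; rewrite delay_integralE.
apply: le_trans (enorm_mxint measurable_delays (h sT)) _.
by under eq_integral do rewrite enorm_phi.
Qed.

(** The total variation on [-T, 0] of the difference of al and the Dirac measure at 0. *)
Definition dist_dirac0 : \bar R := al (Dl `\ 0) + `|fine (al [set 0]) - 1|%:E.

(** Split the delay integral of X into that of X - Y, the part of that of Y with
    delays r <> 0, and the part of that of Y with r = 0, which is al {0} c Y. *)
Lemma delay_integral_dist X Y w : tmeas X w -> tmeas Y w ->
  wnorm X w < +oo -> wnorm Y w < +oo ->
  \int[mu]_(s in rtimes T) (enorm (delay_integral T c al X w s - c s%:E *: Y w s%:E))%:E <=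
  al Dl * wnorm (fun w t => X w t - Y w t)%R w + dist_dirac0 * wnorm Y w.
Proof.
move=> mX mY Xoo Yoo.
have mXY : tmeas (fun w t => X w t - Y w t)%R w.
  by move=> i j; under eq_fun do rewrite !mxE; exact: measurable_funB.
have D0 : Dl 0 by rewrite /delays/= lexx andbT oppe_le0 ltW.
have mD0 : measurable (Dl `\ 0) by apply: measurableD => //; exact: measurable_delays.
pose k := `|fine (al [set 0]) - 1|%R.
have k0 : (0 <= k)%R by rewrite /k.
have m1 : measurable_fun setT (fun s : R => \int[al]_(r in Dl)
    (ext0 T (fun t => `|c t| * enorm (X w t - Y w t))%R (s%:E + r))%:E).
  apply: measurable_conv; [exact: measurable_delays|exact: (mw mXY)|].
  by move=> t; rewrite mulr_ge0// enorm_ge0.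
have m2 : measurable_fun setT (fun s : R => \int[al]_(r in Dl `\ 0)
    (ext0 T (fun t => `|c t| * enorm (Y w t))%R (s%:E + r))%:E).
  by apply: measurable_conv => //; exact: mw.
have m3 : measurable_fun setT (fun s : R => (k * ext0 T (fun t => `|c t| * enorm (Y w t))%R s%:E)%:E).
  apply/measurable_EFinP; apply: measurable_funM => //.
  apply: (measurableT_comp (measurable_ext0 (mw mY))); exact/measurable_EFinP.
have p1 A (h : \bar R -> R) (s : R) : (forall t, (0 <= h t)%R) ->
    0 <= \int[al]_(r in A) (ext0 T h (s%:E + r))%:E.
  by move=> h0; apply: integral_ge0 => r _; rewrite lee_fin /ext0; case: ifP.
have p1X (s : R) : 0 <= \int[al]_(r in Dl)
    (ext0 T (fun t => `|c t| * enorm (X w t - Y w t))%R (s%:E + r))%:E.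
  by apply: p1 => t; rewrite mulr_ge0// enorm_ge0.
have p1Y (s : R) : 0 <= \int[al]_(r in Dl `\ 0)
    (ext0 T (fun t => `|c t| * enorm (Y w t))%R (s%:E + r))%:E.
  by apply: p1 => t; rewrite mulr_ge0// enorm_ge0.
have p3 (s : R) : 0 <= (k * ext0 T (fun t => `|c t| * enorm (Y w t))%R s%:E)%:E.
  by rewrite lee_fin; apply: mulr_ge0 => //; rewrite /ext0; case: ifP.
have i3 : \int[mu]_(s in rtimes T) (k * ext0 T (fun t => `|c t| * enorm (Y w t))%R s%:E)%:E
    <= k%:E * wnorm Y w.
  under eq_integral do rewrite EFinM.
  rewrite ge0_integralZl//.
  - rewrite lee_wpmul2l ?lee_fin//; apply: ge0_subset_integral => //; first exact: measurable_rtimes.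
      apply/measurable_EFinP; apply: (measurableT_comp (measurable_ext0 (mw mY))).
      exact/measurable_EFinP.
    by move=> s _; rewrite lee_fin /ext0; case: ifP.
  - exact: measurable_rtimes.
  - apply/measurable_EFinP/measurable_funTS; apply: (measurableT_comp (measurable_ext0 (mw mY))).
    exact/measurable_EFinP.
  - by move=> s _; rewrite lee_fin /ext0; case: ifP.
rewrite /dist_dirac0 muleDl//; last 2 first.
- rewrite ge0_fin_numE//; apply: integral_ge0 => s _.
  by rewrite lee_fin /ext0; case: ifP.
- by apply: ge0_adde_def; rewrite inE ?measure_ge0 ?lee_fin.
apply: (@le_trans _ _ (\int[mu]_(s in rtimes T)
  ((\int[al]_(r in Dl) (ext0 T (fun t => `|c t| * enorm (X w t - Y w t))%R (s%:E + r))%:E +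
    \int[al]_(r in Dl `\ 0) (ext0 T (fun t => `|c t| * enorm (Y w t))%R (s%:E + r))%:E) +
    (k * ext0 T (fun t => `|c t| * enorm (Y w t))%R s%:E)%:E))); last first.
  rewrite ge0_integralD; [|exact: measurable_rtimes|by move=> s _; rewrite adde_ge0|
    by apply: measurable_funTS; exact: emeasurable_funD|by move=> s _|exact: measurable_funTS m3].
  rewrite ge0_integralD; [|exact: measurable_rtimes|by move=> s _|exact: measurable_funTS m1|
    by move=> s _|exact: measurable_funTS m2].
  rewrite [leRHS]addeA; apply: leeD; last exact: i3.
  apply: leeD.
    apply: conv_le => //; [exact: measurable_delays|exact: (mw mXY)|].
    by move=> t; rewrite mulr_ge0// enorm_ge0.
  by apply: conv_le => //; exact: mw.
apply: ae_ge0_le_integral.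
- exact: measurable_rtimes.
- by move=> s _; rewrite lee_fin enorm_ge0.
- apply/measurable_EFinP; apply: measurable_enorm => i j.
  under eq_fun do rewrite mxE [X in (_ + X)%R]mxE [X in (- X)%R]mxE.
  apply: measurable_funB; first exact: measurable_delay_integral.
  have mcY : measurable_fun (times T) (fun t => c t * Y w t i j)%R by exact: measurable_funM.
  exact: measurable_rtimes_comp mcY.
- by move=> s _; apply: adde_ge0 => //; exact: adde_ge0.
- by apply: measurable_funTS; apply: emeasurable_funD => //; exact: emeasurable_funD.
have finX := finite_ae mX Xoo; have finY := finite_ae mY Yoo.
have finXY : {ae [the measure _ _ of mu], forall s : R,
    (rtimes T s -> mxintegrable al Dl (fun r => phi X w (s%:E + r))) /\
    (rtimes T s -> mxintegrable al Dl (fun r => phi Y w (s%:E + r)))}.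
  exact: ae_and finX finY.
apply: (ae_imp finXY) => s [hX hY] sT; have {}hX := hX sT; have {}hY := hY sT.
have D01 : [set 0] `<=` Dl by move=> _ ->.
have DU : Dl = (Dl `\ 0) `|` [set 0] by rewrite setUC setDUK.
pose fY r := phi Y w (s%:E + r).
have hY0 : mxintegrable al (Dl `\ 0) fY.
  split; first by move=> i j; exact: mphis.
  apply: le_lt_trans hY.2; apply: ge0_subset_integral => //.
  - exact: measurable_delays.
  - by apply/measurable_EFinP; apply: measurable_enorm => i j; exact: mphis.
  - by move=> r _; rewrite lee_fin enorm_ge0.
have s0 : fY 0 = (c s%:E *: Y w s%:E)%R.
  by rewrite /fY adde0 /phi /ext0; move: sT; rewrite /rtimes/= => ->.
have split0 : mxint al Dl fY =
    (mxint al (Dl `\ 0) fY + fine (al [set 0]) *: (c s%:E *: Y w s%:E))%R.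
  apply/matrixP => i j; rewrite !mxE [in LHS]DU Rintegral_setU//; last 2 first.
  - by rewrite -DU; exact: (mxintegrable_coord measurable_delays i j hY).
  - by apply/disj_setPS => r [[_ r0] r00]; exact: r0.
  congr (_ + _)%R; rewrite /Rintegral.
  have -> : \int[al]_(x in [set 0]) (fY x i j)%:E = \int[al]_(x in [set 0]) (cst (fY 0 i j)%:E) x.
    by apply: eq_integral => x /set_mem ->.
  by rewrite integral_cst// s0 !mxE fineM// ?fin_num_measure//= mulrC.
rewrite delay_integralE.
have -> : (mxint al Dl (fun r => phi X w (s%:E + r)) - c s%:E *: Y w s%:E)%R =
   (mxint al Dl (fun r => phi X w (s%:E + r)%E - fY r) +
    mxint al (Dl `\ 0) fY + (fine (al [set 0]) - 1) *: (c s%:E *: Y w s%:E))%R.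
  rewrite mxintB//; last exact: measurable_delays.
  by rewrite split0 scalerBl scale1r; apply/matrixP => i j; rewrite !mxE; ring.
apply: (@le_trans _ _ ((enorm (mxint al Dl (fun r => phi X w (s%:E + r)%E - fY r)%R))%:E +
  (enorm (mxint al (Dl `\ 0) fY))%:E +
  (enorm ((fine (al [set 0]) - 1) *: (c s%:E *: Y w s%:E))%R)%:E)).
  rewrite -!EFinD lee_fin; apply: le_trans (enormD _ _) _.
  by rewrite lerD2r enormD.
apply: leeD.
  apply: leeD.
    apply: le_trans (enorm_mxint measurable_delays (mxintegrableB measurable_delays hX hY)) _.
    rewrite le_eqVlt; apply/orP; left; apply/eqP; apply: eq_integral => r _.
    congr EFin; rewrite /phi /ext0; case: ifP => _; last by rewrite !scale0r subrr enorm0.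
    by rewrite -scalerBr enormZ.
  apply: le_trans (enorm_mxint mD0 hY0) _.
  by under eq_integral do rewrite enorm_phi.
by rewrite lee_fin enormZ -s0 /fY adde0 enorm_phi.
Qed.

End kernel.
End delays.

(** * Lipschitz generators along a path *)

Section generators.
Context (R : realType) (dO : measure_display) (Omega : measurableType dO)
  (P : probability Omega R) (d : nat) (T : \bar R) (W : Omega -> R -> 'cV[R]_d).
Hypothesis T_gt0 : 0 < T.
Hypothesis basisW : brownian_basis P T W.
Local Notation mu := (@lebesgue_measure R).
Context (m : nat) (g : generator R Omega d m).
Hypothesis mg : measurable_generator P T W g.

(** The paths of the generator and the variable int |g(s, 0, 0)| ds both arise by
    substituting functions of one variable for the scenario, the time and the states. *)
Lemma measurable_generator_comp dU (U : measurableType dU) (om : U -> Omega)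
    (tau : U -> \bar R) (y : U -> 'cV[R]_m) (z : U -> 'M[R]_(m, d)) i j :
  measurable [set x | times T (tau x)] ->
  (forall S, predictable_sets P T W S -> measurable [set x | S (om x, tau x)]) ->
  (forall i j, measurable_fun setT (fun x => y x i j)) ->
  (forall i j, measurable_fun setT (fun x => z x i j)) ->
  measurable_fun [set x | times T (tau x)] (fun x => g (om x) (tau x) (y x) (z x) i j).
Proof.
move=> mt mS my mz _ B mB.
pose phi x := (((om x, tau x), y x), z x).
have := mg (borel_mx_coord i j mB).
move=> /(preimage_generated (phi := phi)) h.
rewrite (_ : _ `&` _ = phi @^-1` ((pdom T `*` [set: 'cV[R]_m] `*` [set: 'M[R]_(m, d)]) `&`
   (fun x => g x.1.1.1 x.1.1.2 x.1.2 x.2) @^-1` [set M | B (M i j)])); last first.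
  by apply/seteqP; split => x /=; [move=> [? ?]; split => //; split => //; split|
    move=> [[[? _] _] ?]; split].
apply: h.
  rewrite (_ : _ @^-1` _ = [set x | times T (tau x)])//.
  by apply/seteqP; split => x /=; [case; case|move=> ?; split => //; split].
move=> _ [A [C [D [pA bC bD ->]]]].
rewrite (_ : _ @^-1` _ = [set x | A (om x, tau x)] `&` (setT `&` y @^-1` C) `&` (setT `&` z @^-1` D)); last first.
  by rewrite !setTI; apply/seteqP; split => x.
apply: measurableI; last exact: measurable_borel_mx.
by apply: measurableI; [exact: mS|exact: measurable_borel_mx].
Qed.

Let mEFin : measurable_fun setT (@EFin R).
Proof. exact/measurable_EFinP. Qed.

(** Extension by 0 outside [0, T], as the substituted functions must be measurable on
    the whole type. *)
Let patch_rt (p q : nat) (y : R -> 'M[R]_(p, q)) (s : R) : 'M[R]_(p, q) :=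
  if 0 <= s%:E <= T then y s else 0%R.

Let mpatch (p q : nat) (y : R -> 'M[R]_(p, q)) :
  (forall i j, measurable_fun (rtimes T) (fun s => y s i j)) ->
  forall i j, measurable_fun setT (fun s => patch_rt y s i j).
Proof.
move=> my i j; have := (measurable_restrictT _ measurable_rtimes).1 (my i j).
congr measurable_fun; apply/funext => s; rewrite patchE /patch_rt.
have -> : (s \in rtimes T) = (0 <= s%:E <= T) by apply/idP/idP => [/set_mem|/mem_set].
by case: ifP => // _; rewrite mxE.
Qed.

Lemma measurable_generator_path w (y : R -> 'cV[R]_m) (z : R -> 'M[R]_(m, d)) :
  (forall i j, measurable_fun (rtimes T) (fun s => y s i j)) ->
  (forall i j, measurable_fun (rtimes T) (fun s => z s i j)) ->
  forall i j, measurable_fun (rtimes T) (fun s => g w s%:E (y s) (z s) i j).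
Proof.
move=> my mz i j.
have := @measurable_generator_comp _ _ (fun=> w) (@EFin R) (patch_rt y) (patch_rt z) i j.
have -> : [set s : R | times T s%:E] = rtimes T by [].
move=> /(_ measurable_rtimes) h.
have {}h : measurable_fun (rtimes T) (fun s => g w s%:E (patch_rt y s) (patch_rt z s) i j).
  apply: h; [|exact: mpatch|exact: mpatch].
  move=> S pS; have := mEFin measurableT (predictable_path_set w pS).
  by rewrite setTI.
apply: eq_measurable_fun h => s /set_mem sT.
by rewrite /patch_rt; move: sT; rewrite /rtimes/= => ->.
Qed.

Lemma measurable_generator0 :
  measurable_fun setT (fun w => \int[mu]_(s in rtimes T) (enorm (g w s%:E 0%R 0%R))%:E).
Proof.
pose D := [set x : Omega * R | times T x.2%:E].
have mD : measurable D.
  suff -> : D = setT `*` (rtimes T) by apply: measurableX => //; exact: measurable_rtimes.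
  by apply/seteqP; split => x //= [].
have mg0 i j : measurable_fun D (fun x : Omega * R => g x.1 x.2%:E 0%R 0%R i j).
  apply: (@measurable_generator_comp _ _ fst (fun x : Omega * R => x.2%:E) (fun=> 0%R) (fun=> 0%R) i j mD).
  - move=> S pS; exact: (predictable_joint_set T_gt0 basisW pS).
  - by move=> *; exact: measurable_cst.
  - by move=> *; exact: measurable_cst.
pose h (x : Omega * R) := ((fun x : Omega * R => enorm (g x.1 x.2%:E 0%R 0%R)) \_ D) x.
have mh : measurable_fun setT (EFin \o h).
  apply/measurable_EFinP; apply: (measurable_restrictT _ mD).1.
  exact: measurable_enorm.
have h0 (x : Omega * R) : 0 <= (h x)%:E.
  by rewrite lee_fin /h patchE; case: ifP => // _; exact: enorm_ge0.
have := @measurable_fun_fubini_tonelli_F _ _ _ _ R mu (fun x => (h x)%:E) mh h0.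
congr measurable_fun; apply/funext => w; rewrite /fubini_F [RHS]integral_mkcond.
apply: eq_integral => s _; rewrite /h /= !patchE.
have -> : ((w, s) \in D) = (s \in rtimes T).
  by apply/idP/idP => /set_mem h1; apply/mem_set.
by case: ifP.
Qed.

Lemma generator_lip_integral w (K : R) (y y' : R -> 'cV[R]_m) (z z' : R -> 'M[R]_(m, d)) :
  (0 <= K)%R ->
  {ae [the measure _ _ of mu], forall s : R, rtimes T s -> forall (y y' : 'cV[R]_m) (z z' : 'M[R]_(m, d)),
     (enorm (g w s%:E y z - g w s%:E y' z') <= K * (enorm (y - y') + enorm (z - z')))%R} ->
  (forall i j, measurable_fun (rtimes T) (fun s => y s i j)) ->
  (forall i j, measurable_fun (rtimes T) (fun s => y' s i j)) ->
  (forall i j, measurable_fun (rtimes T) (fun s => z s i j)) ->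
  (forall i j, measurable_fun (rtimes T) (fun s => z' s i j)) ->
  \int[mu]_(s in rtimes T) (enorm (g w s%:E (y s) (z s) - g w s%:E (y' s) (z' s)))%:E <=
  K%:E * (\int[mu]_(s in rtimes T) (enorm (y s - y' s))%:E +
          \int[mu]_(s in rtimes T) (enorm (z s - z' s))%:E).
Proof.
move=> K0 lip my my' mz mz'.
have mB (p q : nat) (x x' : R -> 'M[R]_(p, q)) :
    (forall i j, measurable_fun (rtimes T) (fun s => x s i j)) ->
    (forall i j, measurable_fun (rtimes T) (fun s => x' s i j)) ->
    measurable_fun (rtimes T) (fun s => (enorm (x s - x' s))%:E).
  move=> mx mx'; apply/measurable_EFinP; apply: measurable_enorm => i j.
  by under eq_fun do rewrite mxE [X in (_ + X)%R]mxE; exact: measurable_funB.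
have e0 (p q : nat) (x : R -> 'M[R]_(p, q)) s : rtimes T s -> 0 <= (enorm (x s))%:E.
  by move=> _; rewrite lee_fin enorm_ge0.
have m1 := mB _ _ _ _ my my'; have m2 := mB _ _ _ _ mz mz'.
rewrite -ge0_integralD//; [|exact: measurable_rtimes|by move=> s _; rewrite lee_fin enorm_ge0|by move=> s _; rewrite lee_fin enorm_ge0].
rewrite -ge0_integralZl//; [|exact: measurable_rtimes|exact: emeasurable_funD|by move=> s _; rewrite -EFinD lee_fin addr_ge0// enorm_ge0].
apply: ae_ge0_le_integral.
- exact: measurable_rtimes.
- by move=> s _; rewrite lee_fin enorm_ge0.
- by apply: mB; exact: measurable_generator_path.
- by move=> s _; rewrite -EFinD -EFinM lee_fin mulr_ge0// addr_ge0// enorm_ge0.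
- by apply: measurable_funeM; exact: emeasurable_funD.
by apply: (ae_imp lip) => s h sT; rewrite -EFinD -EFinM lee_fin; exact: h.
Qed.

Lemma generator_integrable w (K : R) (y : R -> 'cV[R]_m) (z : R -> 'M[R]_(m, d)) :
  (0 <= K)%R ->
  {ae [the measure _ _ of mu], forall s : R, rtimes T s -> forall (y y' : 'cV[R]_m) (z z' : 'M[R]_(m, d)),
     (enorm (g w s%:E y z - g w s%:E y' z') <= K * (enorm (y - y') + enorm (z - z')))%R} ->
  \int[mu]_(s in rtimes T) (enorm (g w s%:E 0%R 0%R))%:E < +oo ->
  mxintegrable mu (rtimes T) y -> mxintegrable mu (rtimes T) z ->
  mxintegrable mu (rtimes T) (fun s => g w s%:E (y s) (z s)).
Proof.
move=> K0 lip g0 [my yoo] [mz zoo].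
have mc (p q : nat) i j : measurable_fun (rtimes T) (fun s : R => (0 : 'M[R]_(p, q))%R i j).
  exact: measurable_cst.
have mgyz := measurable_generator_path w my mz.
have mg00 := measurable_generator_path w (mc m 1%N) (mc m d).
split => //.
have h := generator_lip_integral K0 lip my (mc m 1%N) mz (mc m d).
have md : measurable_fun (rtimes T) (fun s => (enorm (g w s%:E (y s) (z s) - g w s%:E 0%R 0%R))%:E).
  apply/measurable_EFinP; apply: measurable_enorm => i j.
  by under eq_fun do rewrite mxE [X in (_ + X)%R]mxE; exact: measurable_funB.
have m0 : measurable_fun (rtimes T) (fun s => (enorm (g w s%:E 0%R 0%R))%:E).
  by apply/measurable_EFinP; exact: measurable_enorm.
apply: (@le_lt_trans _ _ (\int[mu]_(s in rtimes T)
   ((enorm (g w s%:E (y s) (z s) - g w s%:E 0%R 0%R))%:E + (enorm (g w s%:E 0%R 0%R))%:E))).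
  apply: ge0_le_integral.
  - exact: measurable_rtimes.
  - by move=> s _; rewrite lee_fin enorm_ge0.
  - by apply/measurable_EFinP; exact: measurable_enorm.
  - exact: emeasurable_funD.
  - by move=> s _; rewrite -EFinD lee_fin; apply: le_trans (enormD _ _); rewrite subrK.
rewrite ge0_integralD//; [|exact: measurable_rtimes|by move=> s _; rewrite lee_fin enorm_ge0|by move=> s _; rewrite lee_fin enorm_ge0].
apply: lte_add_pinfty => //; apply: le_lt_trans h _.
rewrite lte_mul_pinfty//.
under eq_integral do rewrite subr0.
under [X in _ + X]eq_integral do rewrite subr0.
exact: lte_add_pinfty.
Qed.

End generators.

Section weights.
Context (R : realType) (T : \bar R) (T_gt0 : 0 < T).
Context dO (Omega : measurableType dO) (p q : nat).
Local Notation mu := (@lebesgue_measure R).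
Context (c : \bar R -> R) (mc : measurable_fun (times T) c).
Implicit Types X : Omega -> \bar R -> 'M[R]_(p, q).

Let mec : measurable_fun setT (fun s : R => ext0 T c s%:E).
Proof. by apply: (measurableT_comp (measurable_ext0 mc)); exact/measurable_EFinP. Qed.

Lemma integral_weight_le X w : tmeas T X w ->
  \int[mu]_(s in rtimes T) (enorm (c s%:E *: X w s%:E)%R)%:E <= wnorm T c X w.
Proof.
move=> mX; rewrite integral_mkcond /wnorm /mass_in.
apply: le_ge0_integral => s.
  by rewrite patchE; case: ifP => // _; rewrite lee_fin enorm_ge0.
rewrite patchE /ext0.
have -> : (s \in rtimes T) = (0 <= s%:E <= T) by apply/idP/idP => [/set_mem|/mem_set].
by case: ifP => // _; rewrite enormZ.
Qed.

Lemma wnorm_le_sup X w (S : R) : tmeas T X w ->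
  (forall t, times T t -> (enorm (X w t) <= S)%R) ->
  wnorm T c X w <= Lpnorm T 1 c * S%:E.
Proof.
move=> mX XS; rewrite /Lpnorm Lnorm1.
have S0 : (0 <= S)%R.
  by apply: le_trans (XS 0 _); [exact: enorm_ge0|rewrite /times/= lexx ltW].
rewrite -ge0_integralZr//; last first.
  by apply: measurableT_comp => //; exact/measurable_EFinP.
apply: le_ge0_integral => s.
  by rewrite lee_fin /ext0; case: ifP => // _; rewrite mulr_ge0// enorm_ge0.
rewrite -EFinM lee_fin /ext0; case: ifP => [sT|_]; last by rewrite normr0 mul0r.
by rewrite ler_wpM2l//; exact: XS.
Qed.

(** Cauchy-Schwarz in time. *)
Lemma wnorm_le_energy X w : tmeas T X w ->
  wnorm T c X w <= Lpnorm T 2%:E c * (energy T X w) `^ 2^-1.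
Proof.
move=> mX.
pose f (s : R) := ext0 T c s%:E; pose h (s : R) := enorm (ext0 T (X w) s%:E).
have mh : measurable_fun setT h.
  apply: measurable_enorm => i j.
  have -> : (fun s : R => ext0 T (X w) s%:E i j) = (fun s : R => ext0 T (fun t => X w t i j) s%:E).
    by apply/funext => s; rewrite /ext0; case: ifP => // _; rewrite mxE.
  by apply: (measurableT_comp (measurable_ext0 (mX i j))); exact/measurable_EFinP.
have half : (2^-1 + 2^-1 = 1 :> R)%R by lra.
have := hoelder mu mec mh (ltr0Sn R 1) (ltr0Sn R 1) half.
rewrite Lnorm1.
have -> : \int[mu]_x `|(EFin \o (f \* h)%R) x| = wnorm T c X w.
  apply: eq_integral => s _; rewrite /= /f /h /ext0; case: ifP => _; last by rewrite enorm0 mul0r normr0.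
  by rewrite normrM (ger0_norm (enorm_ge0 _)).
suff -> : 'N[mu]_2%:E[EFin \o h] = (energy T X w) `^ 2^-1 by [].
rewrite unlock; congr (_ `^ _); rewrite energyE; apply: eq_integral => s _ /=.
rewrite (ger0_norm (enorm_ge0 _)) (powR_mulrn 2) ?enorm_ge0//.
Qed.

End weights.

Section dirac_limit.
Context (R : realType) (T : \bar R) (T_gt0 : 0 < T).

(** If al <= delta_0 then al has no mass outside 0; if delta_0 <= al then al {0} >= 1.
    In both cases the absolute values have the sign of al [-T, 0] - 1. *)
Lemma dist_dirac0E (al : {finite_measure set (\bar R) -> \bar R}) :
  measure_le al (dirac (0 : \bar R)) \/ measure_le (dirac (0 : \bar R)) al ->
  dist_dirac0 T al = `|fine (al (delays T)) - 1|%:E.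
Proof.
have mD := measurable_delays T.
have m0 : measurable [set (0 : \bar R)] by [].
have D0 : delays T 0 by rewrite /delays/= lexx andbT oppe_le0 ltW.
have mD0 : measurable (delays T `\ 0) by exact: measurableD.
have alD : al (delays T) = al (delays T `\ 0) + al [set 0].
  rewrite -measureU//; first by rewrite setUC setDUK// => _ ->.
  by apply/seteqP; split => // r [[_ r0] r00]; exact: r0.
have f1 : al (delays T `\ 0) \is a fin_num by exact: fin_num_measure.
have f2 : al [set 0] \is a fin_num by exact: fin_num_measure.
move=> [h|h].
  have -> : al (delays T) = al [set 0].
    rewrite alD (_ : al (delays T `\ 0) = 0) ?add0e//.
    apply/eqP; rewrite eq_le measure_ge0 andbT; apply: le_trans (h _ mD0) _.
    by rewrite /= diracE memNset// => -[_]; apply.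
  rewrite /dist_dirac0 (_ : al (delays T `\ 0) = 0) ?add0e//.
  apply/eqP; rewrite eq_le measure_ge0 andbT; apply: le_trans (h _ mD0) _.
  by rewrite /= diracE memNset// => -[_]; apply.
have a1 : (1 <= fine (al [set 0]))%R.
  by rewrite -lee_fin fineK//; have := h _ m0; rewrite /= diracE mem_set.
rewrite /dist_dirac0 alD fineD// -[X in X + _]fineK// -EFinD; congr EFin.
have a0 : (0 <= fine (al (delays T `\ 0%R)))%R by exact: fine_ge0.
by rewrite !ger0_norm; lra.
Qed.

End dirac_limit.

Section ito_zero.
Context (R : realType) (dO : measure_display) (Omega : measurableType dO)
  (P : probability Omega R) (d : nat) (T : \bar R) (W : Omega -> R -> 'cV[R]_d).
Hypothesis T_gt0 : 0 < T.
Hypothesis basisW : brownian_basis P T W.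

(** Simple integrals vanish at 0, and so do their limits in S^2. *)
Lemma ito_integral0 (m : nat) (Z : process Omega R m d) (M : process Omega R m 1) :
  ito_integral P T W Z M -> {ae P, forall w, M w 0 = 0%R}.
Proof.
move=> ZM; have [H [_ /cvge0P HM]] := ito_approx T_gt0 ZM.
have [mM _] := in_S2_cproc basisW (proj1 ZM).
have T0 : times T 0 by rewrite /times/= lexx ltW.
have mM0 : measurable_fun setT (fun w => (enorm (M w 0) ^+ 2)%:E).
  by apply/measurable_EFinP; apply: measurable_sqr_enorm => i j; exact: mM.
have : \int[P]_w (enorm (M w 0) ^+ 2)%:E = 0.
  apply/eqP; rewrite eq_le; apply/andP; split; last first.
    by apply: integral_ge0 => w _; rewrite lee_fin sqr_ge0.
  apply/lee_addgt0Pr => e e0; rewrite add0e.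
  have [|k _ /(_ k (leqnn k)) /= ke] := HM _ e e0.
    by move=> n; apply: integral_ge0 => w _; exact: supsq_ge0.
  apply: le_trans ke; apply: le_ge0_integral => w; first by rewrite lee_fin sqr_ge0.
  apply: le_trans (supsq_ub (fun w t => si_integral (H k) w t - M w t)%R w T0).
  have -> : si_integral (H k) w 0 = 0%R.
    rewrite /si_integral big1// => i _.
    rewrite !min_l ?lee_fin ?subrr ?mulmx0//; first exact: si_l0.
    by apply: le_trans (si_lr (s:=H k) i); exact: si_l0.
  by rewrite sub0r enormN.
have <- : \int[P]_w `|(enorm (M w 0) ^+ 2)%:E| = \int[P]_w (enorm (M w 0) ^+ 2)%:E.
  by apply: eq_integral => w _; rewrite gee0_abs// lee_fin sqr_ge0.
move=> /(ae_eq_integral_abs _ measurableT mM0).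
apply: filterS => w /(_ Logic.I) [/eqP]; rewrite sqrf_eq0 => /eqP; exact: enorm_eq0.
Qed.

End ito_zero.

(** * Stability of backward equations *)

Section paths.
Context (R : realType) (T : \bar R) (T_gt0 : 0 < T) (m : nat).
Local Notation mu := (@lebesgue_measure R).

(** Here M and M' are the paths of the stochastic integrals. The equations at the times
    0 and t show that L_T is the integral of f - f' over [0, T], and that
    (y - y')_t - L_t is the opposite of its integral over [0, t[. *)
Lemma bsde_path_bound (xi0 : 'cV[R]_m) (f f' : R -> 'cV[R]_m) (y y' M M' : \bar R -> 'cV[R]_m) :
  mxintegrable mu (rtimes T) f -> mxintegrable mu (rtimes T) f' ->
  (forall t, times T t -> y t = (xi0 +
    \col_i (\int[mu]_(s in [set s : R | (t <= s%:E <= T)%E]) f s i ord0) - (M T - M t))%R) ->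
  (forall t, times T t -> y' t = (xi0 +
    \col_i (\int[mu]_(s in [set s : R | (t <= s%:E <= T)%E]) f' s i ord0) - (M' T - M' t))%R) ->
  let L t := (M t - M' t - (M 0%E - M' 0%E - (y 0%E - y' 0%E)))%R in
  let G := \int[mu]_(s in rtimes T) (enorm (f s - f' s))%:E in
  (enorm (L T))%:E <= G /\
  forall t, times T t -> (enorm (y t - y' t - L t))%:E <= G.
Proof.
move=> intf intf' ey ey' L G.
have mT := @measurable_rtimes R T.
pose D := (fun s => f s - f' s)%R.
have intD : mxintegrable mu (rtimes T) D by exact: mxintegrableB.
have T0 : times T 0 by rewrite /times/= lexx ltW.
have TT : times T T by rewrite /times/= lexx ltW.
pose tail (t : \bar R) := [set s : R | (t <= s%:E <= T)%E].
pose head (t : \bar R) := [set s : R | (0 <= s%:E)%E /\ (s%:E < t)%E].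
have mE : measurable_fun setT (@EFin R) by exact/measurable_EFinP.
have mtail t : measurable (tail t).
  have -> : tail t = (@EFin R) @^-1` `[t, T] by apply/seteqP; split => s; rewrite /tail/= in_itv.
  by have := mE measurableT _ (emeasurable_itv `[t, T]); rewrite setTI.
have mhead t : measurable (head t).
  have -> : head t = (@EFin R) @^-1` `[0, t[.
    by apply/seteqP; split => s; rewrite /head/= in_itv/=; [move=> [-> ->]|move=> /andP[]].
  by have := mE measurableT _ (emeasurable_itv `[0, t[); rewrite setTI.
have tail_sub t : times T t -> tail t `<=` rtimes T.
  by move=> /andP[t0 _] s /andP[ts sT]; rewrite /rtimes/= sT (le_trans t0 ts).
have head_sub t : times T t -> head t `<=` rtimes T.
  by move=> /andP[_ tT] s [s0 st]; rewrite /rtimes/= s0 (le_trans (ltW st) tT).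
have sub_int A (h : R -> 'cV[R]_m) : measurable A -> A `<=` rtimes T ->
    mxintegrable mu (rtimes T) h -> mxintegrable mu A h.
  move=> mA AT [mh hoo]; split; first by move=> i j; exact: (measurable_funS mT AT (mh i j)).
  apply: le_lt_trans hoo; apply: ge0_subset_integral => //.
    by apply/measurable_EFinP; exact: measurable_enorm.
  by move=> s _; rewrite lee_fin enorm_ge0.
have colE A (h : R -> 'cV[R]_m) : (\col_i (\int[mu]_(s in A) h s i ord0))%R = mxint mu A h.
  by apply/matrixP => i j; rewrite !mxE (ord1 j).
have dE t : times T t -> (y t - y' t = mxint mu (tail t) D - ((M T - M' T) - (M t - M' t)))%R.
  move=> tT; rewrite ey// ey'// !colE /D mxintB//; [|exact: mtail|exact: sub_int (tail_sub _ tT) intf|exact: sub_int (tail_sub _ tT) intf'].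
  by apply/matrixP => i j; rewrite !mxE; ring.
have splitD t : times T t -> mxint mu (rtimes T) D = (mxint mu (head t) D + mxint mu (tail t) D)%R.
  move=> tT.
  have eqT : rtimes T = head t `|` tail t.
    apply/seteqP; split => s; last by move=> [/(head_sub _ tT)|/(tail_sub _ tT)].
    move=> /andP[s0 sT]; have [st|ts] := ltP s%:E t; first by left; split.
    by right; rewrite /tail/= ts.
  apply/matrixP => i j; rewrite !mxE [in LHS]eqT.
  apply: Rintegral_setU; [exact: mhead|exact: mtail| |].
    by rewrite -eqT; exact: (@mxintegrable_coord _ _ _ mu _ mT _ _ _ i j intD).
  by apply/disj_setPS => s [[_ st] /andP[ts _]]; move: st; rewrite ltNge ts.
have LT : L T = mxint mu (rtimes T) D.
  have -> : rtimes T = tail 0 by [].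
  by rewrite /L dE//; apply/matrixP => i j; rewrite !mxE; ring.
split; first by rewrite LT; exact: enorm_mxint.
move=> t tT.
have -> : (y t - y' t - L t = - mxint mu (head t) D)%R.
  rewrite /L dE// dE//.
  have := splitD t tT; have -> : rtimes T = tail 0 by [].
  by move=> ->; apply/matrixP => i j; rewrite !mxE; ring.
have intDt : mxintegrable mu (head t) D by exact: sub_int (head_sub _ tT) intD.
rewrite enormN; apply: le_trans (@enorm_mxint _ _ _ mu _ (mhead t) _ _ _ intDt) _.
apply: ge0_subset_integral; [exact: mhead|exact: mT| | |exact: head_sub].
  by apply/measurable_EFinP; apply: measurable_enorm; case: intD.
by move=> s _; rewrite lee_fin enorm_ge0.
Qed.

End paths.

Section differences.
Context (R : realType) (dO : measure_display) (Omega : measurableType dO)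
  (P : probability Omega R) (d : nat) (T : \bar R) (W : Omega -> R -> 'cV[R]_d).
Hypothesis T_gt0 : 0 < T.
Hypothesis basisW : brownian_basis P T W.
Local Notation mu := (@lebesgue_measure R).

Let sqB (p q : nat) (A B : 'M[R]_(p, q)) :
  (enorm (A - B) ^+ 2 <= 2 * enorm A ^+ 2 + 2 * enorm B ^+ 2)%R.
Proof.
have := sqr_enormD_le A (- B)%R (@ltr01 R); rewrite enormN invr1.
by rewrite (_ : 1 + 1 = 2)%R//; lra.
Qed.

Lemma supsqB_lty m (X Y : process Omega R m 1) : in_S2 P T W X -> in_S2 P T W Y ->
  \int[P]_w supsq T (fun w t => X w t - Y w t)%R w < +oo.
Proof.
move=> hX hY; have [cX cY] := (in_S2_cproc basisW hX, in_S2_cproc basisW hY).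
apply: (@le_lt_trans _ _ (2%:E * \int[P]_w supsq T X w + 2%:E * \int[P]_w supsq T Y w)).
  apply: le_ge0_lincomb_integral => //.
  - exact: (measurable_supsq T_gt0 basisW).
  - exact: (measurable_supsq T_gt0 basisW).
  - by move=> w; exact: supsq_ge0.
  - by move=> w; exact: supsq_ge0.
  - by move=> w; exact: supsq_ge0.
  - apply: aeW => w; apply: ge_ereal_sup => _ [t tT <-].
    apply: (@le_trans _ _ ((2 * enorm (X w t) ^+ 2 + 2 * enorm (Y w t) ^+ 2)%R)%:E).
      by rewrite lee_fin sqB.
    by rewrite EFinD !EFinM; apply: leeD; rewrite lee_wpmul2l ?lee_fin//; exact: supsq_ub.
  - by apply: (measurable_supsq T_gt0 basisW); exact: cprocB.
by apply: lte_add_pinfty; rewrite lte_mul_pinfty//; [exact: (in_S2_supsq T_gt0 hX)|exact: (in_S2_supsq T_gt0 hY)].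
Qed.

Lemma energyB_lty p q (X Y : process Omega R p q) : in_H2 P T W X -> in_H2 P T W Y ->
  \int[P]_w energy T (fun w t => X w t - Y w t)%R w < +oo.
Proof.
move=> [pX hX] [pY hY].
have jX i j := predictable_joint T_gt0 basisW i j pX.
have jY i j := predictable_joint T_gt0 basisW i j pY.
rewrite integral_energy; last exact: jmeasB.
have mE (Z : process Omega R p q) : jmeas T Z ->
    measurable_fun setT (fun x => (enorm (real_path T Z x) ^+ 2)%:E).
  by move=> mZ; apply/measurable_EFinP; exact: measurable_sqr_enorm.
apply: (@le_lt_trans _ _ (2%:E * \int[P \x mu]_x (enorm (real_path T X x) ^+ 2)%:E +
                          2%:E * \int[P \x mu]_x (enorm (real_path T Y x) ^+ 2)%:E)).
  apply: le_ge0_lincomb_integral => //; try by move=> x; rewrite lee_fin sqr_ge0.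
  - exact: mE.
  - exact: mE.
  - apply: aeW => x; rewrite -!EFinM -EFinD lee_fin.
    apply: le_trans (sqB _ _); rewrite le_eqVlt; apply/orP; left; apply/eqP.
    by congr (enorm _ ^+ 2)%R; rewrite /real_path; case: ifP => _//; rewrite subrr.
  - by apply: mE; exact: jmeasB.
rewrite -!integral_energy// -!(sqr_H2norm).
by apply: lte_add_pinfty; rewrite lte_mul_pinfty//; apply: sqre_lty => //; exact: H2norm_ge0.
Qed.

End differences.

Section stability.
Context (R : realType) (dO : measure_display) (Omega : measurableType dO)
  (P : probability Omega R) (d : nat) (T : \bar R) (W : Omega -> R -> 'cV[R]_d).
Hypothesis T_gt0 : 0 < T.
Hypothesis basisW : brownian_basis P T W.
Context (m : nat).
Local Notation mu := (@lebesgue_measure R).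
Local Notation E f := (\int[P]_w f w)%R.

Lemma sqint_enorm (f : Omega -> 'cV[R]_m) : (forall i, sqint P (fun w => f w i ord0)) ->
  \int[P]_w (enorm (f w) ^+ 2)%:E = (\sum_i E (fun w => f w i ord0 ^+ 2))%R%:E.
Proof.
move=> sf.
have [h1 h2] := @exp_sum _ _ _ P _ (index_enum _) (fun i w => f w i ord0 ^+ 2)%R (fun i => (sf i).2).
rewrite -h2 (EFin_exp h1); apply: eq_integral => w _; rewrite sqr_enorm.
by congr EFin; apply: eq_bigr => i _; rewrite big_ord1.
Qed.

(** A bound of the squared distance G^2 of the drivers by a small multiple of the
    squared distance of the solutions, plus an error B, controls that distance by B:
    the small multiple is absorbed. In terms of E(G^2) the H^2 part costs 1 and the
    S^2 part (3/2) * 4 + 3 = 9, from sup |Y - Y'|^2 <= (3/2) sup |L|^2 + 3 G^2 and the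
    maximal inequality. As 10 * 9/100 = 9/10, the factor of E(B) is 10 / (1 - 9/10). *)
Lemma bsde_stability (xi : Omega -> 'cV[R]_m) (F F' : Omega -> R -> 'cV[R]_m)
    (Y Y' : process Omega R m 1) (Z Z' : process Omega R m d) (B : Omega -> \bar R) :
  bsde_solution P T W xi (fun _ _ => F) Y Z ->
  bsde_solution P T W xi (fun _ _ => F') Y' Z' ->
  {ae P, forall w, mxintegrable mu (rtimes T) (F w)} ->
  {ae P, forall w, mxintegrable mu (rtimes T) (F' w)} ->
  measurable_fun setT B -> (forall w, 0 <= B w) ->
  {ae P, forall w, (\int[mu]_(s in rtimes T) (enorm (F w s - F' w s))%:E) ^+ 2 <=
    (9 / 100)%:E * (supsq T (fun w t => Y w t - Y' w t)%R w +
                    energy T (fun w t => Z w t - Z' w t)%R w) + B w} ->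
  \int[P]_w supsq T (fun w t => Y w t - Y' w t)%R w +
  \int[P]_w energy T (fun w t => Z w t - Z' w t)%R w <= 100%:E * \int[P]_w B w.
Proof.
move=> [YS ZH [M ZM eqY]] [YS' ZH' [M' ZM' eqY']] intF intF' mB B0 G_le.
pose dY : process Omega R m 1 := (fun w t => Y w t - Y' w t)%R.
pose dZ : process Omega R m d := (fun w t => Z w t - Z' w t)%R.
pose N : process Omega R m 1 := (fun w t => M w t - M' w t)%R.
pose L : process Omega R m 1 := (fun w t => N w t - (N w 0%E - dY w 0%E))%R.
pose G w := \int[mu]_(s in rtimes T) (enorm (F w s - F' w s))%:E.
pose SQ := supsq T dY; pose EN := energy T dZ.
pose B2 w := (9 / 100)%:E * (SQ w + EN w) + B w.
have T0 : times T 0 by rewrite /times/= lexx ltW.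
have TT : times T T by rewrite /times/= lexx ltW.
have cY := in_S2_cproc basisW YS; have cY' := in_S2_cproc basisW YS'.
have cM := in_S2_cproc basisW ZM.1; have cM' := in_S2_cproc basisW ZM'.1.
have cdY : cproc P T dY by exact: cprocB.
have cN : cproc P T N by exact: cprocB.
have jZ i j := predictable_joint T_gt0 basisW i j ZH.1.
have jZ' i j := predictable_joint T_gt0 basisW i j ZH'.1.
have jdZ : jmeas T dZ by exact: jmeasB.
have mSQ : measurable_fun setT SQ by exact: (measurable_supsq T_gt0 basisW).
have mEN : measurable_fun setT EN by exact: measurable_energy.
have SQ0 w : 0 <= SQ w by exact: supsq_ge0.
have EN0 w : 0 <= EN w by exact: energy_ge0.
have SQoo : \int[P]_w SQ w < +oo by exact: (supsqB_lty T_gt0 basisW YS YS').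
have ENoo : \int[P]_w EN w < +oo by exact: (energyB_lty T_gt0 basisW ZH ZH').
have k0 : (0 <= 9 / 100 :> R)%R by rewrite divr_ge0.
have mB2 : measurable_fun setT B2.
  by apply: emeasurable_funD => //; apply: measurable_funeM; exact: emeasurable_funD.
have B20 w : 0 <= B2 w by rewrite adde_ge0// mule_ge0// ?lee_fin// adde_ge0.
have intB2 : \int[P]_w B2 w = (9 / 100)%:E * (\int[P]_w SQ w + \int[P]_w EN w) + \int[P]_w B w.
  rewrite ge0_integralD//.
  - by rewrite ge0_integralZl//; [rewrite ge0_integralD|exact: emeasurable_funD|move=> w _; exact: adde_ge0].
  - by move=> w _; rewrite mule_ge0// ?lee_fin// adde_ge0.
  - by apply: measurable_funeM; exact: emeasurable_funD.
have path : {ae P, forall w, (enorm (L w T) ^+ 2)%:E <= B2 w /\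
    forall t, times T t -> (enorm (dY w t - L w t) ^+ 2)%:E <= B2 w}.
  have := ae_and (ae_and eqY eqY') (ae_and G_le (ae_and intF intF')).
  apply: filterS => w [[e e'] [Gw [iF iF']]].
  have [h1 h2] := bsde_path_bound T_gt0 iF iF' e e'.
  have sq (x : R) : (0 <= x)%R -> x%:E <= G w -> (x ^+ 2)%:E <= B2 w.
    move=> x0 xG; apply: le_trans Gw; rewrite -/(G w).
    move: xG; case: (G w) => [g| |]// xG; last by rewrite leey.
    rewrite lee_fin in xG.
    by rewrite -EFin_expe lee_fin ler_pXn2r// nnegrE// (le_trans x0 xG).
  by split => [|t tT]; apply: sq; rewrite ?enorm_ge0//; exact: h2.
(* L is a square-integrable continuous martingale, to which the maximal inequality
   applies *)
have sdY0 i : sqint P (fun w => dY w 0%E i ord0).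
  by have [] := sqint_supsq T0 (cdY.1 _ T0 i ord0) SQoo.
have sN t i : times T t -> sqint P (fun w => N w t i ord0).
  move=> tT; rewrite /N; under eq_fun do rewrite !mxE; apply: sqintB.
    exact: (ito_sqint T_gt0 basisW ZM).
  exact: (ito_sqint T_gt0 basisW ZM').
have aN t i : times T t -> fmeas P W t (fun w => N w t i ord0).
  move=> tT; rewrite /N; under eq_fun do rewrite !mxE; apply: measurable_funB.
    by case: (ZM.1) => pM _ _; exact: (predictable_adapted pM i ord0 tT).
  by case: (ZM'.1) => pM _ _; exact: (predictable_adapted pM i ord0 tT).
have ady0 i : fmeas P W 0 (fun w => dY w 0%E i ord0).
  rewrite /dY; under eq_fun do rewrite !mxE; apply: measurable_funB.
    by case: YS => pY _ _; exact: (predictable_adapted pY i ord0 T0).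
  by case: YS' => pY _ _; exact: (predictable_adapted pY i ord0 T0).
have martN s t X i : 0 <= s -> s <= t -> t <= T -> fmeas P W s X -> sqint P X ->
    (E (fun w => X w * (N w t i ord0 - N w s i ord0)) = 0)%R.
  move=> s0 st tT FX sX.
  have times_t : times T t by rewrite /times/= tT andbT (le_trans s0).
  have times_s : times T s by rewrite /times/= s0 (le_trans st).
  have h1 := ito_martingale T_gt0 basisW ZM i s0 st tT FX sX.
  have h2 := ito_martingale T_gt0 basisW ZM' i s0 st tT FX sX.
  have sM r : times T r -> sqint P (fun w => M w r i ord0) by exact: (ito_sqint T_gt0 basisW ZM).
  have sM' r : times T r -> sqint P (fun w => M' w r i ord0) by exact: (ito_sqint T_gt0 basisW ZM').
  have e : (E (fun w => X w * (M w t i ord0 - M w s i ord0)) =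
    E (fun w => X w * (N w t i ord0 - N w s i ord0)) +
    E (fun w => X w * (M' w t i ord0 - M' w s i ord0)))%R.
    rewrite -expD.
    - by apply: eq_Rintegral => w _; rewrite /N !mxE; ring.
    - by apply: sqint_mul_int => //; apply: sqintB; exact: sN.
    - by apply: sqint_mul_int => //; apply: sqintB; exact: sM'.
  by move: e; rewrite h1 h2 addr0.
have subE (A A' : 'cV[R]_m) i : ((A - A')%R i ord0 = A i ord0 - A' i ord0)%R by rewrite !mxE.
have LE t i : (fun w => L w t i ord0) = (fun w => N w t i ord0 - (N w 0%E i ord0 - dY w 0%E i ord0))%R.
  by apply/funext => w; rewrite /L !subE.
have sL t i : times T t -> sqint P (fun w => L w t i ord0).
  move=> tT; rewrite LE; by apply: sqintB; [exact: sN|apply: sqintB => //; exact: sN].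
have cL : cproc P T L.
  split => [t tT i j|]; first by rewrite (ord1 j); case: (sL t i tT).
  apply: filterS cN.2 => w cNw t; apply: cvgB; first exact: cNw.
  exact: cvg_cst.
have doobL : \int[P]_w supsq T L w <= 4%:E * \int[P]_w (enorm (L w T) ^+ 2)%:E.
  apply: (doob T_gt0 basisW) => //.
  - move=> t i tT; rewrite LE.
    have t0 : 0 <= t by case/andP: tT.
    apply: measurable_funB; first exact: aN.
    apply: measurable_funB; first by apply: (@fmeas_le _ _ _ P _ W _ _ _ t0); exact: aN.
    by apply: (@fmeas_le _ _ _ P _ W _ _ _ t0); exact: ady0.
  - move=> s t X i s0 st tT FX sX; rewrite -[RHS](martN s t X i s0 st tT FX sX).
    by apply: eq_Rintegral => w _; rewrite /L !mxE; ring.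
  - exact: cL.2.
(* the isometry controls N_T, which equals N_T - N_0 almost surely; this is at most
   L_T in L^2 because L_T is the orthogonal sum of dY_0 and N_T - N_0 *)
have ENle : \int[P]_w EN w <= \int[P]_w (enorm (L w T) ^+ 2)%:E.
  apply: le_trans (ito_isometry_le T_gt0 basisW ZM ZM' jZ jZ') _.
  have -> : \int[P]_w (enorm (M w T - M' w T) ^+ 2)%:E =
            \int[P]_w (enorm (N w T - N w 0) ^+ 2)%:E.
    have mN (f : Omega -> 'cV[R]_m) : (forall i j, measurable_fun setT (fun w => f w i j)) ->
        measurable_fun setT (fun w => (enorm (f w) ^+ 2)%:E).
      by move=> mf; apply/measurable_EFinP; exact: measurable_sqr_enorm.
    apply: ge0_ae_eq_integral => //; try by move=> w _; rewrite lee_fin sqr_ge0.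
    - by apply: mN => i j; exact: cN.1.
    - apply: mN => i j; under eq_fun do rewrite !mxE; apply: measurable_funB.
        by have := cN.1 T TT i j; rewrite /N; under eq_fun do rewrite !mxE.
      by have := cN.1 0 T0 i j; rewrite /N; under eq_fun do rewrite !mxE.
    have := ae_and (ito_integral0 T_gt0 basisW ZM) (ito_integral0 T_gt0 basisW ZM').
    by apply: filterS => w [M0 M0'] _; rewrite /N M0 M0' subrr subr0.
  have sNT i : sqint P (fun w => (N w T - N w 0%E)%R i ord0).
    by under eq_fun do rewrite subE; apply: sqintB; exact: sN.
  rewrite (sqint_enorm sNT) sqint_enorm; last by move=> i; exact: sL.
  rewrite lee_fin; apply: ler_sum => i _.
  have -> : E (fun w => L w T i ord0 ^+ 2)%R =
      (E (fun w => (N w T - N w 0%E)%R i ord0 ^+ 2) + E (fun w => dY w 0%E i ord0 ^+ 2))%R.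
    have := martN 0 T (fun w => dY w 0%E i ord0) i (lexx 0) (ltW T_gt0) (lexx T) (ady0 i) (sdY0 i).
    have sNT' : sqint P (fun w => N w T i ord0 - N w 0%E i ord0)%R by apply: sqintB; exact: sN.
    move=> h; rewrite -expD; [|exact: (sNT i).2|exact: (sdY0 i).2].
    have := expZ 2 (sqint_mul_int (sdY0 i) sNT'); rewrite h mulr0 => h2.
    rewrite -[RHS]addr0 -h2 -expD.
    - by apply: eq_Rintegral => w _; rewrite /L !mxE; ring.
    - by apply: integrableD_EFin; [exact: (sNT i).2|exact: (sdY0 i).2].
    - exact: (integrableZ_EFin 2 (sqint_mul_int (sdY0 i) sNT')).
  by rewrite lerDl; apply: exp_ge0 => w; exact: sqr_ge0.
have LTle : \int[P]_w (enorm (L w T) ^+ 2)%:E <= \int[P]_w B2 w.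
  apply: ae_ge0_le_integral => //.
  - by move=> w _; rewrite lee_fin sqr_ge0.
  - by apply/measurable_EFinP; apply: measurable_sqr_enorm => i j; exact: cL.1.
  - by apply: filterS path => w [].
have SQle : \int[P]_w SQ w <= (3 / 2)%:E * \int[P]_w supsq T L w + 3%:E * \int[P]_w B2 w.
  apply: le_ge0_lincomb_integral => //.
  - exact: (measurable_supsq T_gt0 basisW).
  - by move=> w; exact: supsq_ge0.
  apply: filterS path => w [_ pw]; apply: ge_ereal_sup => _ [t tT <-].
  apply: (@le_trans _ _ (((3 / 2) * enorm (L w t) ^+ 2 + 3 * enorm (dY w t - L w t) ^+ 2)%R)%:E).
    have := @sqr_enormD_le R m 1 (2^-1)%R (L w t) (dY w t - L w t)%R.
    rewrite addrC subrK invrK lee_fin => h; have {}h := h ltac:(by rewrite invr_gt0).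
    by apply: le_trans h _; rewrite lerD// ler_wpM2r ?sqr_ge0//; lra.
  rewrite EFinD !EFinM; apply: leeD; rewrite lee_wpmul2l ?lee_fin ?divr_ge0//.
    exact: supsq_ub.
  exact: pw.
rewrite -/dY -/dZ -/SQ -/EN.
have SQI0 : 0 <= \int[P]_w SQ w by exact: integral_ge0.
have ENI0 : 0 <= \int[P]_w EN w by exact: integral_ge0.
have BI0 : 0 <= \int[P]_w B w by exact: integral_ge0.
have LI0 : 0 <= \int[P]_w (enorm (L w T) ^+ 2)%:E.
  by apply: integral_ge0 => w _; rewrite lee_fin sqr_ge0.
have SLI0 : 0 <= \int[P]_w supsq T L w by apply: integral_ge0 => w _; exact: supsq_ge0.
move: SQle LTle ENle doobL; rewrite intB2.
move: SQI0 ENI0 BI0 LI0 SLI0 SQoo ENoo.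
case: (\int[P]_w B w) => [b| |]//; last by move=> *; rewrite gt0_muley ?leey// lte_fin.
case: (\int[P]_w SQ w) => [a| |]//; case: (\int[P]_w EN w) => [e| |]//.
case: (\int[P]_w (enorm (L w T) ^+ 2)%:E) => [l| |]//;
case: (\int[P]_w supsq T L w) => [q| |]//; rewrite -?EFinD -?EFinM -?EFinD -?EFinM -?EFinD ?lee_fin//.
lra.
Qed.

End stability.

(** * Generators with a delay compared with generators without *)

Section almost_everywhere.
Context (R : realType) (dO : measure_display) (Omega : measurableType dO)
  (P : probability Omega R).
Local Notation mu := (@lebesgue_measure R).

Lemma ae_lty (f : Omega -> \bar R) : measurable_fun setT f -> (forall w, 0 <= f w) ->
  \int[P]_w f w < +oo -> {ae P, forall w, f w < +oo}.
Proof.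
move=> mf f0 foo; have intf : P.-integrable setT f.
  by apply/integrableP; split => //; under eq_integral do rewrite gee0_abs//.
have := @integrable_ae _ _ _ P _ measurableT f intf.
by apply: filterS => w /(_ Logic.I); rewrite ge0_fin_numE.
Qed.

(** Almost all sections of a null set of the product are null. *)
Lemma ae_xsection (A : Omega * R -> Prop) : {ae (P \x mu), forall x, A x} ->
  {ae P, forall w, {ae [the measure _ _ of mu], forall s : R, A (w, s)}}.
Proof.
move=> [N [mN N0 AN]].
have mphi := @measurable_fun_xsection _ _ _ _ _ mu _ mN.
have : \int[P]_w `|(mu \o xsection N) w| = 0.
  by rewrite -[RHS]N0; apply: eq_integral => w _; rewrite gee0_abs.
move=> /(ae_eq_integral_abs _ measurableT mphi).
apply: filterS => w /(_ Logic.I) /= Nw.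
exists (xsection N w); split => //; first exact: measurable_xsection.
by move=> s /= h; rewrite /xsection/= inE; exact: AN.
Qed.

End almost_everywhere.

(** Young's inequality with weight 1/8: for s = (x + e) / 5 and r = p y + q z,
    (s + r)^2 <= (9/8) s^2 + 9 r^2, where s^2 <= (2/25) (x^2 + e^2) and
    (9/8) (2/25) = 9/100. *)
Lemma sqr_sum_le (R : realFieldType) (a b p q x e y z G : R) :
  (0 <= a <= 5^-1 -> 0 <= b <= 5^-1 -> 0 <= x -> 0 <= e -> 0 <= G ->
  G <= a * x + b * e + (p * y + q * z) ->
  G ^+ 2 <= 9 / 100 * (x ^+ 2 + e ^+ 2) + 9 * (p ^+ 2 + q ^+ 2) * (y ^+ 2 + z ^+ 2))%R.
Proof.
move=> /andP[a0 a5] /andP[b0 b5] x0 e0 G0 Gle.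
pose s : R := (5^-1 * (x + e))%R; pose r : R := (p * y + q * z)%R.
have Gs : (G <= s + r)%R.
  apply: le_trans Gle _; rewrite lerD2r /s mulrDr.
  by apply: lerD; exact: ler_wpM2r.
have h1 : (G ^+ 2 <= 9 / 8 * s ^+ 2 + 9 * r ^+ 2)%R.
  have := sqr_ge0 (s - 8 * r)%R => h.
  apply: (@le_trans _ _ ((s + r) ^+ 2)%R); last by nra.
  by rewrite ler_pXn2r// nnegrE// (le_trans G0).
have h2 : (s ^+ 2 <= 2 / 25 * (x ^+ 2 + e ^+ 2))%R by rewrite /s; have := sqr_ge0 (x - e)%R; nra.
have h3 : (r ^+ 2 <= (p ^+ 2 + q ^+ 2) * (y ^+ 2 + z ^+ 2))%R.
  by rewrite /r; have := sqr_ge0 (p * z - q * y)%R; nra.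
by nra.
Qed.

Section path_estimates.
Context (R : realType) (T : \bar R) (T_gt0 : 0 < T).
Context dO (Omega : measurableType dO).
Local Notation mu := (@lebesgue_measure R).

Section one_component.
Context (p q : nat) (c : \bar R -> R) (mc : measurable_fun (times T) c).
Implicit Types X Y : Omega -> \bar R -> 'M[R]_(p, q).

Lemma wnorm_le_supsq X w : tmeas T X w -> supsq T X w < +oo ->
  wnorm T c X w <= Lpnorm T 1 c * (supsq T X w) `^ 2^-1.
Proof.
move=> mX Xoo; have S0 := supsq_ge0 T_gt0 X w.
have := sqre_half S0; have := poweR_ge0 (supsq T X w) 2^-1.
case E : (supsq T X w `^ 2^-1) => [S| |]//; last first.
  by move=> _ h; move: Xoo; rewrite -h.
rewrite lee_fin => S_ge0 h; apply: (wnorm_le_sup T_gt0 mc mX) => t tT.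
have := supsq_ub X w tT; rewrite -h -EFin_expe lee_fin.
by rewrite ler_pXn2r// nnegrE ?enorm_ge0.
Qed.

Lemma delay_mxintegrable (al : {finite_measure set (\bar R) -> \bar R}) X w :
  tmeas T X w -> wnorm T c X w < +oo -> mxintegrable mu (rtimes T) (delay_integral T c al X w).
Proof.
move=> mX Xoo; split; first by move=> i j; exact: measurable_delay_integral.
apply: le_lt_trans (delay_integral_bound mc al mX Xoo) _.
by rewrite lte_mul_pinfty//; apply: fin_num_measure; exact: measurable_delays.
Qed.

Lemma weight_mxintegrable X w : tmeas T X w -> wnorm T c X w < +oo ->
  mxintegrable mu (rtimes T) (fun s => c s%:E *: X w s%:E)%R.
Proof.
move=> mX Xoo; split; last exact: le_lt_trans (integral_weight_le c mX) Xoo.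
move=> i j; under eq_fun do rewrite mxE.
have mcX : measurable_fun (times T) (fun t => c t * X w t i j)%R by exact: measurable_funM.
exact: measurable_rtimes_comp mcX.
Qed.

Lemma delay_dist_le (al : {finite_measure set (\bar R) -> \bar R}) X Y w (a b : R) :
  measure_le al (dirac (0 : \bar R)) \/ measure_le (dirac (0 : \bar R)) al ->
  tmeas T X w -> tmeas T Y w -> wnorm T c X w < +oo ->
  wnorm T c (fun w t => X w t - Y w t)%R w <= a%:E -> wnorm T c Y w <= b%:E ->
  \int[mu]_(s in rtimes T) (enorm (delay_integral T c al X w s - c s%:E *: Y w s%:E))%:E <=
  (fine (al (delays T)) * a + `|fine (al (delays T)) - 1| * b)%:E.
Proof.
move=> ord mX mY Xoo XYa Yb.
apply: le_trans (delay_integral_dist T_gt0 mc al mX mY Xoo _) _.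
  by apply: le_lt_trans Yb _; rewrite ltry.
have f1 : al (delays T) \is a fin_num by apply: fin_num_measure; exact: measurable_delays.
rewrite dist_dirac0E// EFinD !EFinM fineK//.
by apply: leeD; rewrite lee_wpmul2l// lee_fin.
Qed.

End one_component.

Context (P : probability Omega R) (d m : nat) (W : Omega -> R -> 'cV[R]_d)
  (g : generator R Omega d m) (mg : measurable_generator P T W g).
Context (u v : \bar R -> R) (mu_ : measurable_fun (times T) u)
  (mv : measurable_fun (times T) v)
  (u_L1 : Lpnorm T 1 u < +oo) (v_L2 : Lpnorm T 2%:E v < +oo).
Context (K : R) (K0 : (0 < K)%R).

(** The estimate of the distance of the drivers in the form required by
    [bsde_stability]. The smallness conditions enter as K a |u|_1 <= 1/5 and
    K b |v|_2 <= 1/5, for the masses a and b of the delay measures. *)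
Lemma generator_delay_dist (al be : {finite_measure set (\bar R) -> \bar R})
    (X Y : process Omega R m 1) (V Z : process Omega R m d) w :
  measure_le al (dirac (0 : \bar R)) \/ measure_le (dirac (0 : \bar R)) al ->
  measure_le be (dirac (0 : \bar R)) \/ measure_le (dirac (0 : \bar R)) be ->
  (K ^+ 2)%:E * (al (delays T)) ^+ 2 * (Lpnorm T 1 u) ^+ 2 <= (25^-1)%:E ->
  (K ^+ 2)%:E * (be (delays T)) ^+ 2 * (Lpnorm T 2%:E v) ^+ 2 <= (25^-1)%:E ->
  {ae [the measure _ _ of mu], forall s : R, rtimes T s -> forall (y y' : 'cV[R]_m) (z z' : 'M[R]_(m, d)),
     (enorm (g w s%:E y z - g w s%:E y' z') <= K * (enorm (y - y') + enorm (z - z')))%R} ->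
  tmeas T X w -> tmeas T Y w -> tmeas T V w -> tmeas T Z w ->
  supsq T X w < +oo -> supsq T Y w < +oo -> supsq T (fun w t => X w t - Y w t)%R w < +oo ->
  energy T V w < +oo -> energy T Z w < +oo -> energy T (fun w t => V w t - Z w t)%R w < +oo ->
  (\int[mu]_(s in rtimes T) (enorm
     (g w s%:E (delay_integral T u al X w s) (delay_integral T v be V w s) -
      g w s%:E (u s%:E *: Y w s%:E)%R (v s%:E *: Z w s%:E)%R))%:E) ^+ 2 <=
  (9 / 100)%:E * (supsq T (fun w t => X w t - Y w t)%R w +
                  energy T (fun w t => V w t - Z w t)%R w) +
  (9 * ((K * `|fine (al (delays T)) - 1| * fine (Lpnorm T 1 u)) ^+ 2 +
        (K * `|fine (be (delays T)) - 1| * fine (Lpnorm T 2%:E v)) ^+ 2))%:E *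
    (supsq T Y w + energy T Z w).
Proof.
move=> oal obe sal sbe lip mX mY mV mZ Xoo Yoo XYoo Voo Zoo VZoo.
have mXY : tmeas T (fun w t => X w t - Y w t)%R w.
  by move=> i j; under eq_fun do rewrite !mxE; exact: measurable_funB.
have mVZ : tmeas T (fun w t => V w t - Z w t)%R w.
  by move=> i j; under eq_fun do rewrite !mxE; exact: measurable_funB.
have root (x : \bar R) : 0 <= x -> x < +oo -> exists2 r : R, (0 <= r)%R & x `^ 2^-1 = r%:E /\ x = (r ^+ 2)%:E.
  move=> x0 xoo; have := sqre_half x0; have := poweR_ge0 x 2^-1.
  case E : (x `^ 2^-1) => [r| |]//; last by move=> _ h; move: xoo; rewrite -h.
  by rewrite lee_fin => r0 h; exists r => //; split => //; rewrite -h -EFin_expe.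
have [rX _ [rXE _]] := root _ (supsq_ge0 T_gt0 X w) Xoo.
have [rY rY0 [rYE sY]] := root _ (supsq_ge0 T_gt0 Y w) Yoo.
have [x x0 [xE sx]] := root _ (supsq_ge0 T_gt0 (fun w t => X w t - Y w t)%R w) XYoo.
have [rV _ [rVE _]] := root _ (energy_ge0 T V w) Voo.
have [rZ rZ0 [rZE sZ]] := root _ (energy_ge0 T Z w) Zoo.
have [e e0 [eE se]] := root _ (energy_ge0 T (fun w t => V w t - Z w t)%R w) VZoo.
have UE : Lpnorm T 1 u = (fine (Lpnorm T 1 u))%:E.
  by rewrite fineK// ge0_fin_numE// Lnorm_ge0.
have VE : Lpnorm T 2%:E v = (fine (Lpnorm T 2%:E v))%:E.
  by rewrite fineK// ge0_fin_numE// Lnorm_ge0.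
set U := fine (Lpnorm T 1 u) in UE *; set V2 := fine (Lpnorm T 2%:E v) in VE *.
have U0 : (0 <= U)%R by apply: fine_ge0; exact: Lnorm_ge0.
have V20 : (0 <= V2)%R by apply: fine_ge0; exact: Lnorm_ge0.
have alE : al (delays T) = (fine (al (delays T)))%:E.
  by rewrite fineK//; apply: fin_num_measure; exact: measurable_delays.
have beE : be (delays T) = (fine (be (delays T)))%:E.
  by rewrite fineK//; apply: fin_num_measure; exact: measurable_delays.
have A0 : (0 <= fine (al (delays T)))%R by exact: fine_ge0.
have B0 : (0 <= fine (be (delays T)))%R by exact: fine_ge0.
rewrite UE alE -!EFin_expe -!EFinM lee_fin in sal.
rewrite VE beE -!EFin_expe -!EFinM lee_fin in sbe.
set A := fine (al (delays T)) in alE A0 sal *; set B := fine (be (delays T)) in beE B0 sbe *.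
have small (a b : R) : (0 <= a)%R -> (0 <= b)%R -> (K ^+ 2 * a ^+ 2 * b ^+ 2 <= 25^-1)%R -> (0 <= K * a * b <= 5^-1)%R.
  move=> a0 b0 h; rewrite !mulr_ge0//=; last exact: ltW.
  rewrite -(@ler_pXn2r _ 2)// ?nnegrE ?mulr_ge0// ?invr_ge0//; last exact: ltW.
  by rewrite !exprMn; apply: le_trans h _; lra.
have wX := wnorm_le_supsq mu_ mX Xoo; have wY := wnorm_le_supsq mu_ mY Yoo.
have wXY := wnorm_le_supsq mu_ mXY XYoo.
have wV := wnorm_le_energy mv mV; have wZ := wnorm_le_energy mv mZ.
have wVZ := wnorm_le_energy mv mVZ.
rewrite UE rXE -EFinM in wX; rewrite UE rYE -EFinM in wY; rewrite UE xE -EFinM in wXY.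
rewrite VE rVE -EFinM in wV; rewrite VE rZE -EFinM in wZ; rewrite VE eE -EFinM in wVZ.
have lt_oo (a : \bar R) (b : R) : a <= b%:E -> a < +oo by move=> h; rewrite (le_lt_trans h)// ltry.
have d1 := delay_dist_le mu_ oal mX mY (lt_oo _ _ wX) wXY wY.
have d2 := delay_dist_le mv obe mV mZ (lt_oo _ _ wV) wVZ wZ.
have i1 := delay_mxintegrable mu_ al mX (lt_oo _ _ wX).
have i2 := delay_mxintegrable mv be mV (lt_oo _ _ wV).
have i3 := weight_mxintegrable mu_ mY (lt_oo _ _ wY).
have i4 := weight_mxintegrable mv mZ (lt_oo _ _ wZ).
have := generator_lip_integral mg (ltW K0) lip i1.1 i3.1 i2.1 i4.1.
set G := \int[mu]_(s in _) _ => Gle.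
have G0 : 0 <= G by apply: integral_ge0 => s _; rewrite lee_fin enorm_ge0.
have {}Gle : G <= (K * ((A * (U * x) + `|A - 1| * (U * rY)) + (B * (V2 * e) + `|B - 1| * (V2 * rZ))))%:E.
  apply: le_trans Gle _; rewrite EFinM lee_wpmul2l ?lee_fin ?(ltW K0)//.
  by rewrite EFinD; exact: leeD d1 d2.
move: G0 Gle; case: G => [G| |]//; rewrite !lee_fin => G0 Gle.
rewrite sx se sY sZ -EFin_expe -!EFinD lee_fin.
apply: (@sqr_sum_le _ (K * A * U) (K * B * V2)) => //; try exact: small.
by apply: le_trans Gle _; rewrite le_eqVlt; apply/orP; left; apply/eqP; ring.
Qed.

End path_estimates.

(** * Convergence of the solutions *)

Theorem corollary2p5 (R : realType) (dO : measure_display)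
    (Omega : measurableType dO) (P : probability Omega R) (m d : nat)
    (T : \bar R) (T_gt0 : 0 < T)
    (W : Omega -> R -> 'cV[R]_d) (basisW : brownian_basis P T W)
    (u v : \bar R -> R)
    (mu_ : measurable_fun (times T) u) (mv_ : measurable_fun (times T) v)
    (u_L1 : Lpnorm T 1 u < +oo) (v_L2 : Lpnorm T 2%:E v < +oo)
    (g : Omega -> \bar R -> 'cV[R]_m -> 'M[R]_(m, d) -> 'cV[R]_m)
    (mg : measurable_generator P T W g)
    (g0_L2 : 'N[P]_2%:E [(fun w =>
       \int[lebesgue_measure]_(s in rtimes T)
         (enorm (g w s%:E 0%R 0%R))%:E)] < +oo)
    (K : R) (K_gt0 : (0 < K)%R)
    (g_lip : {ae (P \x @lebesgue_measure R), forall x : Omega * R,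
       rtimes T x.2 -> forall (y y' : 'cV[R]_m) (z z' : 'M[R]_(m, d)),
       (enorm (g x.1 x.2%:E y z - g x.1 x.2%:E y' z') <=
        K * (enorm (y - y') + enorm (z - z')))%R})
    (xi : Omega -> 'cV[R]_m) (mxi : measurable_wrt setT (bfilt P W T) xi)
    (xi_L2 : 'N[P]_2%:E [(fun w => (enorm (xi w))%:E)] < +oo)
    (alpha1 alpha2 : nat -> {finite_measure set (\bar R) -> \bar R})
    (supp1 : forall n, alpha1 n (~` delays T) = 0)
    (supp2 : forall n, alpha2 n (~` delays T) = 0)
    (small1 : forall n,
       (K ^+ 2)%:E * (alpha1 n (delays T)) ^+ 2 * (Lpnorm T 1 u) ^+ 2
         <= (25^-1)%:E)
    (small2 : forall n,
       (K ^+ 2)%:E * (alpha2 n (delays T)) ^+ 2 * (Lpnorm T 2%:E v) ^+ 2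
         <= (25^-1)%:E)
    (mass1 : alpha1 n (delays T) @[n --> \oo] --> 1)
    (mass2 : alpha2 n (delays T) @[n --> \oo] --> 1)
    (order1 : (forall n, measure_le (alpha1 n) (dirac (0 : \bar R))) \/
              (forall n, measure_le (dirac (0 : \bar R)) (alpha1 n)))
    (order2 : (forall n, measure_le (alpha2 n) (dirac (0 : \bar R))) \/
              (forall n, measure_le (dirac (0 : \bar R)) (alpha2 n)))
    (Yn : nat -> Omega -> \bar R -> 'cV[R]_m)
    (Zn : nat -> Omega -> \bar R -> 'M[R]_(m, d))
    (solYZn : forall n,
       delay_bsde_solution P T W g u v xi (alpha1 n) (alpha2 n) (Yn n) (Zn n))
    (Y : Omega -> \bar R -> 'cV[R]_m)
    (Z : Omega -> \bar R -> 'M[R]_(m, d))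
    (solYZ : nodelay_bsde_solution P T W g u v xi Y Z) :
  (S2norm P T (fun w t => Yn n w t - Y w t)%R @[n --> \oo] --> 0) /\
  (H2norm P T (fun w t => Zn n w t - Z w t)%R @[n --> \oo] --> 0).
Proof.
pose U := fine (Lpnorm T 1 u); pose V := fine (Lpnorm T 2%:E v).
pose a n := fine (alpha1 n (delays T)); pose b n := fine (alpha2 n (delays T)).
pose kap n : R := (9 * ((K * `|a n - 1| * U) ^+ 2 + (K * `|b n - 1| * V) ^+ 2))%R.
pose dY n : process Omega R m 1 := (fun w t => Yn n w t - Y w t)%R.
pose dZ n : process Omega R m d := (fun w t => Zn n w t - Z w t)%R.
have [YS ZH _] := solYZ.
have ord1 n : measure_le (alpha1 n) (dirac (0 : \bar R)) \/ measure_le (dirac (0 : \bar R)) (alpha1 n).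
  by case: order1 => h; [left|right]; exact: h.
have ord2 n : measure_le (alpha2 n) (dirac (0 : \bar R)) \/ measure_le (dirac (0 : \bar R)) (alpha2 n).
  by case: order2 => h; [left|right]; exact: h.
have mS (X : process Omega R m 1) : in_S2 P T W X -> measurable_fun setT (supsq T X).
  by move=> h; exact: (measurable_supsq T_gt0 basisW (in_S2_cproc basisW h)).
have mE (X : process Omega R m d) : in_H2 P T W X -> measurable_fun setT (energy T X).
  by move=> [pX _]; apply: measurable_energy => i j; exact: (predictable_joint T_gt0 basisW i j pX).
have Soo (X : process Omega R m 1) : in_S2 P T W X -> \int[P]_w supsq T X w < +oo.
  exact: (in_S2_supsq T_gt0).
have Eoo (X : process Omega R m d) : in_H2 P T W X -> \int[P]_w energy T X w < +oo.
  by move=> [_ hX]; rewrite -sqr_H2norm sqre_lty// H2norm_ge0.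
pose C := \int[P]_w supsq T Y w + \int[P]_w energy T Z w.
have C0 : 0 <= C.
  by apply: adde_ge0; apply: integral_ge0 => w _; [exact: supsq_ge0|exact: energy_ge0].
have Cfin : C \is a fin_num by rewrite ge0_fin_numE// lte_add_pinfty//; [exact: Soo|exact: Eoo].
have kap0 n : (0 <= kap n)%R by rewrite /kap mulr_ge0// addr_ge0// sqr_ge0.
have bound n : \int[P]_w supsq T (dY n) w + \int[P]_w energy T (dZ n) w <= (100 * kap n * fine C)%:E.
  have [YnS ZnH _] := solYZn n.
  pose B w := (kap n)%:E * (supsq T Y w + energy T Z w).
  have mSE : measurable_fun setT (fun w => supsq T Y w + energy T Z w).
    by apply: emeasurable_funD; [exact: mS|exact: mE].
  have SE0 w : 0 <= supsq T Y w + energy T Z w by rewrite adde_ge0// ?supsq_ge0// energy_ge0.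
  have mB : measurable_fun setT B by exact: measurable_funeM.
  have B0 w : 0 <= B w by rewrite mule_ge0// lee_fin.
  have intB : \int[P]_w B w = (kap n)%:E * C.
    rewrite ge0_integralZl ?lee_fin//; congr (_ * _); rewrite ge0_integralD//.
    - by move=> w _; exact: supsq_ge0.
    - exact: mS.
    - by move=> w _; exact: energy_ge0.
    - exact: mE.
  rewrite -mulrA EFinM EFinM fineK// -intB.
  have tm p q (X : process Omega R p q) w : predictable P T W X -> tmeas T X w.
    by move=> pX i j; exact: (predictable_path pX).
  have lip := ae_xsection g_lip.
  have g0oo : {ae P, forall w, \int[lebesgue_measure]_(s in rtimes T) (enorm (g w s%:E 0%R 0%R))%:E < +oo}.
    pose g0 w := \int[lebesgue_measure]_(s in rtimes T) (enorm (g w s%:E 0%R 0%R))%:E.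
    have g00 w : 0 <= g0 w by apply: integral_ge0 => s _; rewrite lee_fin enorm_ge0.
    have mg0 : measurable_fun setT g0 by exact: (measurable_generator0 T_gt0 basisW mg).
    have : \int[P]_w (g0 w ^+ 2) < +oo.
      have := sqre_lty (Lnorm_ge0 P 2%:E g0) g0_L2; rewrite unlock sqre_half; last first.
        by apply: integral_ge0 => w _; exact: poweR_ge0.
      by under eq_integral do rewrite gee0_abs// poweR2//.
    have mg2 : measurable_fun setT (fun w => g0 w ^+ 2).
      by under eq_fun do rewrite expe2; exact: emeasurable_funM.
    move=> /(ae_lty mg2 (fun w => expe_ge0 2 (g00 w))) h.
    apply: filterS h => w; rewrite -/(g0 w).
    by case: (g0 w) (g00 w) => [r| |]//= _; rewrite ?ltry// expe2 mulyy.
  have fin := ae_and (ae_and (ae_and (ae_lty (mS _ YnS) (supsq_ge0 T_gt0 _) (Soo _ YnS))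
      (ae_lty (mS _ YS) (supsq_ge0 T_gt0 _) (Soo _ YS)))
    (ae_and (ae_lty (mE _ ZnH) (energy_ge0 T _) (Eoo _ ZnH))
      (ae_lty (mE _ ZH) (energy_ge0 T _) (Eoo _ ZH)))) (ae_and lip g0oo).
  have pYn : predictable P T W (Yn n) by case: YnS.
  have pY : predictable P T W Y by case: YS.
  have pZn := ZnH.1; have pZ := ZH.1.
  have jZn i j := predictable_joint T_gt0 basisW i j pZn.
  have jZ i j := predictable_joint T_gt0 basisW i j pZ.
  have findY : {ae P, forall w, supsq T (dY n) w < +oo}.
    apply: ae_lty; [|exact: supsq_ge0|exact: (supsqB_lty T_gt0 basisW)].
    by apply: (measurable_supsq T_gt0 basisW); apply: cprocB; [exact: (in_S2_cproc basisW YnS)|exact: (in_S2_cproc basisW YS)].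
  have findZ : {ae P, forall w, energy T (dZ n) w < +oo}.
    apply: ae_lty; [|exact: energy_ge0|exact: (energyB_lty T_gt0 basisW)].
    by apply: measurable_energy; exact: jmeasB.
  have woo p q (X : process Omega R p q) w : supsq T X w < +oo -> tmeas T X w -> wnorm T u X w < +oo.
    move=> Xoo mX; apply: le_lt_trans (wnorm_le_supsq T_gt0 mu_ mX Xoo) _.
    apply: lte_mul_pinfty; [exact: Lnorm_ge0|by rewrite ge0_fin_numE// Lnorm_ge0|].
    exact: poweR_lty.
  have voo p q (X : process Omega R p q) w : energy T X w < +oo -> tmeas T X w -> wnorm T v X w < +oo.
    move=> Xoo mX; apply: le_lt_trans (wnorm_le_energy mv_ mX) _.
    apply: lte_mul_pinfty; [exact: Lnorm_ge0|by rewrite ge0_fin_numE// Lnorm_ge0|].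
    exact: poweR_lty.
  apply: (bsde_stability T_gt0 basisW (solYZn n) solYZ) => //.
  - apply: filterS fin => w [[[h1 h2] [h3 h4]] [h5 h6]].
    apply: (generator_integrable mg (ltW K_gt0) h5 h6).
      by apply: delay_mxintegrable => //; [exact: tm|apply: woo => //; exact: tm].
    by apply: delay_mxintegrable => //; [exact: tm|apply: voo => //; exact: tm].
  - apply: filterS fin => w [[[h1 h2] [h3 h4]] [h5 h6]].
    apply: (generator_integrable mg (ltW K_gt0) h5 h6).
      by apply: weight_mxintegrable => //; [exact: tm|apply: woo => //; exact: tm].
    by apply: weight_mxintegrable => //; [exact: tm|apply: voo => //; exact: tm].
  - apply: filterS (ae_and fin (ae_and findY findZ)) => w [[[[h1 h2] [h3 h4]] [h5 h6]] [h7 h8]].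
    by apply: (generator_delay_dist T_gt0 mg mu_ mv_ u_L1 v_L2 K_gt0) => //; exact: tm.
have kap_cvg : (100 * kap n * fine C)%R @[n --> \oo] --> (0 : R)%R.
  have ha : a n @[n --> \oo] --> (1 : R)%R by exact: (fine_cvg mass1).
  have hb : b n @[n --> \oo] --> (1 : R)%R by exact: (fine_cvg mass2).
  have sq (x : nat -> R) (c : R) : x n @[n --> \oo] --> (1 : R)%R ->
      ((K * `|x n - 1| * c) ^+ 2)%R @[n --> \oo] --> (0 : R)%R.
    move=> hx.
    have h1 : (K * `|x n - 1| * c)%R @[n --> \oo] --> (K * `|1 - 1| * c)%R.
      have h0 : `|x n - 1|%R @[n --> \oo] --> `|1 - 1 : R|%R.
        by apply: cvg_norm; apply: cvgB => //; exact: cvg_cst.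
      exact: (cvgM (cvgM (cvg_cst K) h0) (cvg_cst c)).
    have := cvgM h1 h1; rewrite subrr normr0 mulr0 mul0r mulr0 => h2.
    by under eq_fun do rewrite expr2; exact: h2.
  have h : ((K * `|a n - 1| * U) ^+ 2 + (K * `|b n - 1| * V) ^+ 2)%R @[n --> \oo] --> (0 + 0 : R)%R.
    exact: (cvgD (sq _ U ha) (sq _ V hb)).
  have h2 := cvgM (cvg_cst (100 * (9 * fine C))%R) h; rewrite addr0 mulr0 in h2.
  have -> : (fun n => 100 * kap n * fine C)%R = (fun n => 100 * (9 * fine C) *
      ((K * `|a n - 1| * U) ^+ 2 + (K * `|b n - 1| * V) ^+ 2))%R.
    by apply/funext => n; rewrite /kap; ring.
  exact: h2.
have small (e : R) : (0 < e)%R -> \forall n \near \oo, (100 * kap n * fine C <= e)%R.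
  move=> e0; near=> n; apply: ltW; near: n.
  exact: (cvgr_lt _ kap_cvg).
have SQ0 n : 0 <= \int[P]_w supsq T (dY n) w by apply: integral_ge0 => w _; exact: supsq_ge0.
have EN0 n : 0 <= \int[P]_w energy T (dZ n) w by apply: integral_ge0 => w _; exact: energy_ge0.
split.
  apply/cvge0_sqr; first by move=> n; exact: S2norm_ge0.
  under eq_fun do rewrite (sqr_S2norm P T_gt0).
  apply/cvge0P => // e e0; near=> n.
  apply: (@le_trans _ _ (100 * kap n * fine C)%:E); last by rewrite lee_fin; near: n; exact: small.
  by apply: le_trans (bound n); rewrite leeDl.
apply/cvge0_sqr; first by move=> n; exact: H2norm_ge0.
under eq_fun do rewrite sqr_H2norm.
apply/cvge0P => // e e0; near=> n.
apply: (@le_trans _ _ (100 * kap n * fine C)%:E); last by rewrite lee_fin; near: n; exact: small.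
by apply: le_trans (bound n); rewrite leeDr.
Unshelve. all: by end_near. Qed.
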